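(* Let $p\ge0$ be an integer, $f\in L^2(\Omega)$, $g\in H^{1/2}(\partial\Omega)$, $\psi_h^0\in V_h^p$, and let $\{\alpha^k\}_{k\ge1}$ be positive numbers. For every $k\ge 1$ (given $\psi_h^{k-1}\in V_h^p$): (i) there exists a unique $(\bm q_h^k,u_h^k,\psi_h^k)\in\bm\Sigma_{h,\mathrm{div}}^p\times V_h^p\times V_h^p$ such that $$\begin{aligned}\alpha^k(\nabla\cdot\bm q_h^k,v_h)+(\psi_h^k,v_h)&=\alpha^k(f,v_h)+(\psi_h^{k-1},v_h)&&\forall v_h\in V_h^p,\\ (A^{-1}\bm q_h^k,\bm v_h)-(\nabla\cdot\bm v_h,u_h^k)&=-\langle g,\bm v_h\cdot\bm n\rangle_{\partial\Omega}&&\forall\bm v_h\in\bm\Sigma_{h,\mathrm{div}}^p,\\ (u_h^k,q_h)-(\mathcal U(\psi_h^k),q_h)&=0&&\forall q_h\in V_h^p;\end{aligned}$$ (ii) there exists a unique $(\bm q_h,\psi_h)\in\bm\Sigma_{h,\mathrm{div}}^p\times V_h^p$ such that $$\begin{aligned}(A^{-1}\bm q_h,\bm v_h)-(\nabla\cdot\bm v_h,\mathcal U(\psi_h))&=-\langle g,\bm v_h\cdot\bm n\rangle_{\partial\Omega}&&\forall\bm v_h\in\bm\Sigma_{h,\mathrm{div}}^p,\\ \alpha^k(\nabla\cdot\bm q_h,v_h)+(\psi_h,v_h)&=\alpha^k(f,v_h)+(\psi_h^{k-1},v_h)&&\forall v_h\in V_h^p.\end{aligned}$$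
   Context: $\Omega\subset\mathbb{R}^d$, $d\in\{2,3\}$, is an open bounded polygonal/polyhedral domain with outward unit normal $\bm n$; $A\in L^\infty(\Omega;\mathbb{R}^{d\times d})$ is symmetric with eigenvalues uniformly bounded below and above by positive constants. $(\cdot,\cdot)$ is the $L^2(\Omega)$ inner product and $\langle\cdot,\cdot\rangle_{\partial\Omega}$ the $L^2(\partial\Omega)$ pairing. $\underline u,\overline u\in H^1(\Omega)\cap C(\overline\Omega)$ with $\underline u\le\overline u$ (also $\overline u=+\infty$ is allowed). $\Upsilon:\Omega\times\mathbb{R}\to\mathbb{R}$ is a Carathéodory function such that for a.e. $x$, $\Upsilon(x,\cdot)$ is a (smooth) increasing bijection from $\mathbb{R}$ onto $(\underline u(x),\overline u(x))$, and $\mathcal U(\psi)(x)=\Upsilon(x,\psi(x))$; it is understood that $\mathcal U$ maps $L^\infty(\Omega)$ into $L^\infty(\Omega)$ so that the integrals make sense. $\mathcal T_h$ is a conforming shape-regular partition of $\Omega$ into elements $T$, each the image of a reference element $\hat T$ (a simplex, or a square/cube) under an affine map $\Phi_T$. $\mathcal P_p(\hat T)$ denotes polynomials of total degree $\le p$ if $\hat T$ is a simplex, and of degree $\le p$ in each variable if $\hat T$ is a square/cube. $\mathrm{RT}_p(\hat T)$ is the Raviart–Thomas space: $[\mathcal P_p(\hat T)]^d+\mathbf x\,\mathcal P_p(\hat T)$ on simplices, and on squares/cubes the standard tensor-product version (the $i$-th component has degree $\le p+1$ in $x_i$ and $\le p$ in the others). $\bm\Sigma_h^p=\{\mathbf r_h\in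 L^2(\Omega)^d:\mathbf r_h|_T=\frac1{\det\Phi_T'}\Phi_T'\hat{\mathbf r}\circ\Phi_T^{-1},\ \hat{\mathbf r}\in\mathrm{RT}_p(\hat T)\ \forall T\}$, $\bm\Sigma_{h,\mathrm{div}}^p=\bm\Sigma_h^p\cap H(\mathrm{div};\Omega)$, $V_h^p=\{v_h\in L^2(\Omega):v_h|_T=\hat v\circ\Phi_T^{-1},\ \hat v\in\mathcal P_p(\hat T)\ \forall T\}$. *)

(* Defs.v *)
From HB Require Import structures.
From mathcomp Require Import all_boot all_order all_algebra.
From mathcomp Require Import all_classical all_reals all_analysis.
From mathcomp Require Import measurable_realfun.

Set Implicit Arguments.
Unset Strict Implicit.
Unset Printing Implicit Defensive.

Import Order.TTheory GRing.Theory Num.Theory.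
Import numFieldNormedType.Exports.

Local Open Scope classical_set_scope.
Local Open Scope ring_scope.

(* The sigma-algebra generated by the entries; for real matrices it is the
   Borel sigma-algebra. *)
Section matrix_measurable.
Context (R : realType) (m n : nat).

Definition mx_cylinder : set (set 'M[R]_(m, n)) :=
  [set B | exists i j, exists2 A : set R,
     measurable A & B = (fun M : 'M[R]_(m, n) => M i j) @^-1` A].

Definition mx_measurable : set (set 'M[R]_(m, n)) := <<s mx_cylinder >>.

Let mx_measurable0 : mx_measurable set0.
Proof. exact: sigma_algebra0. Qed.

Let mx_measurableC A : mx_measurable A -> mx_measurable (~` A).
Proof. exact: sigma_algebraC. Qed.

Let mx_measurable_bigcup (F : (set 'M[R]_(m, n))^nat) :
  (forall i, mx_measurable (F i)) -> mx_measurable (\bigcup_i (F i)).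
Proof. exact: sigma_algebra_bigcup. Qed.

HB.instance Definition _ := @isMeasurable.Build default_measure_display
  'M[R]_(m, n) mx_measurable mx_measurable0 mx_measurableC mx_measurable_bigcup.

Lemma measurable_entry i j :
  measurable_fun [set: 'M[R]_(m, n)] (fun M : 'M[R]_(m, n) => M i j).
Proof.
by move=> _ A mA; rewrite setTI; apply: sub_sigma_algebra; exists i, j, A.
Qed.

Lemma measurable_fun_mxP d (T : measurableType d) (f : T -> 'M[R]_(m, n)) :
  (forall i j, measurable_fun [set: T] (fun x => f x i j)) ->
  measurable_fun [set: T] f.
Proof.
move=> mf; apply: (@measurability _ _ _ _ _ _ mx_cylinder erefl).
by move=> _ [_ [i [j [A mA ->]]] <-]; exact: mf.
Qed.

End matrix_measurable.

Section lebesgue_cV.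
Context (R : realType).

Section step.
Context (n : nat).

Definition cons_cV (p : R * 'cV[R]_n) : 'cV[R]_n.+1 :=
  \col_i oapp (p.2 ^~ ord0) p.1 (unlift ord0 i).

Let uncons_cV (v : 'cV[R]_n.+1) : R * 'cV[R]_n :=
  (v ord0 ord0, \col_i v (lift ord0 i) ord0).

Let cons_cVK : cancel cons_cV uncons_cV.
Proof.
case=> t v; rewrite /uncons_cV /cons_cV !mxE unlift_none /=; congr pair.
by apply/colP => i; rewrite !mxE liftK.
Qed.

Lemma measurable_cons_cV : measurable_fun [set: R * 'cV[R]_n] cons_cV.
Proof.
apply: measurable_fun_mxP => i j.
under eq_fun do rewrite mxE.
case: unliftP => [k|] _ /=; last exact: measurable_fst.
exact: (measurableT_comp (measurable_entry k ord0) measurable_snd).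
Qed.

Let measurable_uncons_cV : measurable_fun [set: 'cV[R]_n.+1] uncons_cV.
Proof.
apply/measurable_fun_pairP; split; first exact: measurable_entry.
apply: measurable_fun_mxP => i j /=.
by under eq_fun do rewrite mxE; exact: measurable_entry.
Qed.

Variable mu : {sigma_finite_measure set 'cV[R]_n -> \bar R}.

Definition lebesgue_step : set 'cV[R]_n.+1 -> \bar R :=
  pushforward (@lebesgue_measure R \x mu)%E cons_cV.

Let lebesgue_step0 : lebesgue_step set0 = 0%E.
Proof. by rewrite /lebesgue_step /pushforward preimage_set0 measure0. Qed.

Let lebesgue_step_ge0 A : (0 <= lebesgue_step A)%E.
Proof. by apply: measure_ge0; exact: measurable_cons_cV. Qed.

Let lebesgue_step_sigma_additive : semi_sigma_additive lebesgue_step.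
Proof. by apply: measure_semi_sigma_additive; exact: measurable_cons_cV. Qed.

HB.instance Definition _ := isMeasure.Build _ _ _ lebesgue_step
  lebesgue_step0 lebesgue_step_ge0 lebesgue_step_sigma_additive.

Let lebesgue_step_sigma_finite : sigma_finite setT lebesgue_step.
Proof.
have /sigma_finiteP[F [TF ndF Foo]] := sigma_finiteT (@lebesgue_measure R).
have /sigma_finiteP[G [TG ndG Goo]] := sigma_finiteT mu.
exists (fun k => uncons_cV @^-1` (F k `*` G k)) => [|k].
  rewrite -preimage_bigcup; apply/esym; rewrite -subTset => v _ /=.
  have [i _ Fi] : (\bigcup_k F k) (uncons_cV v).1 by rewrite -TF.
  have [j _ Gj] : (\bigcup_k G k) (uncons_cV v).2 by rewrite -TG.
  exists (maxn i j) => //; split.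
    by move: Fi; exact/subsetPset/ndF/leq_maxl.
  by move: Gj; exact/subsetPset/ndG/leq_maxr.
have [mFk Fkoo] := Foo k; have [mGk Gkoo] := Goo k; split.
  by rewrite -[X in measurable X]setTI; apply: measurable_uncons_cV => //;
    exact: measurableX.
rewrite /lebesgue_step /pushforward -comp_preimage.
rewrite (_ : uncons_cV \o cons_cV = id).
  by rewrite preimage_id product_measure1E// lte_mul_pinfty// ge0_fin_numE.
by apply/funext => p; exact: cons_cVK.
Qed.

HB.instance Definition _ := Measure_isSigmaFinite.Build _ _ _ lebesgue_step
  lebesgue_step_sigma_finite.

End step.

Fixpoint lebesgue_cV n : {sigma_finite_measure set 'cV[R]_n -> \bar R} :=
  match n with
  | 0 => dirac (0 : 'cV[R]_0)
  | n'.+1 => lebesgue_step (lebesgue_cV n')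
  end.

End lebesgue_cV.

Section euclidean.
Context (R : realType) (d : nat).
Implicit Types (x y u v nu : 'cV[R]_d) (h : 'cV[R]_d * R).

Definition dot u v : R := \sum_i u i ord0 * v i ord0.

Definition enorm u : R := Num.sqrt (dot u u).

Lemma measurable_dot nu : measurable_fun [set: 'cV[R]_d] (dot nu).
Proof.
apply: measurable_sum => i; apply: measurable_funM => //.
exact: measurable_entry.
Qed.

Definition hyperplane h : set 'cV[R]_d := [set x | dot h.1 x = h.2].

Definition hproj h x : 'cV[R]_d := x - (dot h.1 x - h.2) *: h.1.

Lemma measurable_hproj h : measurable_fun [set: 'cV[R]_d] (hproj h).
Proof.
apply: measurable_fun_mxP => i j; under eq_fun do rewrite !mxE.
apply: measurable_funB; first exact: measurable_entry.
apply: measurable_funM => //; apply: measurable_funB => //.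
exact: measurable_dot.
Qed.

Definition slab h : set 'cV[R]_d := [set x | 0 <= dot h.1 x - h.2 <= 1].

(* For a unit vector [h.1], the (d-1)-dimensional Lebesgue (equivalently,
   Hausdorff) measure on [hyperplane h]: the area of a subset of the hyperplane
   is the volume of the prism of height 1 over it. *)
Definition hyperplane_measure h (A : set 'cV[R]_d) : \bar R :=
  lebesgue_cV R d (slab h `&` hproj h @^-1` A).

Lemma measurable_slab h : measurable (slab h).
Proof.
rewrite (_ : slab h = (fun x => dot h.1 x - h.2) @^-1` `[0, 1]%classic).
  rewrite -[X in measurable X]setTI; apply: measurable_funB => //.
  exact: measurable_dot.
by apply/seteqP; split=> x; rewrite /= in_itv.
Qed.

Let hyperplane_measure0 h : hyperplane_measure h set0 = 0%E.
Proof. by rewrite /hyperplane_measure preimage_set0 setI0 measure0. Qed.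

Let hyperplane_measure_ge0 h A : (0 <= hyperplane_measure h A)%E.
Proof. exact: measure_ge0. Qed.

Let hyperplane_measure_sigma_additive h :
  semi_sigma_additive (hyperplane_measure h).
Proof.
have mproj A : measurable A -> measurable (slab h `&` hproj h @^-1` A).
  move=> mA; apply: measurableI; first exact: measurable_slab.
  by rewrite -[X in measurable X]setTI; exact: measurable_hproj.
move=> F mF tF mUF; rewrite /hyperplane_measure preimage_bigcup setI_bigcupr.
apply: measure_semi_sigma_additive => [n||]; first exact: mproj.
  apply/trivIsetP => i j _ _ ij.
  have FF : F i `&` F j = set0 by move/trivIsetP : tF; exact.
  rewrite -subset0 => x [[_ Fi] [_ Fj]].
  by have : (F i `&` F j) (hproj h x) by []; rewrite FF.
by rewrite -setI_bigcupr -preimage_bigcup; exact: mproj.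
Qed.

HB.instance Definition _ h := isMeasure.Build _ _ _ (hyperplane_measure h)
  (hyperplane_measure0 h) (hyperplane_measure_ge0 h)
  (@hyperplane_measure_sigma_additive h).

(* Restricted to a set covered by the hyperplanes of [hs], listed without
   repetition and with unit normals, this is the (d-1)-dimensional surface
   measure: distinct hyperplanes meet in negligible sets. *)
Definition surface_measure (hs : seq ('cV[R]_d * R)) :
    {measure set 'cV[R]_d -> \bar R} :=
  msum (fun i => hyperplane_measure (nth (0, 0) hs i)) (size hs).

Definition bdry (Om : set 'cV[R]_d) : set 'cV[R]_d := closure Om `\` interior Om.

(* [hs] lists hyperplanes covering the boundary, each of them once.
   The condition [Om = interior (closure Om)] excludes cracks, along which there would be no
   outward normal. *)
Definition polyhedral_domain (Om : set 'cV[R]_d) (hs : seq ('cV[R]_d * R)) :=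
  [/\ open Om, Om !=set0, connected Om, bounded_set Om & Om = interior (closure Om)]
  /\ [/\ forall h, h \in hs -> enorm h.1 = 1,
         forall i j, (i < size hs)%N -> (j < size hs)%N ->
           hyperplane (nth (0, 0) hs i) = hyperplane (nth (0, 0) hs j) -> i = j
       & bdry Om `<=` [set x | exists2 h, h \in hs & hyperplane h x]].

(* A default value is used at the (negligibly many) boundary points near which
   [Om] is not a half-space. *)
Definition outward_normal (Om : set 'cV[R]_d) (x : 'cV[R]_d) : 'cV[R]_d :=
  xget 0 [set nu | enorm nu = 1 /\ \forall y \near x, Om y <-> dot nu (y - x) < 0].

End euclidean.

(* Elements of Lebesgue and Sobolev spaces are represented by (Borel)
   measurable functions on the whole of [R^d], considered only on [Om] and up
   to equality almost everywhere. *)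
Section spaces.
Context (R : realType) (d : nat) (Om : set 'cV[R]_d).
Implicit Types (u v w phi psi : 'cV[R]_d -> R) (q r : 'cV[R]_d -> 'cV[R]_d).

Local Notation leb := (lebesgue_cV R d).

Definition ae_on (P : 'cV[R]_d -> Prop) := \forall x \ae leb, Om x -> P x.

Definition inL2 u :=
  measurable_fun Om u /\ leb.-integrable Om (fun x => ((u x) ^+ 2)%:E).

Definition inL2v q := forall i, inL2 (fun x => q x i ord0).

Definition inLinfty u :=
  measurable_fun Om u /\ exists M : R, ae_on (fun x => `|u x| <= M).

Definition ip u v : R := \int[leb]_(x in Om) (u x * v x).

Definition ipv q r : R := \int[leb]_(x in Om) dot (q x) (r x).

Definition pderiv (i : 'I_d) (phi : 'cV[R]_d -> R) : 'cV[R]_d -> R :=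
  fun x => 'D_(delta_mx i ord0) phi x.

Definition smooth phi := forall s : seq 'I_d,
  continuous (foldr pderiv phi s) /\
  forall i x, derivable (foldr pderiv phi s) x (delta_mx i ord0).

Definition test_function phi := smooth phi /\
  exists K, [/\ compact K, K `<=` Om & forall x, ~ K x -> phi x = 0].

Definition weak_pderiv i u w := inL2 w /\
  forall phi, test_function phi -> ip u (pderiv i phi) = - ip w phi.

Definition inH1 u := inL2 u /\ forall i, exists w, weak_pderiv i u w.

Definition weak_div q w := inL2 w /\
  forall phi, test_function phi ->
    ipv q (fun x => \col_i pderiv i phi x) = - ip w phi.

Definition inHdiv q := inL2v q /\ exists w, weak_div q w.

(* The weak divergence of [q \in H(div)], unique almost everywhere. *)
Definition wdiv q : 'cV[R]_d -> R := xget (cst 0) [set w | weak_div q w].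

End spaces.

Section data.
Context (R : realType) (d : nat) (Om : set 'cV[R]_d).

(* The Sobolev-Slobodeckij space [H^{1/2}] of the (d-1)-dimensional boundary:
   the exponent of the kernel is (d - 1) + 2 * 1/2 = d. *)
Definition inH12_bdry (hs : seq ('cV[R]_d * R)) (g : 'cV[R]_d -> R) :=
  let sigma := surface_measure hs in
  [/\ measurable_fun (bdry Om) g,
      sigma.-integrable (bdry Om) (fun x => ((g x) ^+ 2)%:E)
    & (\int[sigma]_(x in bdry Om) \int[sigma]_(y in bdry Om)
         ((g x - g y) ^+ 2 / enorm (x - y) ^+ d)%:E < +oo)%E].

Definition elliptic_coeff (A : 'cV[R]_d -> 'M[R]_d) :=
  [/\ forall i j, inLinfty Om (fun x => A x i j),
      ae_on Om (fun x => (A x)^T = A x)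
    & exists a0 a1 : R, 0 < a0 /\
        ae_on Om (fun x => forall l, eigenvalue (A x) l -> a0 <= l <= a1)].

Definition inH1C (u : 'cV[R]_d -> R) :=
  inH1 Om u /\ {within closure Om, continuous u}.

(* [ub = None] stands for the upper obstacle [+oo]. *)
Definition obstacles (lb : 'cV[R]_d -> R) (ub : option ('cV[R]_d -> R)) :=
  inH1C lb /\
  if ub is Some w then inH1C w /\ (forall x, closure Om x -> lb x <= w x)
  else True.

Definition upper (ub : option ('cV[R]_d -> R)) (x : 'cV[R]_d) : \bar R :=
  if ub is Some w then (w x)%:E else +oo%E.

Definition superposition (Ups : 'cV[R]_d -> R -> R) (psi : 'cV[R]_d -> R) :
  'cV[R]_d -> R := fun x => Ups x (psi x).

Definition latent_map lb ub (Ups : 'cV[R]_d -> R -> R) :=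
  [/\ forall t, measurable_fun Om (Ups ^~ t),
      ae_on Om (fun x => continuous (Ups x)),
      ae_on Om (fun x => [/\
        forall n t, derivable (derive1n n (Ups x)) t 1,
        {homo Ups x : s t / s < t} &
        set_bij [set: R] [set y | ((lb x)%:E < y%:E < upper ub x)%E] (Ups x)])
    & forall psi, inLinfty Om psi -> inLinfty Om (superposition Ups psi)].

End data.

Inductive ref_shape := Simplex | Cube.

(* Each element has its own reference shape; a single reference element for the
   whole mesh corresponds to a constant [mesh_shape]. *)
Record mesh (R : realType) (d : nat) := Mesh {
  mesh_elt : finType;
  mesh_shape : mesh_elt -> ref_shape;
  mesh_lin : mesh_elt -> 'M[R]_d;
  mesh_vec : mesh_elt -> 'cV[R]_d
}.

Section discrete.
Context (R : realType) (d : nat).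
Implicit Types (s : ref_shape) (q r : 'cV[R]_d -> 'cV[R]_d).

Definition ref_elt s : set 'cV[R]_d :=
  match s with
  | Simplex => [set x | (forall i, 0 <= x i ord0) /\ (\sum_i x i ord0) <= 1]
  | Cube => [set x | forall i, 0 <= x i ord0 <= 1]
  end.

(* [K] is a closed convex polytope below: these are its faces of all
   dimensions, including [set0] and [K]. *)
Definition is_face (K F : set 'cV[R]_d) :=
  [/\ F `<=` K,
      forall x y (t : R), F x -> F y -> 0 <= t <= 1 ->
        F (t *: x + (1 - t) *: y)
    & forall x y (t : R), K x -> K y -> 0 < t < 1 ->
        F (t *: x + (1 - t) *: y) -> F x /\ F y].

(* Polynomial functions with exponents at most [N], restricted to the
   multi-indices in [S]. *)
Definition polyfun N (S : pred {ffun 'I_d -> 'I_N.+1}) (f : 'cV[R]_d -> R) :=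
  exists c : {ffun 'I_d -> 'I_N.+1} -> R,
    forall x, f x = \sum_(a | S a) c a * \prod_i x i ord0 ^+ a i.

Definition Pref p s : set ('cV[R]_d -> R) :=
  match s with
  | Simplex => polyfun (fun a : {ffun 'I_d -> 'I_p.+1} => (\sum_i a i <= p)%N)
  | Cube => polyfun (fun _ : {ffun 'I_d -> 'I_p.+1} => true)
  end.

(* On the cube, component [i] has degree at most [p + 1] in [x_i] and at most
   [p] in the other variables. *)
Definition RTref p s : set ('cV[R]_d -> 'cV[R]_d) :=
  match s with
  | Simplex => [set r | exists (a : 'I_d -> 'cV[R]_d -> R) b,
      [/\ forall i, Pref p Simplex (a i), Pref p Simplex b
        & forall x, r x = (\col_i a i x) + b x *: x]]
  | Cube => [set r | forall i,
      polyfun (fun a : {ffun 'I_d -> 'I_p.+2} =>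
                 [forall j, (a j <= p + (j == i))%N])
              (fun x => r x i ord0)]
  end.

Variables (Om : set 'cV[R]_d) (M : mesh R d).
Implicit Types T : mesh_elt M.

Definition mesh_map T (x : 'cV[R]_d) := mesh_lin T *m x + mesh_vec T.

Definition mesh_inv T (x : 'cV[R]_d) := invmx (mesh_lin T) *m (x - mesh_vec T).

Definition elem T : set 'cV[R]_d := mesh_map T @` ref_elt (mesh_shape T).

Definition conforming :=
  [/\ forall T, mesh_lin T \in unitmx,
      closure Om = \bigcup_T elem T,
      forall T T', T != T' -> interior (elem T) `&` interior (elem T') = set0
    & forall T T', is_face (elem T) (elem T `&` elem T') /\
                   is_face (elem T') (elem T `&` elem T')].

Definition shape_regular (kappa : R) := forall T, exists x rho,
  [/\ 0 < rho, [set y | enorm (y - x) <= rho] `<=` elem T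
    & forall y z, elem T y -> elem T z -> enorm (y - z) <= kappa * rho].

Definition Vh p (v : 'cV[R]_d -> R) := inL2 Om v /\
  forall T, exists2 vh, Pref p (mesh_shape T) vh &
    ae_on (elem T) (fun x => v x = vh (mesh_inv T x)).

Definition Sigmah p q := inL2v Om q /\
  forall T, exists2 rh, RTref p (mesh_shape T) rh &
    ae_on (elem T) (fun x =>
      q x = (\det (mesh_lin T))^-1 *: (mesh_lin T *m rh (mesh_inv T x))).

Definition Sigmah_div p q := Sigmah p q /\ inHdiv Om q.

(* The continuous representative on the closed element [T] of [q|_T]. *)
Definition elem_trace q T : 'cV[R]_d -> 'cV[R]_d :=
  xget (cst 0) [set w | {within elem T, continuous w} /\
                        ae_on (elem T) (fun x => w x = q x)].

(* The pairing [<g, q . n>] on the boundary of [Om]: since elements meet the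
   boundary in sets that overlap in negligible sets only, it is the sum of the
   contributions of the elements. *)
Definition bdry_pairing hs (g : 'cV[R]_d -> R) q : R :=
  \sum_(T : mesh_elt M)
    \int[surface_measure hs]_(x in bdry Om `&` elem T)
      (g x * dot (elem_trace q T x) (outward_normal Om x)).

End discrete.

Section problems.
Context (R : realType) (d : nat) (Om : set 'cV[R]_d) (hs : seq ('cV[R]_d * R))
  (A : 'cV[R]_d -> 'M[R]_d) (Ups : 'cV[R]_d -> R -> R) (M : mesh R d) (p : nat)
  (f g : 'cV[R]_d -> R) (alpha : R) (psi0 : 'cV[R]_d -> R).
Implicit Types (q : 'cV[R]_d -> 'cV[R]_d) (u psi : 'cV[R]_d -> R).

Definition mixed_solution q u psi :=
  [/\ Sigmah_div Om M p q, Vh Om M p u & Vh Om M p psi] /\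
  [/\ forall v, Vh Om M p v ->
        alpha * ip Om (wdiv Om q) v + ip Om psi v =
        alpha * ip Om f v + ip Om psi0 v,
      forall v, Sigmah_div Om M p v ->
        ipv Om (fun x => invmx (A x) *m q x) v - ip Om (wdiv Om v) u =
        - bdry_pairing Om M hs g v
    & forall w, Vh Om M p w ->
        ip Om u w - ip Om (superposition Ups psi) w = 0].

Definition reduced_solution q psi :=
  [/\ Sigmah_div Om M p q, Vh Om M p psi,
      forall v, Sigmah_div Om M p v ->
        ipv Om (fun x => invmx (A x) *m q x) v -
          ip Om (wdiv Om v) (superposition Ups psi) =
        - bdry_pairing Om M hs g v
    & forall v, Vh Om M p v ->
        alpha * ip Om (wdiv Om q) v + ip Om psi v =
        alpha * ip Om f v + ip Om psi0 v].

End problems.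

(* Main.v *)
(* In an [L^2]-orthonormal basis of [V_h] and a basis of [Sigma_h] orthonormal
   for [(A^-1 q, r)], the first equation expresses the coordinates of [psi] by
   those of [q], and the third one those of [u] by those of [psi]. What remains
   is an equation [N c = 0] for the coordinates [c] of [q], where [N] is
   continuous and, [U] being monotone, strongly monotone with constant 1. Such
   an [N] has a zero: solve for the coordinates one after the other by the
   intermediate value theorem, strong monotonicity making each partial solution
   depend continuously on the remaining coordinates. Uniqueness is the usual
   testing of the difference of two solutions with itself.

   Problem (ii) is equivalent to (i) because [div Sigma_h] lies in [V_h], so that
   [U psi] may be replaced by its [L^2] projection [u]; the inclusion compares
   weak and elementwise divergences through integration by parts against smooth
   bumps supported in boxes inside the elements.

   Functions are not identified when they agree almost everywhere, so linear
   algebra is done on spaces with a semidefinite inner product, whose null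
   vectors are the functions vanishing almost everywhere. *)
Require Import Defs.
From mathcomp Require Import all_boot all_order all_algebra.
From mathcomp Require Import all_classical all_reals all_analysis.
From mathcomp Require Import measurable_realfun ring lra.

Set Implicit Arguments.
Unset Strict Implicit.
Unset Printing Implicit Defensive.

Import Order.TTheory GRing.Theory Num.Theory.
Import numFieldNormedType.Exports.

Local Open Scope classical_set_scope.
Local Open Scope ring_scope.

(** * Monotone maps and the abstract mixed problem *)

(** In a basis orthonormal for [(A^-1 q, r)] the linear part of [N] is the identity. Since [psi]
    depends on [q] through [- alpha] times the transpose of the matrix coupling [q] to [u], the
    nonlinear part contributes [alpha^-1] times a monotonicity product of [U], which is nonnegative.
    Hence the constant 1, whatever the mesh and [alpha]. The nonlinearity acts on bounded functions,
    so continuity of [N] rests on [V_h] lying in [L^infty]: convergent coordinates keep all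
    arguments of [Ups x] between two constants, and monotonicity of [Ups x] then supplies a
    dominating function. Passing from basis vectors to all test functions requires every functional
    to vanish on null vectors. For the boundary pairing this has content: the boundary has volume
    zero, so equality almost everywhere inside does not by itself reach it. The pairing is
    controlled through continuous representatives on closed elements, which agree everywhere once
    they agree almost everywhere. Similarly, the weak divergence is a chosen function, and its
    identities rest on uniqueness almost everywhere. *)

Section strongly_monotone.
Context (R : realType).

(** For [c = |h 0|], comparison with the point 0 gives [h c >= h 0 + c >= 0] and
    [h (- c) <= h 0 - c <= 0], so the intermediate value theorem applies on [[-c, c]]. *)
Lemma strongly_monotone_zero1 (h : R -> R) : continuous h ->
  (forall s t, (t - s) ^+ 2 <= (h t - h s) * (t - s)) -> exists t, h t = 0.
Proof.
move=> ch hm; pose c := `|h 0|.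
have c0 : 0 <= c by exact: normr_ge0.
have [c00|cn0] := eqVneq c 0; first by exists 0; apply/normr0_eq0.
have cp : 0 < c by rewrite lt_def cn0.
have hc : 0 <= h c.
  have := hm 0 c; rewrite subr0 expr2 ler_pM2r// => H.
  have := ler_norm (- h 0); rewrite normrN -/c; lra.
have hNc : h (- c) <= 0.
  have := hm 0 (- c); rewrite subr0 sqrrN expr2 mulrN -mulNr ler_pM2r// => H.
  have := ler_norm (h 0); rewrite -/c; lra.
have [|||t _ ht] := @IVT R h (- c) c 0.
- lra.
- exact: continuous_subspaceT.
- by rewrite ge_min hNc le_max hc orbT.
by exists t.
Qed.

Lemma cvg_sum_ord n (f : nat -> 'I_n -> R) (l : 'I_n -> R) :
  (forall i, f k i @[k --> \oo] --> l i) ->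
  (\sum_i f k i) @[k --> \oo] --> \sum_i l i.
Proof. by move=> fl; apply: cvg_big => // [[x y]]; exact: add_continuous. Qed.

Lemma cvg_sqr_le (a b e : nat -> R) (l : R) :
  (forall k, (a k - b k) ^+ 2 <= e k) -> e k @[k --> \oo] --> 0 ->
  b k @[k --> \oo] --> l -> a k @[k --> \oo] --> l.
Proof.
move=> abe e0 bl.
suff ab0 : (a k - b k) @[k --> \oo] --> (0 : R).
  have -> : a = (fun k => (a k - b k) + b k).
    by apply/funext => k; rewrite subrK.
  by rewrite -[l]add0r; exact: cvgD.
apply: (@norm_cvg0 _ R^o).
have s0 : Num.sqrt (e k) @[k --> \oo] --> (0 : R).
  rewrite -[X in _ --> X]sqrtr0; apply: continuous_cvg e0.
  exact: sqrt_continuous.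
apply: (@squeeze_cvgr _ _ _ _ (fun=> 0) (fun k => Num.sqrt (e k))) => //.
  near=> k; rewrite normr_ge0/= -sqrtr_sqr ler_wsqrtr//.
exact: cvg_cst.
Unshelve. all: by end_near. Qed.

Context (n : nat).
Implicit Types (N : ('I_n -> R) -> 'I_n -> R) (x y z : 'I_n -> R).

Definition coord_cvg (u : nat -> 'I_n -> R) z := forall i, u k i @[k --> \oo] --> z i.

Lemma strongly_monotone_zero N :
  (forall u z, coord_cvg u z -> coord_cvg (N \o u) (N z)) ->
  (forall x y, \sum_i (x i - y i) ^+ 2 <= \sum_i (N x i - N y i) * (x i - y i)) ->
  exists x, forall i, N x i = 0.
Proof.
move=> cN mN.
(* The first [k] coordinates are solved for in terms of the others. *)
suff H k : (k <= n)%N -> forall z, exists y,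
    (forall i : 'I_n, (k <= i)%N -> y i = z i) /\
    (forall i : 'I_n, (i < k)%N -> N y i = 0).
  have [y [_ y0]] := H n (leqnn n) (fun=> 0).
  by exists y => i; apply: y0.
elim: k => [_ z|k IH kn z]; first by exists z.
pose i0 := Ordinal kn.
have IH' := IH (ltnW kn).
pose zt t := fun i : 'I_n => if i == i0 then t else z i.
(* [Y t] solves the first [k] equations with coordinate [k] frozen at [t] and the later coordinates
   at those of [z]. *)
pose Y t := sval (cid (IH' (zt t))).
have Yz t (i : 'I_n) : (k <= i)%N -> Y t i = zt t i.
  by rewrite /Y; case: cid => y [] /= + _; exact.
have Y0 t (i : 'I_n) : (i < k)%N -> N (Y t) i = 0.
  by rewrite /Y; case: cid => y [] /= _; exact.
have cY (u : nat -> R) t : u m @[m --> \oo] --> t -> coord_cvg (Y \o u) (Y t).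
  move=> ut.
  (* [w m] takes the first [k] coordinates from the limit [Y t] and the others from [Y (u m)]. It
     converges to [Y t], so the first [k] components of [N (w m)] tend to 0. *)
  pose w m := fun i : 'I_n => if (i < k)%N then Y t i else zt (u m) i.
  have cw : coord_cvg w (Y t).
    move=> i; rewrite /w; case: ltnP => ik; first exact: cvg_cst.
    rewrite Yz// /zt; case: eqP => _ //; exact: cvg_cst.
  have cNw := cN _ _ cw.
  pose e m := \sum_(i < n) (if (i < k)%N then N (w m) i ^+ 2 else 0).
  have e0 : e m @[m --> \oo] --> 0.
    rewrite [X in _ --> X](_ : _ = \sum_(i < n) 0); last by rewrite big1.
    apply: cvg_sum_ord => i; case: ltnP => ik; last exact: cvg_cst.
    have := cNw i; rewrite (Y0 _ _ ik) => Ni0.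
    rewrite (_ : 0 = (0 : R) ^+ 2); last by rewrite expr0n.
    by under eq_fun do rewrite expr2; rewrite expr2; exact: (cvgM Ni0 Ni0).
  move=> i; apply: (@cvg_sqr_le _ (w ^~ i) e) => // m.
  (* [Y (u m)] and [w m] differ only in the first [k] coordinates, where [N (Y (u m))] vanishes;
     strong monotonicity and Young's inequality then bound their squared distance by [e m]. *)
  have S : \sum_i (Y (u m) i - w m i) ^+ 2 <= e m.
    have := mN (Y (u m)) (w m).
    set S := \sum_i _ => le1.
    suff le2 : \sum_i (N (Y (u m)) i - N (w m) i) * (Y (u m) i - w m i) <=
        2^-1 * e m + 2^-1 * S by lra.
    rewrite /S /e !mulr_sumr -big_split/=; apply: ler_sum => j _.
    case: ltnP => jk.
      rewrite Y0// sub0r.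
      have := sqr_ge0 (N (w m) j + (Y (u m) j - w m j)).
      by set a := N _ _; set b := _ - _; nra.
    by rewrite /w ltnNge jk/= Yz// subrr mulr0 expr0n/= !mulr0 addr0.
  apply: le_trans S; rewrite (bigD1 i)//= lerDl.
  by apply: sumr_ge0 => *; exact: sqr_ge0.
(* The scalar map inherits strong monotonicity: in the product for [Y t] and [Y s], the first [k]
   terms vanish because the equations are solved, and the terms after [i0] because the coordinates
   coincide. *)
have [||t ht] := @strongly_monotone_zero1 (fun t => N (Y t) i0).
- move=> t; apply/continuous_withinNx; apply/cvgr_dnbhsP => u [_ ut].
  exact: (cN _ _ (cY _ _ ut) i0).
- move=> s t; have := mN (Y t) (Y s).
  have -> : \sum_i (N (Y t) i - N (Y s) i) * (Y t i - Y s i) =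
      (N (Y t) i0 - N (Y s) i0) * (t - s).
    rewrite (bigD1 i0)//= big1 ?addr0.
      by rewrite !Yz ?leqnn// /zt eqxx.
    move=> j ji0; have [jk|kj] := ltnP j k.
      by rewrite !Y0// subrr mul0r.
    by rewrite !Yz// /zt (negbTE ji0) subrr mulr0.
  apply: le_trans; rewrite (bigD1 i0)//= !Yz ?leqnn// /zt eqxx lerDl.
  by apply: sumr_ge0 => *; exact: sqr_ge0.
exists (Y t); split => i.
  by move=> ki; rewrite Yz ?(ltnW ki)// /zt; case: eqP ki => // ->; rewrite ltnn.
rewrite ltnS leq_eqVlt => /orP[/eqP ik|]; last exact: Y0.
by have -> : i = i0 by exact: val_inj.
Qed.

End strongly_monotone.

(** * Semidefinite inner products and orthonormal bases modulo null vectors *)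

Section inner_product.
Context (R : realType) (X : lmodType R).
Implicit Types (L : set X) (f : X -> R) (a : X -> X -> R).

Definition subspace L := L 0 /\ forall (c : R) u v, L u -> L v -> L (c *: u + v).

Definition linear_on L f :=
  forall (c : R) u v, L u -> L v -> f (c *: u + v) = c * f u + f v.

Definition inner_product_on L a :=
  [/\ forall w, L w -> linear_on L (a ^~ w),
      forall u v, L u -> L v -> a u v = a v u
    & forall u, L u -> 0 <= a u u].

(** For a linear [f], this is the condition to descend to the quotient of [L] by the null vectors of
    [a]. *)
Definition null_compat L a f := forall z, L z -> a z z = 0 -> f z = 0.

(** The expansion of [u] is required only up to a null vector, so this is a basis of the quotient by
    null vectors rather than of [L]. *)
Definition orthonormal_basis L a n (e : 'I_n -> X) :=
  [/\ forall i, L (e i), forall i j, a (e i) (e j) = (i == j)%:R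
    & forall u, L u ->
        a (u - \sum_i a u (e i) *: e i) (u - \sum_i a u (e i) *: e i) = 0].

Lemma subspaceD L u v : subspace L -> L u -> L v -> L (u + v).
Proof. by move=> [_ lL] Lu Lv; rewrite -[u]scale1r; exact: lL. Qed.

Lemma subspaceZ L c u : subspace L -> L u -> L (c *: u).
Proof. by move=> [L0 lL] Lu; rewrite -[_ *: _]addr0; exact: lL. Qed.

Lemma subspaceB L u v : subspace L -> L u -> L v -> L (u - v).
Proof.
by move=> sL Lu Lv; rewrite -scaleN1r; apply: subspaceD => //; exact: subspaceZ.
Qed.

Lemma subspace_sum L n (c : 'I_n -> R) e : subspace L -> (forall i, L (e i)) ->
  L (\sum_i c i *: e i).
Proof.
move=> sL Le; elim/big_ind: _ => //; first by case: sL.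
  by move=> *; exact: subspaceD.
by move=> i _; exact: subspaceZ.
Qed.

Lemma linear_on0 L f : subspace L -> linear_on L f -> f 0 = 0.
Proof.
move=> [L0 _] lf; have := lf 1 0 0 L0 L0.
by rewrite scaler0 addr0 mul1r => /eqP; rewrite -subr_eq0 opprD addrA subrr sub0r oppr_eq0 => /eqP.
Qed.

Lemma linear_onZ L f c u : subspace L -> linear_on L f -> L u ->
  f (c *: u) = c * f u.
Proof.
move=> sL lf Lu; rewrite -[_ *: _]addr0 lf//; last by case: sL.
by rewrite (linear_on0 sL lf) addr0.
Qed.

Lemma linear_onD L f u v : linear_on L f -> L u -> L v -> f (u + v) = f u + f v.
Proof. by move=> lf Lu Lv; rewrite -[u in LHS]scale1r lf// mul1r. Qed.

Lemma linear_onB L f u v : subspace L -> linear_on L f -> L u -> L v ->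
  f (u - v) = f u - f v.
Proof.
move=> sL lf Lu Lv; rewrite -scaleN1r (linear_onD lf)//; last exact: subspaceZ.
by rewrite (linear_onZ _ sL lf)// mulN1r.
Qed.

Lemma linear_on_sum L f n (c : 'I_n -> R) e : subspace L -> linear_on L f ->
  (forall i, L (e i)) -> f (\sum_i c i *: e i) = \sum_i c i * f (e i).
Proof.
move=> sL lf Le.
suff [//] : f (\sum_i c i *: e i) = \sum_i c i * f (e i) /\ L (\sum_i c i *: e i).
elim/big_ind2: _.
- by split; [rewrite (linear_on0 sL lf)|case: sL].
- move=> x r y s [fx Lx] [fy Ly]; split; last exact: subspaceD.
  by rewrite (linear_onD lf)// fx fy.
- by move=> i _; split; [exact: (linear_onZ _ sL lf)|exact: subspaceZ].
Qed.

Lemma inner_product_linear_on L a w : subspace L -> inner_product_on L a ->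
  L w -> linear_on L (a w).
Proof.
move=> [_ lL] [la sa _] Lw c u v Lu Lv.
by rewrite (sa w u)// (sa w v)// (sa w)//; [exact: la|exact: lL].
Qed.

(** A weak Cauchy-Schwarz inequality: for a null vector [z] the form at [t *: z + w] is affine in
    [t], with slope [2 * a w z]. A nonzero slope would let it take negative values; the [t] chosen
    below gives -1. *)
Lemma inner_product_null L a w : subspace L -> inner_product_on L a -> L w ->
  null_compat L a (a w).
Proof.
move=> sL ia Lw z Lz zz; have [la sa a_ge0] := ia.
have la' := inner_product_linear_on sL ia.
apply: contrapT => /eqP wz0.
pose t := - (a w w + 1) / (2 * a w z).
have Lt : L (t *: z) by exact: subspaceZ.
have := a_ge0 _ (subspaceD sL Lt Lw).
rewrite (linear_onD (la _ _))//; last exact: subspaceD.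
rewrite (linear_onZ _ sL (la _ _))//; last exact: subspaceD.
rewrite !(linear_onD (la' _ _))// !(linear_onZ _ sL (la' _ _))// zz (sa z w)//.
rewrite mulr0 add0r.
have -> : t * a w z + (t * a w z + a w w) = - 1.
  by rewrite /t; field.
by rewrite ler0N1.
Qed.

Lemma orthonormal_basis_sum L a n (e : 'I_n -> X) (c d : 'I_n -> R) :
  subspace L -> inner_product_on L a ->
  (forall i, L (e i)) -> (forall i j, a (e i) (e j) = (i == j)%:R) ->
  a (\sum_i c i *: e i) (\sum_i d i *: e i) = \sum_i c i * d i.
Proof.
move=> sL ia Le oe; have [la _ _] := ia.
rewrite (linear_on_sum _ sL (la _ _))//; last exact: subspace_sum.
apply: eq_bigr => i _; congr (_ * _).
rewrite (linear_on_sum _ sL (inner_product_linear_on sL ia _))//.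
rewrite (bigD1 i)//= big1 ?addr0; first by rewrite oe eqxx mulr1.
by move=> j ji; rewrite oe eq_sym (negbTE ji) mulr0.
Qed.

(** Linearity kills [f] on the expansion of [u], and compatibility with null vectors kills it on the
    remainder. This reduces an equation for all test vectors to the basis vectors. *)
Lemma orthonormal_basis_ext L a n (e : 'I_n -> X) f : subspace L ->
  inner_product_on L a -> orthonormal_basis L a e -> linear_on L f ->
  null_compat L a f -> (forall i, f (e i) = 0) -> forall u, L u -> f u = 0.
Proof.
move=> sL ia [Le oe zb] lf nf fe0 u Lu.
set s := \sum_i a u (e i) *: e i.
have Ls : L s by exact: subspace_sum.
rewrite -[u](subrK s) (linear_onD lf)//; last exact: subspaceB.
rewrite nf//; [|exact: subspaceB|exact: zb].
rewrite (linear_on_sum _ sL lf)// add0r big1// => i _.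
by rewrite fe0 mulr0.
Qed.

(* [Gam r u]: [r] is a coefficient vector of [u]. It is a relation because a
   function given only almost everywhere need not determine its coefficients. *)
Lemma exists_orthonormal_basis L a N (Gam : 'rV[R]_N -> X -> Prop) :
  subspace L -> inner_product_on L a ->
  (forall (c : R) r s u v, L u -> L v -> Gam r u -> Gam s v -> Gam (c *: r + s) (c *: u + v)) ->
  (forall u, L u -> exists r, Gam r u) ->
  (forall u, L u -> Gam 0 u -> a u u = 0) ->
  exists n (e : 'I_n -> X), orthonormal_basis L a e.
Proof.
move=> sL ia lG eG G0; have [la sa a_ge0] := ia.
pose P n := exists e : 'I_n -> X,
  (forall i, L (e i)) /\ (forall i j, a (e i) (e j) = (i == j)%:R).
have L0 : L 0 by case: sL.
have G00 : Gam 0 0.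
  have [r Gr] := eG 0 L0; have := lG (-1) _ _ _ _ L0 L0 Gr Gr.
  by rewrite scaler0 addr0 scaleN1r addNr.
(* Coefficient rows of an orthonormal family are independent: in a vanishing combination of rows,
   the same combination of vectors has the zero row as coefficients, hence norm zero, and that norm
   is the sum of the squared scalars. *)
have Psize n : `[< P n >] -> (n <= N)%N.
  move=> /asboolP[e [Le oe]].
  have /choice[r Gr] := fun i => eG (e i) (Le i).
  suff : row_free (\matrix_(i < n) r i) by rewrite /row_free => /eqP <-; exact: rank_leq_col.
  apply: inj_row_free => l l0.
  have Gl : Gam (\sum_i l ord0 i *: r i) (\sum_i l ord0 i *: e i) /\
      L (\sum_i l ord0 i *: e i).
    elim/big_ind2: _ => //.
      move=> r1 u1 r2 u2 [G1 L1] [G2 L2]; split; last exact: subspaceD.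
      by have := lG 1 _ _ _ _ L1 L2 G1 G2; rewrite !scale1r.
    move=> i _; split; last exact: subspaceZ.
    by have := lG (l ord0 i) _ _ _ _ (Le i) L0 (Gr i) G00; rewrite !addr0.
  have sl0 : \sum_i l ord0 i *: r i = 0.
    rewrite -[RHS]l0 mulmx_sum_row; apply: eq_bigr => i _.
    by congr (_ *: _); apply/rowP => j; rewrite !mxE.
  have [] := Gl; rewrite sl0 => /G0 /[apply].
  rewrite (orthonormal_basis_sum _ _ sL ia)// => /eqP.
  rewrite psumr_eq0; last by move=> i _; rewrite -expr2 sqr_ge0.
  move=> /allP ll0; apply/rowP => i; rewrite mxE.
  by have := ll0 i; rewrite mem_index_enum => /(_ isT); rewrite /= mulf_eq0 orbb => /eqP.
have P0 : exists n, `[< P n >].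
  by exists 0%N; apply/asboolP; exists (fun=> 0); split; case.
(* In an orthonormal family of maximal size, a projection remainder of positive norm could be
   normalized and added as one more member. *)
have [n /asboolP[e [Le oe]] nmax] := ex_maxnP P0 Psize.
exists n, e; split => // u Lu.
set z := u - _.
have Lz : L z by apply: subspaceB => //; exact: subspace_sum.
have ze i : a z (e i) = 0.
  rewrite (linear_onB sL (la _ _))//; last exact: subspace_sum.
  rewrite (linear_on_sum _ sL (la _ _))// (bigD1 i)//= big1; last first.
    by move=> j ji; rewrite oe (negbTE ji) mulr0.
  by rewrite oe eqxx mulr1 addr0 subrr.
apply: contrapT => /eqP zz.
have zz0 : 0 < a z z by rewrite lt_def zz a_ge0.
pose w := (Num.sqrt (a z z))^-1 *: z.
have Lw : L w by exact: subspaceZ.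
have we i : a w (e i) = 0 by rewrite (linear_onZ _ sL (la _ _))// ze mulr0.
have ww : a w w = 1.
  rewrite (linear_onZ _ sL (la _ _))// (linear_onZ _ sL (inner_product_linear_on sL ia _))//.
  rewrite mulrA -expr2 exprVn sqr_sqrtr; last exact: ltW.
  by rewrite mulVf.
suff /nmax : `[< P n.+1 >] by rewrite ltnn.
apply/asboolP; exists (fun i => oapp e w (unlift ord0 i)); split=> [i|i j].
  by case: unliftP => [k|] _ /=.
case: (unliftP ord0 i) => [i'|] ->; case: (unliftP ord0 j) => [j'|] -> /=.
- by rewrite oe (inj_eq (@lift_inj _ ord0)).
- by rewrite sa// we.
- by rewrite we.
- by rewrite ww.
Qed.

End inner_product.

(** * The mixed problem over abstract finite-dimensional spaces *)

Section abstract_mixed_problem.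
Context (R : realType) (X Y : lmodType R) (S : set X) (V : set Y).
(** The intended meaning: [a q r] is [(A^-1 q, r)], [m] the [L^2] product, [b q v] is [(div q, v)],
    [G] the boundary pairing, [F] the load, and [U psi w] is [(U psi, w)], which is linear in [w]
    only. *)
Context (a : X -> X -> R) (m : Y -> Y -> R) (b : X -> Y -> R).
Context (G : X -> R) (F : Y -> R) (U : Y -> Y -> R) (alpha : R).
Context (nS nV : nat) (x : 'I_nS -> X) (y : 'I_nV -> Y).

Hypotheses (sS : subspace S) (sV : subspace V).
Hypotheses (ia : inner_product_on S a) (im : inner_product_on V m).
Hypotheses (basx : orthonormal_basis S a x) (basy : orthonormal_basis V m y).
Hypothesis bl : forall v, V v -> linear_on S (b ^~ v).
Hypothesis br : forall q, S q -> linear_on V (b q).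
Hypothesis bl0 : forall v, V v -> null_compat S a (b ^~ v).
Hypothesis br0 : forall q, S q -> null_compat V m (b q).
Hypotheses (lG : linear_on S G) (G0 : null_compat S a G).
Hypotheses (lF : linear_on V F) (F0 : null_compat V m F).
Hypothesis lU : forall psi, V psi -> linear_on V (U psi).
Hypothesis U0 : forall psi, V psi -> null_compat V m (U psi).
Hypothesis Umono : forall psi phi, V psi -> V phi ->
  U phi (psi - phi) <= U psi (psi - phi).
Hypothesis Uext : forall psi phi, V psi -> V phi ->
  m (psi - phi) (psi - phi) = 0 -> forall w, V w -> U psi w = U phi w.
Hypothesis Ucont : forall (c : nat -> 'I_nV -> R) l w, V w -> coord_cvg c l ->
  U (\sum_j c k j *: y j) w @[k --> \oo] --> U (\sum_j l j *: y j) w.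
Hypothesis alpha0 : 0 < alpha.

Definition abstract_solution q u psi :=
  [/\ S q, V u & V psi] /\
  [/\ forall v, V v -> alpha * b q v + m psi v = F v,
      forall v, S v -> a q v - b v u = - G v
    & forall w, V w -> m u w = U psi w].

Let Sx i : S (x i). Proof. by case: basx. Qed.
Let Vy j : V (y j). Proof. by case: basy. Qed.

Lemma abstract_solution_exists : exists q u psi, abstract_solution q u psi.
Proof.
pose comb (c : 'I_nV -> R) := \sum_j c j *: y j.
have Vcomb c : V (comb c) by exact: subspace_sum.
pose B i j := b (x i) (y j).
(* The first equation tested with [y j] prescribes the coordinates [cpsi] of [psi], the third one
   those of [u]; [N c i] is then the residual of the second equation tested with [x i]. *)
pose cpsi (c : 'I_nS -> R) j := F (y j) - alpha * \sum_i c i * B i j.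
pose u_ c j := U (comb (cpsi c)) (y j).
pose N c i := c i - \sum_j B i j * u_ c j + G (x i).
have [||c Nc] := @strongly_monotone_zero R nS N.
- move=> c l cl i; rewrite /N /=; apply: cvgD; last exact: cvg_cst.
  apply: cvgB; first exact: cl.
  apply: cvg_sum_ord => j; apply: cvgM; first exact: cvg_cst.
  apply: Ucont => // k; apply: cvgB; first exact: cvg_cst.
  apply: cvgM; first exact: cvg_cst.
  apply: cvg_sum_ord => i'; apply: cvgM; [exact: cl|exact: cvg_cst].
- move=> c d.
  (* Since [cpsi c - cpsi d] is [- alpha] times the image of [c - d] under the transpose of [B], the
     coupling term of [N] can be rewritten with [cpsi] at the price of the factor [alpha^-1]. *)
  have key : \sum_i (N c i - N d i) * (c i - d i) =
    \sum_i (c i - d i) ^+ 2 +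
      alpha^-1 * \sum_j (u_ c j - u_ d j) * (cpsi c j - cpsi d j).
    have -> : \sum_j (u_ c j - u_ d j) * (cpsi c j - cpsi d j) =
      - alpha * \sum_j (u_ c j - u_ d j) * \sum_i (c i - d i) * B i j.
      rewrite mulr_sumr; apply: eq_bigr => j _; rewrite /cpsi.
      rewrite (_ : \sum_i (c i - d i) * B i j =
        \sum_i c i * B i j - \sum_i d i * B i j); first by ring.
      rewrite -sumrB; apply: eq_bigr => i _; exact: mulrBl.
    rewrite mulrA mulrN mulVf ?gt_eqF// mulN1r.
    under [X in _ - X]eq_bigr do rewrite mulr_sumr.
    rewrite exchange_big/= -sumrB; apply: eq_bigr => i _.
    rewrite /N -(_ : (c i - d i) * \sum_j B i j * (u_ c j - u_ d j) =
      \sum_j (u_ c j - u_ d j) * ((c i - d i) * B i j)); last first.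
      by rewrite mulr_sumr; apply: eq_bigr => j _; ring.
    rewrite (_ : \sum_j B i j * (u_ c j - u_ d j) =
      \sum_j B i j * u_ c j - \sum_j B i j * u_ d j); first by ring.
    rewrite -sumrB; apply: eq_bigr => j _; exact: mulrBr.
  rewrite key lerDl; apply: mulr_ge0; first by rewrite invr_ge0 ltW.
  have -> : \sum_j (u_ c j - u_ d j) * (cpsi c j - cpsi d j) =
    U (comb (cpsi c)) (comb (cpsi c) - comb (cpsi d)) -
    U (comb (cpsi d)) (comb (cpsi c) - comb (cpsi d)).
    have -> : comb (cpsi c) - comb (cpsi d) =
        \sum_j (cpsi c j - cpsi d j) *: y j.
      rewrite /comb -sumrB; apply: eq_bigr => j _; by rewrite -scalerBl.
    rewrite !(linear_on_sum _ sV (lU _))// -sumrB; apply: eq_bigr => j _.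
    by rewrite /u_; ring.
  by rewrite subr_ge0; exact: Umono.
exists (\sum_i c i *: x i), (comb (u_ c)), (comb (cpsi c)).
have Sq : S (\sum_i c i *: x i) by exact: subspace_sum.
have coef n (Z : lmodType R) (L : set Z) (ip : Z -> Z -> R) (e : 'I_n -> Z) d k : subspace L ->
    inner_product_on L ip -> orthonormal_basis L ip e ->
    ip (\sum_j d j *: e j) (e k) = d k.
  move=> sL iL [Le oe _]; have [lL _ _] := iL.
  rewrite (linear_on_sum _ sL (lL _ _))// (bigD1 k)//= big1 ?addr0.
    by rewrite oe eqxx mulr1.
  by move=> j jk; rewrite oe (negbTE jk) mulr0.
split; first by split.
split=> [v Vv|v Sv|w Vw].
(* The residual of each equation is linear in the test vector and vanishes on null vectors, so basis
   vectors suffice as tests. *)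
- apply/eqP; rewrite -subr_eq0; apply/eqP; move: v Vv.
  have Vpsi := Vcomb (cpsi c).
  apply: (orthonormal_basis_ext sV im basy) => [t u v Vu Vv|z Vz zz|j].
  + rewrite (br Sq)// (inner_product_linear_on sV im Vpsi)// lF//; ring.
  + rewrite br0// F0// (inner_product_null sV im Vpsi)//; ring.
  + rewrite (coef _ _ V)// /cpsi (linear_on_sum _ sS (bl (Vy j)))//.
    by rewrite /B; ring.
- apply/eqP; rewrite -subr_eq0; apply/eqP; move: v Sv.
  have Vu := Vcomb (u_ c).
  apply: (orthonormal_basis_ext sS ia basx) => [t u v Su Sv|z Sz zz|i].
  + rewrite (bl Vu)// (inner_product_linear_on sS ia Sq)// lG//; ring.
  + rewrite bl0// G0// (inner_product_null sS ia Sq)//; ring.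
  + rewrite (coef _ _ S)// /comb (linear_on_sum _ sV (br (Sx i)))// opprK.
    by rewrite -[RHS](Nc i) /N; congr (_ - _ + _); apply: eq_bigr => j _; rewrite mulrC.
- apply/eqP; rewrite -subr_eq0; apply/eqP; move: w Vw.
  have Vu := Vcomb (u_ c).
  apply: (orthonormal_basis_ext sV im basy) => [t w v Vw Vv|z Vz zz|j].
  + rewrite (inner_product_linear_on sV im Vu)// (lU (Vcomb _))//; ring.
  + rewrite U0// (inner_product_null sV im Vu)//; ring.
  + by rewrite (coef _ _ V)// subrr.
Qed.

(** With [dq], [du], [dpsi] the differences, [a dq dq = b dq du = - alpha^-1 * m dpsi du], and the
    last product is nonnegative by monotonicity of [U]; so [dq] is null. The first equation then
    makes [dpsi] null, and the third one [du]. *)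
Lemma abstract_solution_unique q u psi q' u' psi' :
  abstract_solution q u psi -> abstract_solution q' u' psi' ->
  [/\ a (q' - q) (q' - q) = 0, m (u' - u) (u' - u) = 0
    & m (psi' - psi) (psi' - psi) = 0].
Proof.
move=> [[Sq Vu Vp] [E1 E2 E3]] [[Sq' Vu' Vp'] [E1' E2' E3']].
have [la _ a_ge0] := ia; have [lm sm m_ge0] := im.
have Sdq : S (q' - q) by exact: subspaceB.
have Vdu : V (u' - u) by exact: subspaceB.
have Vdp : V (psi' - psi) by exact: subspaceB.
have D1 v : V v -> alpha * b (q' - q) v + m (psi' - psi) v = 0.
  move=> Vv; rewrite (linear_onB sS (bl Vv))// (linear_onB sV (lm _ Vv))//.
  by have := E1 v Vv; have := E1' v Vv => <-; lra.
have D2 v : S v -> a (q' - q) v = b v (u' - u).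
  move=> Sv; rewrite (linear_onB sV (br Sv))// (linear_onB sS (la _ Sv))//.
  by have := E2 v Sv; have := E2' v Sv; lra.
have D3 w : V w -> m (u' - u) w = U psi' w - U psi w.
  move=> Vw; rewrite (linear_onB sV (lm _ Vw))//.
  by rewrite E3// E3'.
have q0 : a (q' - q) (q' - q) = 0.
  apply/le_anti; rewrite a_ge0// andbT D2//.
  have /eqP := D1 _ Vdu; rewrite addr_eq0 => /eqP bE.
  rewrite -(ler_pM2l alpha0) mulr0 bE oppr_le0 sm// D3// subr_ge0.
  exact: Umono.
have p0 : m (psi' - psi) (psi' - psi) = 0.
  by have := D1 _ Vdp; rewrite bl0// mulr0 add0r.
by split=> //; rewrite D3// (Uext Vp' Vp p0)// subrr.
Qed.

End abstract_mixed_problem.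

(** * Topology and Lebesgue measure of column vectors *)

Section column_topology.
Context (R : realType).

Lemma cvg_mx T (F : set_system T) m n (f : T -> 'M[R]_(m, n)) (l : 'M[R]_(m, n)) :
  Filter F -> (forall i j, f x i j @[x --> F] --> l i j) -> f x @[x --> F] --> l.
Proof.
move=> FF fl A [P lP PA].
suff FP : F [set x | forall i j, P i j (f x i j)].
  change (F (f @^-1` A)); apply: (filterS _ FP) => x Px.
  by apply: PA => i j; exact: (Px i j).
apply: filter_forall => i; apply: filter_forall => j.
by apply: fl; exact: lP.
Qed.

Lemma continuous_mx (T : topologicalType) m n (f : T -> 'M[R]_(m, n)) :
  (forall i j, continuous (fun x => f x i j)) -> continuous f.
Proof. by move=> cf x; apply: cvg_mx => i j; exact: cf. Qed.

Lemma le_mx_norm m n (M : 'M[R]_(m, n)) i j : `|M i j| <= `|M|.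
Proof.
rewrite [leRHS]/Num.norm /= mx_normrE.
exact: (@le_bigmax _ _ _ 0 (fun p : 'I_m * 'I_n => `|M p.1 p.2|) (i, j)).
Qed.

Lemma mx_norm_le m n (M : 'M[R]_(m, n)) r : 0 <= r ->
  (forall i j, `|M i j| <= r) -> `|M| <= r.
Proof.
move=> r0 Mr; rewrite [leLHS]/Num.norm /= mx_normrE.
by apply/bigmax_leP; split => // -[i j] _; exact: Mr.
Qed.

Context (n : nat).
Implicit Types (A O : set 'cV[R]_n) (a b x : 'cV[R]_n).

(** Transposition carries the Heine-Borel theorem over from row vectors. *)
Lemma bounded_closed_compact_cV A : bounded_set A -> closed A -> compact A.
Proof.
move=> bA cA.
have ctr m k : continuous (@trmx R m k).
  apply: continuous_mx => i j.
  have -> : (fun y : 'M[R]_(m, k) => y^T i j) = (fun y => y j i).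
    by apply/funext => y; rewrite mxE.
  exact: coord_continuous.
pose B := (@trmx R 1 n) @^-1` A.
have -> : A = (@trmx R 1 n) @` B.
  apply/seteqP; split=> [x Ax|_ [y By <-]//].
  by exists x^T; rewrite /B/= ?trmxK.
apply: continuous_compact; first exact/continuous_subspaceT/ctr.
apply: bounded_closed_compact.
- have [M [Mr MA]] := bA; exists M; split => // r Mr' v Bv.
  apply: le_trans (MA _ Mr' _ Bv).
  by apply: mx_norm_le => // i j; rewrite -(mxE trmx_key (fun j i => v i j)) le_mx_norm.
- exact: (iffLR (continuous_closedP _) (ctr _ _)).
Qed.

Lemma bounded_set_cVP A : bounded_set A <-> exists2 r, 0 < r &
  forall x, A x -> forall i, `|x i ord0| <= r.
Proof.
split.
  move=> [M [Mr MA]]; exists (`|M| + 1); first by rewrite ltr_wpDl.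
  move=> x Ax i; apply: le_trans (le_mx_norm x i ord0) _.
  by apply: MA => //; rewrite (le_lt_trans (ler_norm M))// ltrDl.
move=> [r r0 Ar]; exists r; split; first exact: gtr0_real.
move=> s rs x Ax; apply: mx_norm_le; first exact/ltW/(lt_trans r0).
by move=> i j; rewrite ord1; apply: le_trans (Ar _ Ax i) (ltW rs).
Qed.

Definition box a b : set 'cV[R]_n :=
  [set x | forall i, a i ord0 < x i ord0 < b i ord0].

Definition cbox a b : set 'cV[R]_n :=
  [set x | forall i, a i ord0 <= x i ord0 <= b i ord0].

Lemma sub_box_cbox a b : box a b `<=` cbox a b.
Proof. by move=> x xab i; have /andP[? ?] := xab i; rewrite !ltW. Qed.

Lemma open_box a b : open (box a b).
Proof.
rewrite openE => x xab; rewrite /interior.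
exists (fun i _ => `]a i ord0, b i ord0[%classic) => [i j|y xy i].
  by rewrite ord1; apply: open_nbhs_nbhs; split=> //=; rewrite in_itv/=; exact: xab.
by have := xy i ord0; rewrite /= in_itv.
Qed.

Lemma closed_cbox a b : closed (cbox a b).
Proof.
have -> : cbox a b = \bigcap_i ((fun x : 'cV[R]_n => x i ord0) @^-1` `[a i ord0, b i ord0]%classic).
  apply/seteqP; split=> [x xab i _|x xab i]; last by have := xab i Logic.I; rewrite /= in_itv.
  by rewrite /= in_itv/=; exact: xab.
apply: closed_bigI => i _.
apply: (iffLR (continuous_closedP _) (@coord_continuous _ _ _ _ _)).
exact: interval_closed.
Qed.

Lemma compact_cbox a b : compact (cbox a b).
Proof.
apply: bounded_closed_compact_cV (@closed_cbox a b).
apply/bounded_set_cVP; exists (`|a| + `|b| + 1).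
  by rewrite ltr_wpDl// addr_ge0.
move=> x xab i; have /andP[ax xb] := xab i.
have := le_mx_norm a i ord0; have := le_mx_norm b i ord0.
by rewrite !ler_norml; lra.
Qed.

Lemma open_rat_box O x : open O -> O x -> exists a b : 'cV[rat]_n,
  box (map_mx ratr a) (map_mx ratr b) x /\
  cbox (map_mx ratr a) (map_mx ratr b) `<=` O.
Proof.
move=> oO Ox; have /nbhs_ballP[e /= e0 eO] := open_nbhs_nbhs (conj oO Ox).
have /choice[a ax] (i : 'I_n) : exists q, ratr q \in `]x i ord0 - e, x i ord0[.
  by apply: rat_in_itvoo; rewrite ltrBlDr ltrDl.
have /choice[b xb] (i : 'I_n) : exists q, ratr q \in `]x i ord0, x i ord0 + e[.
  by apply: rat_in_itvoo; rewrite ltrDl.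
exists (\col_i a i), (\col_i b i); split.
  move=> i; rewrite !mxE.
  by have := ax i; have := xb i; rewrite !in_itv/= => /andP[-> _] /andP[_ ->].
move=> y yab; apply: eO; split => // i j; rewrite ord1 /ball/= ltr_distlC.
have := yab i; rewrite !mxE => /andP[ay yb].
have := ax i; have := xb i; rewrite !in_itv/= => /andP[_ bx] /andP[xa _].
by rewrite (lt_le_trans xa)// (le_lt_trans yb).
Qed.

Lemma measurable_box a b : measurable (box a b).
Proof.
have -> : box a b = \bigcap_(i in [set: 'I_n])
    ((fun x : 'cV[R]_n => x i ord0) @^-1` `]a i ord0, b i ord0[%classic).
  apply/seteqP; split=> [x xab i _|x xab i].
    by rewrite /= in_itv/=; exact: xab.
  by have := xab i Logic.I; rewrite /= in_itv.
apply: fin_bigcap_measurable => [|i _]; first exact: finite_finset.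
by rewrite -[X in measurable X]setTI; exact: measurable_entry.
Qed.

(* Countability of the rational boxes is what makes open sets measurable. *)
Lemma open_bigcup_box O : open O -> exists D : set ('cV[rat]_n * 'cV[rat]_n),
  (forall p, D p -> cbox (map_mx ratr p.1) (map_mx ratr p.2) `<=` O) /\
  O = \bigcup_(p in D) box (map_mx ratr p.1) (map_mx ratr p.2).
Proof.
move=> oO.
exists [set p | cbox (map_mx ratr p.1) (map_mx ratr p.2) `<=` O]; split => //.
apply/seteqP; split=> [x Ox|x [p pO /sub_box_cbox/pO]//].
by have [a [b [xab abO]]] := open_rat_box oO Ox; exists (a, b).
Qed.

Lemma open_measurable_cV O : open O -> measurable O.
Proof.
move=> /open_bigcup_box[D [_ ->]]; rewrite bigcup_mkcond.
apply: countable_bigcupT_measurable => [|p]; first exact: countableP.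
by case: ifPn => // _; exact: measurable_box.
Qed.

Lemma closed_measurable_cV A : closed A -> measurable A.
Proof.
move=> cA; rewrite -[A]setCK; apply: measurableC; apply: open_measurable_cV.
exact: closed_openC.
Qed.

Lemma continuous_measurable_cV (f : 'cV[R]_n -> R) (D : set 'cV[R]_n) :
  continuous f -> measurable_fun D f.
Proof.
move=> cf; apply: measurable_funTS.
apply: (measurability _ (RGenOpens.measurableE R)) => _ [_ [a [b ->] <-]].
rewrite setTI; apply: open_measurable_cV.
by apply: open_comp => [x _|]; [exact: cf|exact: interval_open].
Qed.

End column_topology.

(** * Lebesgue measure of boxes, open sets and hyperplanes *)

Section column_measure.
Context (R : realType).
Local Notation leb := (lebesgue_cV R).

Lemma lebesgue_cVS n (A : set 'cV[R]_n.+1) :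
  leb n.+1 A = (@lebesgue_measure R \x leb n)%E (@cons_cV R n @^-1` A).
Proof. by []. Qed.

(** By uniqueness of the product measure, slices may also be taken along the first coordinate, with
    the others fixed. *)
Lemma lebesgue_cVS2 n (A : set 'cV[R]_n.+1) : measurable A ->
  leb n.+1 A = (@lebesgue_measure R \x^ leb n)%E (@cons_cV R n @^-1` A).
Proof.
move=> mA; rewrite lebesgue_cVS; apply: product_measure_unique => [B C mB mC|].
  by rewrite /= product_measure2E.
by rewrite -[X in measurable X]setTI; exact: measurable_cons_cV.
Qed.

Lemma cons_cV_box n (a b : 'cV[R]_n.+1) :
  @cons_cV R n @^-1` box a b = `]a ord0 ord0, b ord0 ord0[%classic `*`
    box (\col_i a (lift ord0 i) ord0) (\col_i b (lift ord0 i) ord0).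
Proof.
apply/seteqP; split=> -[t v] /=.
  move=> tv; split.
    by rewrite /= in_itv/=; have := tv ord0; rewrite !mxE unlift_none.
  by move=> i; rewrite !mxE; have := tv (lift ord0 i); rewrite !mxE liftK.
rewrite in_itv /= => -[tab vab] i; rewrite !mxE.
by case: unliftP => [j|] -> //=; have := vab j; rewrite !mxE.
Qed.

Lemma lebesgue_cV_box_lty n (a b : 'cV[R]_n) : (leb n (box a b) < +oo)%E.
Proof.
elim: n => [|n IH] in a b *.
  rewrite /= diracE; by case: (_ \in _); rewrite ltry.
rewrite lebesgue_cVS cons_cV_box product_measure1E; last first.
- exact: measurable_box.
- exact: measurable_itv.
apply: lte_mul_pinfty; [exact: measure_ge0| |exact: IH].
by rewrite /= lebesgue_measure_itv/=; case: ifP.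
Qed.

Lemma lebesgue_cV_box_gt0 n (a b : 'cV[R]_n) :
  (forall i, a i ord0 < b i ord0) -> (0 < leb n (box a b))%E.
Proof.
elim: n => [|n IH] in a b *.
  by move=> _; rewrite /= diracE mem_set// => -[].
move=> ab; rewrite lebesgue_cVS cons_cV_box product_measure1E; last first.
- exact: measurable_box.
- exact: measurable_itv.
apply: mule_gt0; last by apply: IH => i; rewrite !mxE.
by rewrite /= lebesgue_measure_itv/= lte_fin ab -EFinD lte_fin subr_gt0.
Qed.

Lemma lebesgue_cV_bounded_lty n (A : set 'cV[R]_n) :
  measurable A -> bounded_set A -> (leb n A < +oo)%E.
Proof.
move=> mA /bounded_set_cVP[r r0 Ar].
apply: le_lt_trans (lebesgue_cV_box_lty (const_mx (- (r + 1))) (const_mx (r + 1))).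
apply: le_measure; rewrite ?inE//; first exact: measurable_box.
by move=> x Ax i; rewrite !mxE; have := Ar x Ax i; rewrite ler_norml; lra.
Qed.

Lemma lebesgue_cV_open_gt0 n (O : set 'cV[R]_n) :
  open O -> O !=set0 -> (0 < leb n O)%E.
Proof.
move=> oO [x Ox]; have [a [b [xab abO]]] := open_rat_box oO Ox.
apply: lt_le_trans (lebesgue_cV_box_gt0 (a := map_mx ratr a) (b := map_mx ratr b) _) _.
  by move=> i; have /andP[ax xb] := xab i; exact: lt_trans xb.
apply: le_measure; rewrite ?inE//.
- exact: measurable_box.
- exact: open_measurable_cV.
- by apply: subset_trans abO; exact: sub_box_cbox.
Qed.

Lemma measurable_hyperplane n (h : 'cV[R]_n * R) : measurable (hyperplane h).
Proof.
have -> : hyperplane h = dot h.1 @^-1` [set h.2] by [].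
by rewrite -[X in measurable X]setTI; apply: measurable_dot.
Qed.

Lemma dot_cons_cV n (u : 'cV[R]_n.+1) (p : R * 'cV[R]_n) :
  dot u (cons_cV p) = u ord0 ord0 * p.1 + dot (\col_i u (lift ord0 i) ord0) p.2.
Proof.
rewrite /dot big_ord_recl !mxE unlift_none /=; congr (_ + _).
by apply: eq_bigr => i _; rewrite !mxE liftK.
Qed.

(** Induction on the dimension. If the normal has first coordinate 0, every slice at a fixed first
    coordinate is a hyperplane of the lower-dimensional space; otherwise every line in the first
    direction meets the hyperplane in one point. *)
Lemma lebesgue_cV_hyperplane n (h : 'cV[R]_n * R) : h.1 != 0 ->
  leb n (hyperplane h) = 0%E.
Proof.
elim: n h => [[u c] /eqP[]|n IH [u c] /= u0]; first by apply/colP => -[].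
have [u00|u00] := eqVneq (u ord0 ord0) 0.
- have u'0 : \col_i u (lift ord0 i) ord0 != 0.
    apply: contra u0 => /eqP /colP u'; apply/eqP/colP => i; rewrite mxE.
    by case: (unliftP ord0 i) => [j|] ->//; have := u' j; rewrite !mxE.
  rewrite lebesgue_cVS /product_measure1 integral0_eq// => t _ /=.
  rewrite -[RHS](IH (\col_i u (lift ord0 i) ord0, c))//; congr (leb n _).
  apply/seteqP; split=> v; rewrite /xsection/= ?inE /hyperplane /= dot_cons_cV u00 mul0r add0r//.
- rewrite lebesgue_cVS2; last exact: measurable_hyperplane.
  rewrite /product_measure2 integral0_eq// => v _ /=.
  apply/eqP; rewrite eq_le measure_ge0 andbT.
  rewrite -(lebesgue_measure_set1 ((c - dot (\col_i u (lift ord0 i) ord0) v) / u ord0 ord0)).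
  have mys : measurable (ysection (@cons_cV R n @^-1` hyperplane (u, c)) v).
    apply: measurable_ysection.
    rewrite -[X in measurable X]setTI; apply: measurable_cons_cV => //.
    exact: measurable_hyperplane.
  apply: le_measure; rewrite ?inE//.
  move=> t; rewrite /ysection/= inE /hyperplane /= dot_cons_cV /= => tc.
  by rewrite /= -tc; field.
Qed.

End column_measure.

(** * Bump functions and the fundamental lemma *)

Section derivative_integral.
Context (R : realType).
Local Notation leb := (lebesgue_cV R).

(** A directional derivative sees only the restriction to a line, so it can be transported between
    different spaces, such as a coordinate line of [R^n] and [R] itself. *)
Lemma is_derive_line (V V' W : normedModType R) (f : V -> W) (g : V' -> W)
    (a v : V) (a' v' : V') d :
  (forall h : R, f (h *: v + a) = g (h *: v' + a')) ->
  is_derive a v f d -> is_derive a' v' g d.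
Proof.
move=> fg [df fd].
have fga : f a = g a' by have := fg 0; rewrite !scale0r !add0r.
have E : (fun h : R => h^-1 *: ((f \o shift a) (h *: v) - f a)) =
         (fun h : R => h^-1 *: ((g \o shift a') (h *: v') - g a')).
  by apply/funext => h /=; rewrite fg fga.
split; first by rewrite /derivable -E.
by rewrite -fd /derive E.
Qed.

Lemma integrable_bounded_supp d (T : measurableType d)
    (mu : {measure set T -> \bar R}) (E : set T) (f : T -> R) (C : R) :
  measurable E -> (mu E < +oo)%E -> measurable_fun setT f ->
  (forall x, `|f x| <= C) -> (forall x, ~ E x -> f x = 0) ->
  mu.-integrable setT (EFin \o f).
Proof.
move=> mE Eoo mf fC f0.
have -> : EFin \o f = (EFin \o f) \_ E.
  apply/funext => x; rewrite patchE; case: ifPn => //; rewrite notin_setE => Ex.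
  by rewrite /= f0.
apply/(integrable_mkcond _ mE)/measurable_bounded_integrable => //.
  exact: measurable_funTS.
exists C; split; first exact: num_real.
by move=> M CM x _; apply: le_trans (fC x) (ltW CM).
Qed.

Lemma continuous_cbox_bounded n (f : 'cV[R]_n -> R) (a b : 'cV[R]_n) :
  continuous f -> exists2 C, 0 <= C & forall x, cbox a b x -> `|f x| <= C.
Proof.
move=> cf.
have /compact_bounded[M [_ HM]] : compact (f @` cbox a b).
  by apply: continuous_compact; [exact: continuous_subspaceT|exact: compact_cbox].
exists (`|M| + 1); first by rewrite addr_ge0.
move=> x xab; apply: HM; last by exists x.
by rewrite (le_lt_trans (ler_norm M))// ltrDl.
Qed.

Lemma measurable_cbox n (a b : 'cV[R]_n) : measurable (cbox a b).
Proof. by apply: closed_measurable_cV; exact: closed_cbox. Qed.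

Lemma lebesgue_cbox_lty n (a b : 'cV[R]_n) : (leb n (cbox a b) < +oo)%E.
Proof.
apply: lebesgue_cV_bounded_lty; first exact: measurable_cbox.
by apply: compact_bounded; exact: compact_cbox.
Qed.

Definition cube n (r : R) : set 'cV[R]_n := cbox (const_mx (- r)) (const_mx r).

Lemma cubeP n r (x : 'cV[R]_n) : cube r x <-> forall i, `|x i ord0| <= r.
Proof.
by split=> xr i; have := xr i; rewrite !mxE ler_norml.
Qed.

Lemma continuous_supp_integrable n (f : 'cV[R]_n -> R) r : continuous f ->
  (forall x, ~ cube r x -> f x = 0) -> (leb n).-integrable setT (EFin \o f).
Proof.
move=> cf f0; have [C C0 fC] := continuous_cbox_bounded (const_mx (- r)) (const_mx r) cf.
apply: (@integrable_bounded_supp _ _ _ (cube r) f C) => //.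
- exact: measurable_cbox.
- exact: lebesgue_cbox_lty.
- exact: continuous_measurable_cV.
- move=> x; have [/fC//|/f0 ->] := pselect (cube r x).
  by rewrite normr0.
Qed.

Lemma integral_lebesgue_cVS n (f : 'cV[R]_n.+1 -> R) r : continuous f ->
  (forall x, ~ cube r x -> f x = 0) ->
  (@lebesgue_measure R \x leb n)%E.-integrable setT
     (fun p => (f (cons_cV p))%:E) /\
  (\int[leb n.+1]_x (f x)%:E =
   \int[@lebesgue_measure R \x leb n]_p (f (cons_cV p))%:E)%E.
Proof.
move=> cf f0.
have mc : measurable_fun [set: measurableTypeR R * 'cV[R]_n] (@cons_cV R n).
  exact: measurable_cons_cV.
have [C C0 fC] := continuous_cbox_bounded (const_mx (- r)) (const_mx r) cf.
have int1 : (@lebesgue_measure R \x leb n)%E.-integrable setT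
     (EFin \o (f \o @cons_cV R n)).
  apply: (integrable_bounded_supp (mu := (@lebesgue_measure R \x leb n)%E) (E := @cons_cV R n @^-1` cube r) (C := C)) => //.
  - by rewrite -[X in measurable X]setTI; apply: mc => //; exact: measurable_cbox.
  - by have := lebesgue_cbox_lty (const_mx (- r) : 'cV[R]_n.+1) (const_mx r); rewrite lebesgue_cVS.
  - by apply: measurableT_comp => //; exact: continuous_measurable_cV.
  - move=> x /=; have [/fC//|/f0 ->] := pselect (cube r (cons_cV x)).
    by rewrite normr0.
  - by move=> x; exact: f0.
split => //.
have mf : measurable_fun setT (EFin \o f).
  by apply/measurable_EFinP; exact: continuous_measurable_cV.
by have := integral_pushforward mc mf int1 measurableT; rewrite preimage_setT.
Qed.

Lemma cons_cV0 n h t (v : 'cV[R]_n) :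
  cons_cV (h + t, v) = h *: delta_mx ord0 ord0 + cons_cV (t, v).
Proof.
apply/colP => i; rewrite !mxE /=; case: unliftP => [j|] -> /=.
  by rewrite mulr0 add0r.
by rewrite mulr1.
Qed.

Lemma cons_cV_lift n h t (v : 'cV[R]_n) j :
  cons_cV (t, h *: delta_mx j ord0 + v) =
  h *: delta_mx (lift ord0 j) ord0 + cons_cV (t, v).
Proof.
apply/colP => i; rewrite !mxE /=; case: unliftP => [k|] -> /=.
  by rewrite !mxE (inj_eq (@lift_inj _ ord0)).
by rewrite mulr0 add0r.
Qed.

Lemma continuous_cons_cVl n (v : 'cV[R]_n) : continuous (fun t : R => cons_cV (t, v)).
Proof.
apply: continuous_mx => i j.
have -> : (fun t : R => cons_cV (t, v) i j) = (fun t => oapp (v ^~ ord0) t (unlift ord0 i)).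
  by apply/funext => t; rewrite mxE.
case: (unlift ord0 i) => [k|] /= t; [exact: cvg_cst|exact: cvg_id].
Qed.

Lemma continuous_cons_cVr n (t : R) : continuous (fun v : 'cV[R]_n => cons_cV (t, v)).
Proof.
apply: continuous_mx => i j.
have -> : (fun v : 'cV[R]_n => cons_cV (t, v) i j) = (fun v => oapp (v ^~ ord0) t (unlift ord0 i)).
  by apply/funext => v; rewrite mxE.
case: (unlift ord0 i) => [k|] /=; [exact: coord_continuous|exact: cst_continuous].
Qed.

Lemma integral_derive_supp1 (F G : R -> R) (r : R) : continuous G ->
  (forall t : R, is_derive t 1 F (G t)) ->
  (forall t, r < `|t| -> F t = 0) -> (forall t, r < `|t| -> G t = 0) ->
  (\int[@lebesgue_measure R]_t (G t)%:E = 0)%E.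
Proof.
(* [s] is positive and exceeds [r] even when [r] is negative, so [F] vanishes at [s] and [- s]. *)
move=> cG FG F0 G0; pose s : R := `|r| + 1.
have rs (t : R) : s <= `|t| -> r < `|t|.
  by apply: lt_le_trans; rewrite /s (le_lt_trans (ler_norm r))// ltrDl.
have s0 : 0 < s by rewrite /s ltr_wpDl.
have -> : (\int[@lebesgue_measure R]_t (G t)%:E =
    \int[@lebesgue_measure R]_(t in `[(- s)%R, s]%classic) (G t)%:E)%E.
  rewrite [RHS]integral_mkcond; apply: eq_integral => t _; rewrite patchE.
  case: ifPn => //; rewrite notin_setE /= in_itv/= => /negP.
  by rewrite -ler_norml -ltNge => st; rewrite G0// rs// ltW.
rewrite (@continuous_FTC2 _ G F).
- by rewrite !F0 ?subee// rs// ?normrN ger0_norm// ltW.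
- lra.
- exact: continuous_subspaceT.
- have cF : continuous F.
    move=> t; apply: differentiable_continuous; apply/derivable1_diffP.
    by case: (FG t).
  split.
  + by move=> t _; case: (FG t).
  + exact/cvg_at_right_filter/cF.
  + exact/cvg_at_left_filter/cF.
- by move=> t _; rewrite derive1E; case: (FG t).
Qed.

(** Fubini with the first coordinate split off. If the derivative is in that coordinate, it is
    integrated first, by the fundamental theorem of calculus; otherwise the slices at a fixed first
    coordinate integrate to 0 by induction. *)
Lemma integral_derive_supp n (F G : 'cV[R]_n -> R) (i : 'I_n) (r : R) :
  continuous F -> continuous G ->
  (forall x, is_derive x (delta_mx i ord0 : 'cV[R]_n) F (G x)) ->
  (forall x, ~ cube r x -> F x = 0) -> (forall x, ~ cube r x -> G x = 0) ->
  (\int[leb n]_x (G x)%:E = 0)%E.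
Proof.
elim: n => [|n IH] in F G i *; first by case: i.
move=> cF cG FG F0 G0.
have [iG ->] := integral_lebesgue_cVS cG G0.
have Ncube (t : R) (v : 'cV[R]_n) : r < `|t| \/ ~ cube r v -> ~ cube r (cons_cV (t, v)).
  move=> tv /cubeP H; case: tv => [rt|].
    by have := H ord0; rewrite mxE unlift_none/= leNgt rt.
  by apply; apply/cubeP => j; have := H (lift ord0 j); rewrite mxE liftK.
have [j ij|i0] := unliftP ord0 i.
- rewrite -integral12_prod_meas1// integral0_eq// => t _; rewrite /fubini_F /=.
  apply: (IH (fun v => F (cons_cV (t, v))) (fun v => G (cons_cV (t, v))) j).
  + by move=> v; apply: continuous_comp; [exact: continuous_cons_cVr|exact: cF].
  + by move=> v; apply: continuous_comp; [exact: continuous_cons_cVr|exact: cG].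
  + move=> v; apply: is_derive_line (FG _) => h.
    by rewrite cons_cV_lift ij.
  + by move=> v Nv; apply: F0; apply: Ncube; right.
  + by move=> v Nv; apply: G0; apply: Ncube; right.
- rewrite -integral21_prod_meas1// integral0_eq// => v _; rewrite /fubini_G /=.
  apply: (@integral_derive_supp1 (fun t => F (cons_cV (t, v))) (fun t => G (cons_cV (t, v))) r).
  + by move=> t; apply: continuous_comp; [exact: continuous_cons_cVl|exact: cG].
  + move=> t; apply: is_derive_line (FG _) => h.
    by rewrite -[h *: 1]/(h * 1) mulr1 cons_cV0 i0.
  + by move=> t Nt; apply: F0; apply: Ncube; left.
  + by move=> t Nt; apply: G0; apply: Ncube; left.
Qed.

End derivative_integral.

(** * One-dimensional bumps *)

Section flat_functions.
Context (R : realType).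
Implicit Types (p q : {poly R}) (c t : R).

(** The classical smooth function [exp (- c / t)] extended by 0, with a polynomial factor in [1 / t]
    so that the family is closed under derivation. *)
Definition flat p c t : R := if 0 < t then p.[t^-1] * expR (- (c / t)) else 0.

Lemma flat_le0 p c t : t <= 0 -> flat p c t = 0.
Proof. by rewrite /flat ltNge => ->. Qed.

(** One term of the exponential series, [exp x >= x^(i+1) / (i+1)!] at [x = c / t]; using a power
    one higher than needed leaves the factor [t]. *)
Lemma expr_inv_mul_expR c t i : 0 < c -> 0 < t ->
  t^-1 ^+ i * expR (- (c / t)) <= i.+1`!%:R / c ^+ i.+1 * t.
Proof.
move=> c0 t0; have x0 : 0 < c / t by exact: divr_gt0.
have H := expR_ge1Dxn i (ltW x0).
have {}H : (c / t) ^+ i.+1 / i.+1`!%:R <= expR (c / t) by lra.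
have f0 : 0 < (i.+1`!%:R : R) by rewrite ltr0n fact_gt0.
have ci : 0 < c ^+ i.+1 by exact: exprn_gt0.
rewrite expRN ler_pdivrMr ?expR_gt0//.
apply: (@le_trans _ _ (i.+1`!%:R / c ^+ i.+1 * t * ((c / t) ^+ i.+1 / i.+1`!%:R))).
  have ti : 0 < t ^+ i by exact: exprn_gt0.
  rewrite le_eqVlt; apply/orP; left; apply/eqP.
  rewrite expr_div_n [t ^+ i.+1]exprS exprVn.
  move: (t ^+ i) (c ^+ i.+1) (i.+1`!%:R) ti ci f0 => T C F T0 C0 F0.
  by field; rewrite !gt_eqF.
by rewrite ler_pM2l// mulr_gt0// divr_gt0.
Qed.

Lemma flat_bound p c : 0 < c -> exists2 K, 0 <= K & forall t, `|flat p c t| <= K * `|t|.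
Proof.
move=> c0; pose K := \sum_(i < size p) `|p`_i| * (i.+1`!%:R / c ^+ i.+1).
have K0 : 0 <= K.
  apply: sumr_ge0 => i _; apply: mulr_ge0 => //.
  by rewrite divr_ge0// exprn_ge0// ltW.
exists K => // t; have [t0|t0] := ltP 0 t; last first.
  by rewrite flat_le0// normr0 mulr_ge0.
rewrite /flat t0 normrM (ger0_norm (expR_ge0 _)) (gtr0_norm t0) horner_coef.
apply: (@le_trans _ _ (\sum_(i < size p) `|p`_i| * (t^-1 ^+ i * expR (- (c / t))))).
  under [leRHS]eq_bigr do rewrite mulrA.
  rewrite -mulr_suml ler_pM2r ?expR_gt0//.
  apply: le_trans (ler_norm_sum _ _ _) _; apply: ler_sum => i _.
  by rewrite normrM normrX (@ger0_norm _ t^-1)// invr_ge0 ltW.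
rewrite /K mulr_suml; apply: ler_sum => i _.
by rewrite -mulrA ler_wpM2l// expr_inv_mul_expR.
Qed.

(** For [t > 0] the derivative of [p(1/t) exp(-c/t)] is [t^-2 (c p - p')(1/t) exp(-c/t)]; the factor
    [t^-2] becomes ['X^2]. *)
Definition dflat c p : {poly R} := 'X^2 * (c *: p - p^`()).

Lemma is_derive_flat p c t : 0 < c -> is_derive t 1 (flat p c) (flat (dflat c p) c t).
Proof.
move=> c0; have [t0|t0|->] := ltgtP t 0.
- rewrite (flat_le0 _ _ (ltW t0)); apply: (@near_eq_is_derive _ _ _ (cst 0)).
    near=> s; rewrite flat_le0//; apply: ltW; near: s.
    by apply: lt_nbhsl.
- have tN0 : t != 0 by rewrite gt_eqF.
  have dV : is_derive t (1:R) (fun s : R => s^-1) (- t ^- 2 *: 1).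
    by apply: is_deriveV => //; exact: is_derive_id.
  have d1 : is_derive t 1 (fun s => p.[s^-1]) (p^`().[t^-1] * (- t ^- 2 *: 1)).
    exact: (is_derive1_comp (is_derive_poly p t^-1) dV).
  have d2 : is_derive t 1 (fun s => - (c / s)) (- (c *: (- t ^- 2 *: 1))).
    by apply: is_deriveN; apply: (@is_deriveZ _ _ _ _ c).
  have d3 := @is_derive1_comp R expR (fun s => - (c / s)) t _ _ (is_derive_expR _) d2.
  have d4 : is_derive t 1 (fun s => p.[s^-1] * expR (- (c / s))) (flat (dflat c p) c t).
    refine (is_derive_eq (is_deriveM d1 d3) _).
    rewrite /flat t0 /dflat !hornerE /= /GRing.scale /=.
    by rewrite exprVn; field.
  apply: near_eq_is_derive d4; near=> s; rewrite /flat ifT//; near: s.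
  exact: lt_nbhsr.
- suff L : (fun h => h^-1 *: ((flat p c \o shift 0) (h *: 1) - flat p c 0)) @ 0^' --> (0 : R).
    rewrite (flat_le0 (dflat c p))//; apply: DeriveDef; first by apply/cvg_ex; exists 0.
    exact: cvg_lim L.
  (* At the origin the difference quotient of [flat p c] is [flat ('X * p) c], which is bounded by a
     multiple of [|h|]. *)
  have [K K0 HK] := flat_bound ('X * p) c0.
  apply: (@norm_cvg0 _ R^o).
  apply: (@squeeze_cvgr _ _ _ _ (fun=> 0) (fun h : R => K * `|h|)).
  + near=> h; rewrite normr_ge0/=; apply: le_trans (HK h).
    rewrite (flat_le0 p c (lexx 0)) subr0 /= addr0 -[h *: 1]/(h * 1) mulr1.
    rewrite /flat; case: ifP => _; last by rewrite scaler0.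
    by rewrite hornerM hornerX -mulrA.
  + exact: cvg_cst.
  + rewrite -[X in _ --> X](mulr0 K) -[X in K * X](@normr0 _ R^o).
    apply: cvgM; first exact: cvg_cst.
    by apply: cvg_norm; exact: cvg_within.
Unshelve. all: by end_near. Qed.

(* A class of functions supported in [[a, b]] and stable under derivation, whence
   the smoothness of bumps. *)
Inductive bump_class (c a b : R) : (R -> R) -> Prop :=
| bump_base p q : bump_class c a b (fun t => flat p c (t - a) * flat q c (b - t))
| bump_add f g : bump_class c a b f -> bump_class c a b g ->
    bump_class c a b (fun t => f t + g t).

Lemma bump_class_derive c a b f : 0 < c -> bump_class c a b f ->
  exists g, bump_class c a b g /\ forall t : R, is_derive t 1 f (g t).
Proof.
move=> c0; elim=> [p q|f1 f2 _ [g1 [B1 d1]] _ [g2 [B2 d2]]]; last first.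
  exists (fun t => g1 t + g2 t); split; first exact: bump_add.
  by move=> t; exact: is_deriveD.
exists (fun t => flat (dflat c p) c (t - a) * flat q c (b - t) +
  flat p c (t - a) * flat (- dflat c q) c (b - t)).
split; first by apply: bump_add; exact: bump_base.
move=> t.
have e1 : is_derive t 1 (fun s : R => flat p c (s - a)) (flat (dflat c p) c (t - a)).
  apply: is_derive_line (is_derive_flat p (t - a) c0) => h.
  by rewrite /= -addrA.
have e2 : is_derive t 1 (fun s : R => flat q c (b - s)) (- flat (dflat c q) c (b - t)).
  have -> : - flat (dflat c q) c (b - t) = flat (dflat c q) c (b - t) * (- 1).
    by rewrite mulrN1.
  apply: (@is_derive1_comp _ (flat q c) (fun s => b - s)).
    exact: is_derive_flat.
  rewrite -[X in is_derive _ _ _ X]add0r.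
  by apply: is_deriveB.
refine (is_derive_eq (is_deriveM e1 e2) _).
rewrite /GRing.scale /= addrC mulrC; congr (_ * _ + _ * _).
rewrite /flat; case: ifP => _; last by rewrite oppr0.
by rewrite hornerN mulNr.
Qed.

Lemma bump_class_continuous c a b f : 0 < c -> bump_class c a b f -> continuous f.
Proof.
move=> c0 /(bump_class_derive c0)[g [_ fg]] t.
by apply: differentiable_continuous; apply/derivable1_diffP; case: (fg t).
Qed.

Lemma bump_class_supp c a b f t : bump_class c a b f -> ~ (a < t < b) -> f t = 0.
Proof.
elim=> [p q|f1 f2 _ H1 _ H2] tab; last by rewrite H1// H2// addr0.
have [ta|ta] := leP t a; first by rewrite flat_le0 ?mul0r// subr_le0.
have [bt|bt] := leP b t; first by rewrite (flat_le0 q) ?mulr0// subr_le0.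
by case: tab; rewrite ta bt.
Qed.

Lemma bump_class_derivatives c a b f : 0 < c -> bump_class c a b f ->
  exists D : nat -> R -> R, [/\ D 0%N = f, forall k, bump_class c a b (D k)
    & forall k (t : R), is_derive t 1 (D k) (D k.+1 t)].
Proof.
move=> c0 Bf.
pose nxt (u : {f | bump_class c a b f}) : {f | bump_class c a b f} :=
  let w := cid (bump_class_derive c0 (svalP u)) in exist _ (sval w) (svalP w).1.
exists (fun k => sval (iter k nxt (exist _ f Bf))); split => //.
- by move=> k; exact: svalP.
- by move=> k t; rewrite iterS /nxt; case: cid => /= g [].
Qed.

End flat_functions.

(** * Smooth bumps on boxes *)

Section box_bumps.
Context (R : realType) (n : nat).
Implicit Types (a b : 'cV[R]_n).

Lemma prod_line_derive (f : 'I_n -> R -> R) (i : 'I_n) (d : R) (x : 'cV[R]_n) :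
  is_derive (x i ord0) 1 (f i) d ->
  is_derive x (delta_mx i ord0 : 'cV[R]_n) (fun x => \prod_j f j (x j ord0))
    (d * \prod_(j | j != i) f j (x j ord0)).
Proof.
move=> fd; set C := \prod_(j | _) _.
have fC : is_derive (x i ord0) 1 (fun t => f i t * C) (d * C).
  refine (is_derive_eq (is_deriveM fd (is_derive_cst C _ _)) _).
  by rewrite /GRing.scale /= mulr0 add0r mulrC.
apply: is_derive_line fC => h.
rewrite (bigD1 i)//= !mxE !eqxx; congr (f i _ * _).
apply: eq_bigr => j ji; rewrite !mxE (negbTE ji) /= mulr0 add0r//.
Qed.

Lemma prod_coord_continuous (f : 'I_n -> R -> R) : (forall i, continuous (f i)) ->
  continuous (fun x : 'cV[R]_n => \prod_j f j (x j ord0)).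
Proof.
move=> cf x; apply: (@cvg_big _ _ _ _ _ (@mul_continuous R) _ (nbhs x)) => j _.
by apply: continuous_comp; [exact: coord_continuous|exact: cf].
Qed.

(** The parameter [c] controls sharpness: along [c = 1/(k+1)] the bumps stay between 0 and 1 and
    converge pointwise to the indicator of the open box. *)
Definition box_bump (c : R) a b (x : 'cV[R]_n) : R :=
  \prod_i (flat 1 c (x i ord0 - a i ord0) * flat 1 c (b i ord0 - x i ord0)).

Lemma box_bump_supp c a b x : ~ box a b x -> box_bump c a b x = 0.
Proof.
move=> /existsNP[i xi]; rewrite /box_bump (bigD1 i)//=.
by rewrite (bump_class_supp (bump_base c (a i ord0) (b i ord0) 1 1) xi) mul0r.
Qed.

Lemma box_bump_derivatives c a b : 0 < c -> exists D : 'I_n -> nat -> R -> R,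
  [/\ box_bump c a b = (fun x => \prod_i D i 0%N (x i ord0)),
      forall i k, continuous (D i k),
      forall i k t, ~ (a i ord0 < t < b i ord0) -> D i k t = 0
    & forall i k (t : R), is_derive t 1 (D i k) (D i k.+1 t)].
Proof.
move=> c0.
have /choice[D HD] := fun i : 'I_n =>
  bump_class_derivatives c0 (bump_base c (a i ord0) (b i ord0) 1 1).
exists D; split.
- by apply/funext => x; apply: eq_bigr => i _; case: (HD i) => ->.
- by move=> i k; apply: bump_class_continuous c0 _; case: (HD i).
- by move=> i k t; apply: bump_class_supp; case: (HD i).
- by move=> i k t; case: (HD i).
Qed.

Lemma box_bump_pderiv c a b (i : 'I_n) : 0 < c ->
  [/\ continuous (box_bump c a b),
      continuous (pderiv i (box_bump c a b)),
      forall x, is_derive x (delta_mx i ord0 : 'cV[R]_n) (box_bump c a b)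
        (pderiv i (box_bump c a b) x)
    & forall x, ~ box a b x -> pderiv i (box_bump c a b) x = 0].
Proof.
move=> c0; have [D [-> cD D0 dD]] := box_bump_derivatives a b c0.
have pD (x : 'cV[R]_n) := prod_line_derive (f := fun j => D j 0%N) (dD i 0%N (x i ord0)).
pose E j := if j == i then D i 1%N else D j 0%N.
have pE : pderiv i (fun x => \prod_j D j 0%N (x j ord0)) = (fun x => \prod_j E j (x j ord0)).
  apply/funext => x; rewrite /pderiv; case: (pD x) => _ ->.
  rewrite [RHS](bigD1 i)//= /E eqxx; congr (_ * _).
  by apply: eq_bigr => j /negbTE ->.
split.
- by apply: (@prod_coord_continuous (fun j => D j 0%N)) => j; exact: cD.
- by rewrite pE; apply: (@prod_coord_continuous E) => j; rewrite /E; case: ifP.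
- by move=> x; have := pD x; rewrite /pderiv => H; case: (H) => ? ->.
- move=> x /existsNP[j xj]; rewrite pE (bigD1 j)//= /E.
  by case: eqP xj => [->|_] xj; rewrite D0// mul0r.
Qed.

Lemma test_function_box_bump (Om : set 'cV[R]_n) c a b : 0 < c ->
  cbox a b `<=` Om -> test_function Om (box_bump c a b).
Proof.
move=> c0 abO; split; last first.
  exists (cbox a b); split => //; first exact: compact_cbox.
  by move=> x xab; apply: box_bump_supp => /sub_box_cbox.
have [D [-> cD D0 dD]] := box_bump_derivatives a b c0.
move=> s.
(* The variables are separated, so an iterated partial derivative differentiates factor [j] as many
   times as [j] occurs in [s]. *)
have -> : foldr (@pderiv R n) (fun x => \prod_j D j 0%N (x j ord0)) s =
    fun x => \prod_j D j (count_mem j s) (x j ord0).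
  elim: s => //= i s ->; apply/funext => x; rewrite /pderiv.
  have [_ ->] := prod_line_derive (f := fun j => D j (count_mem j s))
    (dD i (count_mem i s) (x i ord0)).
  rewrite [RHS](bigD1 i)//= eqxx add1n; congr (_ * _).
  by apply: eq_bigr => j ji; rewrite eq_sym (negbTE ji) add0n.
split.
  by apply: (@prod_coord_continuous (fun j => D j (count_mem j s))) => j; exact: cD.
move=> i x.
by case: (prod_line_derive (f := fun j => D j (count_mem j s))
  (dD i (count_mem i s) (x i ord0))).
Qed.

Lemma flat1_ge0 c t : 0 <= flat 1 c t :> R.
Proof. by rewrite /flat; case: ifP => // _; rewrite hornerC mul1r expR_ge0. Qed.

Lemma flat1_le1 c t : 0 <= c -> flat 1 c t <= 1 :> R.
Proof.
move=> c0; rewrite /flat; case: ifP => // t0; rewrite hornerC mul1r.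
by rewrite expR_le1 oppr_le0 divr_ge0// ltW.
Qed.

Lemma box_bump_ge0 c a b x : 0 <= box_bump c a b x.
Proof. by apply: prodr_ge0 => i _; rewrite mulr_ge0// flat1_ge0. Qed.

Lemma box_bump_le1 c a b x : 0 <= c -> box_bump c a b x <= 1.
Proof.
move=> c0; apply: prodr_ile1 => i _; rewrite mulr_ge0 ?flat1_ge0//=.
by rewrite mulr_ile1 ?flat1_ge0 ?flat1_le1.
Qed.

Lemma flat1_cvg t : 0 < t -> flat 1 k.+1%:R^-1 t @[k --> \oo] --> (1 : R).
Proof.
move=> t0.
have -> : (fun k => flat 1 k.+1%:R^-1 t) = (fun k => expR (- (k.+1%:R^-1 / t)) : R).
  by apply/funext => k; rewrite /flat t0 hornerC mul1r.
suff : expR (- (k.+1%:R^-1 / t)) @[k --> \oo] --> (expR (- (0 / t)) : R).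
  by rewrite mul0r oppr0 expR0.
have h : (- (k.+1%:R^-1 / t)) @[k --> \oo] --> - (0 / t).
  by apply: cvgN; apply: cvgM; [exact: cvg_harmonic|exact: cvg_cst].
by apply: continuous_cvg h; exact: continuous_expR.
Qed.

Lemma box_bump_cvg a b x :
  box_bump k.+1%:R^-1 a b x @[k --> \oo] --> (\1_(box a b) x : R).
Proof.
rewrite indicE; have [xab|xab] := pselect (box a b x); last first.
  rewrite memNset//.
  have -> : (fun k => box_bump k.+1%:R^-1 a b x) = (fun=> 0 : R).
    by apply/funext => k; rewrite box_bump_supp.
  exact: cvg_cst.
have -> : (x \in box a b)%:R = \prod_(i < n) (1 * 1) :> R.
  by rewrite mem_set// big1// => i _; rewrite mulr1.
apply: (@cvg_big _ _ _ _ _ (@mul_continuous R) _ \oo) => j _.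
have /andP[ax xb] := xab j.
by apply: cvgM; apply: flat1_cvg; rewrite subr_gt0.
Qed.

End box_bumps.

(** * The fundamental lemma of the calculus of variations *)

Section fundamental_lemma.
Context (R : realType) (n : nat).
Local Notation leb := (lebesgue_cV R n).
Implicit Types (a b : 'cV[R]_n) (O : set 'cV[R]_n).

Definition boxes : set (set 'cV[R]_n) := [set B | exists a b, B = box a b].

Lemma boxI a b a' b' : box a b `&` box a' b' =
  box (\col_i Num.max (a i ord0) (a' i ord0)) (\col_i Num.min (b i ord0) (b' i ord0)).
Proof.
apply/seteqP; split=> [x [xab xab'] i|x xab].
  by rewrite !mxE gt_max lt_min; have /andP[-> ->] := xab i; have /andP[-> ->] := xab' i.
split=> i; have := xab i; rewrite !mxE gt_max lt_min.
  by move=> /andP[/andP[-> _] /andP[-> _]].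
by move=> /andP[/andP[_ ->] /andP[_ ->]].
Qed.

(** Boxes generate the sigma-algebra and are stable under intersection, as the pi-lambda theorem
    demands. Generation holds because the preimage of an open interval under a coordinate is a
    countable union of rational boxes. *)
Lemma measurable_boxes : @measurable _ 'cV[R]_n = <<s boxes >>.
Proof.
apply/seteqP; split; last first.
  apply: smallest_sub; first exact: sigma_algebra_measurable.
  by move=> _ [a [b ->]]; exact: measurable_box.
apply: smallest_sub; first exact: smallest_sigma_algebra.
move=> _ [i [j [A mA ->]]].
have : measurable_fun [set: g_sigma_algebraType boxes] (fun M : g_sigma_algebraType boxes => (M : 'cV[R]_n) i j).
  apply: (measurability _ (RGenOpens.measurableE R)) => _ [_ [s [t ->] <-]].
  rewrite setTI.
  have oO : open ((fun M : 'cV[R]_n => M i j) @^-1` `]s, t[%classic).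
    by apply: open_comp => [x _|]; [exact: coord_continuous|exact: interval_open].
  have [D [_ ->]] := open_bigcup_box oO.
  rewrite bigcup_mkcond.
  apply: countable_bigcupT_measurable => [|p]; first exact: countableP.
  by case: ifPn => // _; apply: sub_sigma_algebra; eexists; eexists.
by move=> /(_ measurableT A mA); rewrite setTI.
Qed.

(** By the pi-lambda theorem the integral of [w] vanishes over every measurable subset of the box,
    which determines [w] almost everywhere. *)
Lemma ae_zero_of_box_integrals a b (w : 'cV[R]_n -> R) :
  leb.-integrable (box a b) (EFin \o w) ->
  (forall a' b', cbox a' b' `<=` cbox a b -> (\int[leb]_(x in box a' b') (w x)%:E = 0)%E) ->
  {ae leb, forall x, box a b x -> w x = 0}.
Proof.
move=> iw w0; have mB := measurable_box a b.
have H S : <<s boxes >> S -> (\int[leb]_(x in box a b `&` S) (w x)%:E = 0)%E.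
  apply: (@dynkin_induction _ _ boxes (fun S => \int[leb]_(x in box a b `&` S) (w x)%:E = 0)%E).
  - exact: measurable_boxes.
  - by move=> _ _ [a1 [b1 ->]] [a2 [b2 ->]]; rewrite boxI; do 2 eexists.
  - by rewrite setIT; exact: w0.
  - move=> _ [a1 [b1 ->]]; rewrite boxI; apply: w0.
    move=> x xab i; have := xab i; rewrite !mxE ge_max le_min.
    by move=> /andP[/andP[-> _] /andP[-> _]].
  - move=> E mE E0.
    have : (\int[leb]_(x in (box a b `&` E) `|` (box a b `&` ~` E)) (w x)%:E = 0)%E.
      by rewrite -setIUr setUv setIT; exact: w0.
    rewrite integral_setU ?E0 ?add0e//.
    + exact: measurableI.
    + by apply: measurableI => //; exact: measurableC.
    + by rewrite -setIUr setUv setIT; apply: measurable_int iw.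
    + by apply/disj_setPS => x [[_ Ex] [_ NEx]].
  - move=> F mF tF F0.
    have mBF k : measurable (box a b `&` F k) by exact: measurableI.
    rewrite setI_bigcupr integral_bigcup//.
    + by apply: eseries0 => k _ _; exact: F0.
    + exact: trivIset_setIl.
    + rewrite -setI_bigcupr; apply: integrableS iw => //.
      by apply: measurableI => //; exact: bigcupT_measurable.
have := @integral_ae_eq _ _ _ leb (box a b) mB (cst 0%E) (EFin \o w) iw.
move=> /(_ (measurable_cst _)) ae0.
have /ae0 : forall E, E `<=` box a b -> measurable E ->
    (\int[leb]_(x in E) (EFin \o w) x = \int[leb]_(x in E) (cst 0) x)%E.
  move=> E EB mE; rewrite integral0.
  have := H E; rewrite -measurable_boxes setIC setIidl//; exact.
by apply: filterS => x /= wx Bx; case: (wx Bx).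
Qed.

Lemma fundamental_lemma O (w : 'cV[R]_n -> R) : open O ->
  leb.-integrable O (EFin \o w) ->
  (forall c a b, 0 < c -> cbox a b `<=` O ->
    (\int[leb]_(x in O) (w x * box_bump c a b x)%:E = 0)%E) ->
  {ae leb, forall x, O x -> w x = 0}.
Proof.
move=> oO iw w0; have mO := open_measurable_cV oO.
have mw : measurable_fun O w by apply/measurable_EFinP; exact: measurable_int iw.
(* Dominated convergence with bound [|w|], as the bumps tend to the indicator of the box. *)
have int0 a b : cbox a b `<=` O -> (\int[leb]_(x in box a b) (w x)%:E = 0)%E.
  move=> abO.
  have BO : box a b `<=` O by apply: subset_trans abO; exact: sub_box_cbox.
  have mb k : measurable_fun O (box_bump k.+1%:R^-1 a b).
    apply: continuous_measurable_cV.
    have [D [-> cD _ _]] := box_bump_derivatives a b (ltac:(by rewrite invr_gt0) : 0 < k.+1%:R^-1 :> R).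
    by apply: (@prod_coord_continuous _ _ (fun i => D i 0%N)).
  have [|||||_ _] := @dominated_convergence _ _ _ leb O mO
    (fun k x => (w x * box_bump k.+1%:R^-1 a b x)%:E)
    (fun x => (w x * \1_(box a b) x)%:E) (fun x => `|w x|%:E).
  - by move=> k; apply/measurable_EFinP; apply: measurable_funM => //; exact: mb.
  - apply/measurable_EFinP; apply: measurable_funM => //.
    by apply: measurable_indic; exact: measurable_box.
  - apply: aeW => x Ox; apply: cvg_EFin; first exact: nearW.
    by apply: cvgM; [exact: cvg_cst|exact: box_bump_cvg].
  - exact: integrable_abse iw.
  - apply: aeW => x k Ox /=; rewrite lee_fin normrM ler_piMr//.
    by rewrite ger0_norm ?box_bump_ge0// box_bump_le1// invr_ge0.
  - rewrite (_ : (fun _ => _) = cst 0%E); last first.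
      by apply/funext => k; exact: w0.
    move=> /cvg_lim; rewrite lim_cst// => /(_ (@ereal_hausdorff R)) int0.
    rewrite [RHS]int0 -[in LHS](setIidr BO) integral_mkcondr.
    apply: eq_integral => x _; rewrite patchE indicE; case: (x \in box a b).
      by rewrite mulr1.
    by rewrite mulr0.
have [D [DO ->]] := open_bigcup_box oO.
(* [pickle] numbers the rational boxes that exhaust [O], so that only countably many null sets have
   to be united. *)
pose P k x := if unpickle k is Some p then
  D p -> box (map_mx ratr p.1) (map_mx ratr p.2) x -> w x = 0 else True.
have : {ae leb, forall x k, P k x}.
  apply: ae_foralln => k; rewrite /P; case: unpickle => [p|]; last exact: aeW.
  have [Dp|nDp] := pselect (D p); last by apply: aeW => x /nDp.
  have pO := DO p Dp.
  have : {ae leb, forall x, box (map_mx ratr p.1) (map_mx ratr p.2) x -> w x = 0}.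
    apply: ae_zero_of_box_integrals.
      apply: integrableS iw => //; first exact: measurable_box.
      by apply: subset_trans pO; exact: sub_box_cbox.
    by move=> a' b' sB; apply: int0; apply: subset_trans pO.
  by apply: filterS => x wx Dp'; exact: wx.
apply: filterS => x Px [p Dp xp].
by have := Px (pickle p); rewrite /P pickleK; exact.
Qed.

End fundamental_lemma.

(** * Square-integrable functions and weak divergences *)

Section real_integrable.
Context d (T : measurableType d) (R : realType) (mu : {measure set T -> \bar R}).
Context (D : set T) (mD : measurable D).
Implicit Types f g : T -> R.

Definition rintegrable f := mu.-integrable D (EFin \o f).

Lemma rintegrableD f g : rintegrable f -> rintegrable g ->
  rintegrable (fun x => f x + g x).
Proof. by move=> If Ig; exact: (integrableD mD If Ig). Qed.

Lemma rintegrableZ (c : R) f : rintegrable f -> rintegrable (fun x => c * f x).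
Proof. by move=> If; exact: (integrableZl mD c If). Qed.

Lemma rintegrable_sum n (f : 'I_n -> T -> R) : (forall i, rintegrable (f i)) ->
  rintegrable (fun x => \sum_i f i x).
Proof.
move=> If.
have -> : (fun x => \sum_i f i x) = \sum_i f i :> (T -> R^o).
  by apply/funext => x; rewrite fct_sumE.
elim/big_ind : _ => [|g h Ig Ih|i _]; last exact: If.
  exact: integrable0.
exact: rintegrableD.
Qed.

Lemma Rintegral_lin (c : R) f g : rintegrable f -> rintegrable g ->
  \int[mu]_(x in D) (c * f x + g x) = c * \int[mu]_(x in D) f x + \int[mu]_(x in D) g x.
Proof.
move=> If Ig; rewrite RintegralD//; last exact: rintegrableZ.
by rewrite RintegralZl.
Qed.

Lemma Rintegral_sum n (f : 'I_n -> T -> R) : (forall i, rintegrable (f i)) ->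
  \int[mu]_(x in D) (\sum_i f i x) = \sum_i \int[mu]_(x in D) f i x.
Proof.
elim: n f => [f _|n IH f If].
  rewrite big_ord0; under eq_Rintegral do rewrite big_ord0.
  by rewrite Rintegral_cst// mul0r.
under eq_Rintegral do rewrite big_ord_recl.
rewrite RintegralD//; first by rewrite IH// big_ord_recl.
  exact: If.
exact: (@rintegrable_sum _ (fun i => f (lift ord0 i))).
Qed.

Lemma ae_eq_Rintegral f g : measurable_fun D f -> measurable_fun D g ->
  (\forall x \ae mu, D x -> f x = g x) ->
  \int[mu]_(x in D) f x = \int[mu]_(x in D) g x.
Proof.
move=> mf mg fg; congr fine; apply: ae_eq_integral => //.
- exact/measurable_EFinP.
- exact/measurable_EFinP.
- by apply: filterS fg => x fgx Dx; rewrite fgx.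
Qed.

Lemma ae_bounded_rintegrable f (C : R) : (mu D < +oo)%E -> measurable_fun D f ->
  (\forall x \ae mu, D x -> `|f x| <= C) -> rintegrable f.
Proof.
move=> Doo mf fC; apply/integrableP; split; first exact/measurable_EFinP.
apply: (@le_lt_trans _ _ (\int[mu]_(x in D) `|C|%:E)%E).
  apply: ae_ge0_le_integral => //.
  - by apply/measurable_EFinP; exact: measurableT_comp.
  - apply: filterS fC => x fCx Dx; rewrite /= lee_fin.
    exact: le_trans (fCx Dx) (ler_norm C).
by rewrite integral_cst// lte_mul_pinfty.
Qed.

End real_integrable.

Section L2.
Context (R : realType) (d : nat) (Om : set 'cV[R]_d).
Hypotheses (oOm : open Om) (bOm : bounded_set Om).
Local Notation leb := (lebesgue_cV R d).
Implicit Types (u v w : 'cV[R]_d -> R) (q r : 'cV[R]_d -> 'cV[R]_d).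

Let mOm : measurable Om. Proof. exact: open_measurable_cV. Qed.

Lemma ae_onW (P : 'cV[R]_d -> Prop) : (forall x, Om x -> P x) -> ae_on Om P.
Proof. by move=> OP; apply: aeW. Qed.

Lemma ae_onS (P Q : 'cV[R]_d -> Prop) : (forall x, Om x -> P x -> Q x) ->
  ae_on Om P -> ae_on Om Q.
Proof. by move=> PQ; rewrite /ae_on; apply: filterS => x Px Ox; apply: PQ => //; exact: Px. Qed.

Lemma ae_onS2 (P Q S : 'cV[R]_d -> Prop) : (forall x, Om x -> P x -> Q x -> S x) ->
  ae_on Om P -> ae_on Om Q -> ae_on Om S.
Proof.
move=> PQ; rewrite /ae_on; apply: filterS2 => x Px Qx Ox.
by apply: PQ => //; [exact: Px|exact: Qx].
Qed.

Lemma ae_on_forall (I : finType) (P : I -> 'cV[R]_d -> Prop) :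
  (forall i, ae_on Om (P i)) -> ae_on Om (fun x => forall i, P i x).
Proof.
move=> aP.
have : {ae leb, forall x, forall i : I, Om x -> P i x} by exact: filter_forall.
by rewrite /ae_on; apply: filterS => x Px Ox i; exact: Px.
Qed.

Lemma inL2_mul u v : inL2 Om u -> inL2 Om v -> rintegrable leb Om (fun x => u x * v x).
Proof.
move=> [mu iu] [mv iv].
apply: (@le_integrable _ _ _ leb Om mOm _ (EFin \o (fun x => u x ^+ 2 + v x ^+ 2))).
- by apply/measurable_EFinP; exact: measurable_funM.
- move=> x _ /=; rewrite lee_fin normrM [leRHS]ger0_norm ?addr_ge0 ?sqr_ge0//.
  rewrite -[u x ^+ 2]real_normK ?num_real// -[v x ^+ 2]real_normK ?num_real//.
  have := sqr_ge0 (`|u x| - `|v x|); have := normr_ge0 (u x); have := normr_ge0 (v x); nra.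
- exact: rintegrableD.
Qed.

Lemma inL2_lin (c : R) u v : inL2 Om u -> inL2 Om v -> inL2 Om (fun x => c * u x + v x).
Proof.
move=> L2u L2v; have [mu iu] := L2u; have [mv iv] := L2v; split.
  by apply: measurable_funD => //; exact: measurable_funM.
have -> : (fun x => ((c * u x + v x) ^+ 2)%:E) = EFin \o (fun x =>
    c ^+ 2 * u x ^+ 2 + ((2 * c) * (u x * v x) + v x ^+ 2)).
  by apply/funext => x /=; congr EFin; ring.
apply: rintegrableD => //; first exact: rintegrableZ.
by apply: rintegrableD => //; apply: rintegrableZ => //; exact: inL2_mul.
Qed.

Lemma ae_bounded_inL2 u : inLinfty Om u -> inL2 Om u.
Proof.
move=> [mu [C uC]]; split => //.
apply: (@ae_bounded_rintegrable _ _ _ leb Om mOm _ (C ^+ 2)).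
- exact: lebesgue_cV_bounded_lty.
- exact: measurable_funX.
apply: ae_onS uC => x Ox uC; rewrite ger0_norm ?sqr_ge0//.
by rewrite -[u x ^+ 2]real_normK ?num_real// lerXn2r ?nnegrE// (le_trans _ uC).
Qed.

Lemma continuous_Linfty u : continuous u -> inLinfty Om u.
Proof.
move=> cu; split; first exact: continuous_measurable_cV.
have /bounded_set_cVP[r r0 Or] := bOm.
have [C _ uC] := continuous_cbox_bounded (const_mx (- r)) (const_mx r) cu.
exists C; apply: aeW => x Ox; apply: uC; exact/cubeP/Or.
Qed.

Lemma inL2_cst (c : R) : inL2 Om (fun=> c).
Proof. by apply/ae_bounded_inL2/continuous_Linfty; exact: cst_continuous. Qed.

Lemma inL2_rintegrable u : inL2 Om u -> rintegrable leb Om u.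
Proof.
move=> L2u; have := inL2_mul L2u (inL2_cst 1).
by rewrite (_ : (fun x => _) = u)//; apply/funext => x; rewrite mulr1.
Qed.

Lemma ipC u v : ip Om u v = ip Om v u.
Proof. by apply: eq_Rintegral => x _; rewrite mulrC. Qed.

Lemma ip_linl (c : R) u v w : inL2 Om u -> inL2 Om v -> inL2 Om w ->
  ip Om (fun x => c * u x + v x) w = c * ip Om u w + ip Om v w.
Proof.
move=> L2u L2v L2w; rewrite -Rintegral_lin//; [|exact: inL2_mul..].
by apply: eq_Rintegral => x _; rewrite mulrDl mulrA.
Qed.

Lemma ip_linr (c : R) u v w : inL2 Om u -> inL2 Om v -> inL2 Om w ->
  ip Om w (fun x => c * u x + v x) = c * ip Om w u + ip Om w v.
Proof. by move=> *; rewrite ipC ip_linl// ![ip Om _ w]ipC. Qed.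

Lemma ip_ge0 u : 0 <= ip Om u u.
Proof. by apply: Rintegral_ge0 => x _; rewrite -expr2 sqr_ge0. Qed.

Lemma ip_ae_eq u u' v v' : inL2 Om u -> inL2 Om u' -> inL2 Om v -> inL2 Om v' ->
  ae_on Om (fun x => u x = u' x) -> ae_on Om (fun x => v x = v' x) ->
  ip Om u v = ip Om u' v'.
Proof.
move=> [mu _] [mu' _] [mv _] [mv' _] uu' vv'.
apply: ae_eq_Rintegral => //; try exact: measurable_funM.
by apply: ae_onS2 uu' vv' => x _ -> ->.
Qed.

Lemma Rintegral_eq0_ge0 (f : 'cV[R]_d -> R) : rintegrable leb Om f ->
  ae_on Om (fun x => 0 <= f x) -> \int[leb]_(x in Om) f x = 0 ->
  ae_on Om (fun x => f x = 0).
Proof.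
move=> If f0 If0.
have mf : measurable_fun Om (EFin \o f) by exact: measurable_int If.
have : (\int[leb]_(x in Om) `|(f x)%:E| = 0)%E.
  rewrite -[RHS](_ : \int[leb]_(x in Om) (f x)%:E = 0)%E; last first.
    by rewrite -[LHS]fineK ?(integrable_fin_num mOm If)// -[fine _]/(Rintegral _ _ _) If0.
  apply: ae_eq_integral => //; first exact: measurableT_comp.
  by apply: ae_onS f0 => x _ fx0 /=; rewrite ger0_norm.
move=> /(iffLR (ae_eq_integral_abs leb mOm mf)).
by apply: ae_onS => x _ /= [].
Qed.

Lemma ip_eq0 u : inL2 Om u -> ip Om u u = 0 -> ae_on Om (fun x => u x = 0).
Proof.
move=> L2u u0.
have : ae_on Om (fun x => u x * u x = 0).
  apply: Rintegral_eq0_ge0 => //; first exact: inL2_mul.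
  by apply: ae_onW => x _; rewrite -expr2 sqr_ge0.
by apply: ae_onS => x _ /eqP; rewrite mulf_eq0 orbb => /eqP.
Qed.

Lemma ip_null u v : inL2 Om u -> inL2 Om v -> ae_on Om (fun x => u x = 0) -> ip Om u v = 0.
Proof.
move=> L2u L2v u0; rewrite (ip_ae_eq (u' := fun=> 0) (v' := v))//.
- by apply: etrans (_ : \int[leb]_(x in Om) 0 = 0); [apply: eq_Rintegral => x _; rewrite mul0r|rewrite Rintegral_cst// mul0r].
- exact: inL2_cst.
- exact: ae_onW.
Qed.

Lemma ipvE q r : inL2v Om q -> inL2v Om r ->
  ipv Om q r = \sum_i ip Om (fun x => q x i ord0) (fun x => r x i ord0).
Proof.
by move=> L2q L2r; rewrite -Rintegral_sum// => i; exact: inL2_mul.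
Qed.

Lemma inL2v_lin (c : R) q r : inL2v Om q -> inL2v Om r ->
  inL2v Om (fun x => c *: q x + r x).
Proof.
move=> L2q L2r i.
have := inL2_lin c (L2q i) (L2r i).
by rewrite (_ : (fun x => c * _ + _) = (fun x => (c *: q x + r x) i ord0))//;
  apply/funext => x; rewrite !mxE.
Qed.

Lemma inL2v_dot q r : inL2v Om q -> inL2v Om r ->
  rintegrable leb Om (fun x => dot (q x) (r x)).
Proof.
by move=> L2q L2r; apply: rintegrable_sum => // i; exact: inL2_mul.
Qed.

Lemma ipv_linl (c : R) q r s : inL2v Om q -> inL2v Om r -> inL2v Om s ->
  ipv Om (fun x => c *: q x + r x) s = c * ipv Om q s + ipv Om r s.
Proof.
move=> L2q L2r L2s; rewrite -Rintegral_lin//; [|exact: inL2v_dot..].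
apply: eq_Rintegral => x _; rewrite /dot mulr_sumr -big_split/=.
by apply: eq_bigr => i _; rewrite !mxE; ring.
Qed.

Lemma test_function_L2 (phi : 'cV[R]_d -> R) : test_function Om phi ->
  inL2 Om phi /\ inL2v Om (fun x => \col_i pderiv i phi x).
Proof.
move=> [sphi _]; split; first by apply/ae_bounded_inL2/continuous_Linfty; case: (sphi [::]).
move=> i.
have -> : (fun x => (\col_i pderiv i phi x) i ord0) = pderiv i phi.
  by apply/funext => x; rewrite mxE.
by apply/ae_bounded_inL2/continuous_Linfty; case: (sphi [:: i]).
Qed.

Lemma weak_div_lin (c : R) q r w v : inL2v Om q -> inL2v Om r ->
  weak_div Om q w -> weak_div Om r v ->
  weak_div Om (fun x => c *: q x + r x) (fun x => c * w x + v x).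
Proof.
move=> L2q L2r [L2w qw] [L2v rv]; split; first exact: inL2_lin.
move=> phi tphi; have [L2p L2dp] := test_function_L2 tphi.
by rewrite ipv_linl// ip_linl// qw// rv//; ring.
Qed.

(** The difference is orthogonal to all bumps supported in [Om]. Identities for [wdiv], which is a
    choice among weak divergences, are obtained by comparison through this lemma. *)
Lemma weak_div_unique q w w' : weak_div Om q w -> weak_div Om q w' ->
  ae_on Om (fun x => w x = w' x).
Proof.
move=> [L2w qw] [L2w' qw'].
have L2 : inL2 Om (fun x => (-1) * w' x + w x) by exact: inL2_lin.
have : {ae leb, forall x, Om x -> (-1) * w' x + w x = 0}.
  apply: fundamental_lemma => //; first exact: inL2_rintegrable.
  move=> c a b c0 abO.
  have tphi := test_function_box_bump c0 abO.
  have [L2p L2dp] := test_function_L2 tphi.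
  have := ip_linl (-1) L2w' L2w L2p.
  rewrite (_ : -1 * ip Om w' _ + ip Om w _ = 0); last first.
    by have := qw _ tphi; have := qw' _ tphi; move=> -> /eqP; rewrite eqr_opp => /eqP ->; ring.
  by move=> H; rewrite -[LHS]fineK ?(integrable_fin_num mOm (inL2_mul L2 L2p))// -[fine _]/(ip _ _ _) H.
by apply: ae_onS => x _ /eqP; rewrite mulN1r addrC subr_eq0 => /eqP.
Qed.

Lemma wdivP q : inHdiv Om q -> weak_div Om q (wdiv Om q).
Proof. by move=> [_ [w qw]]; apply: (@xgetPex _ (cst 0) [set w | weak_div Om q w]); exists w. Qed.

Lemma inHdiv_lin (c : R) q r : inHdiv Om q -> inHdiv Om r ->
  inHdiv Om (fun x => c *: q x + r x).
Proof.
move=> [L2q [w qw]] [L2r [v rv]]; split; first exact: inL2v_lin.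
by exists (fun x => c * w x + v x); exact: weak_div_lin.
Qed.

Lemma wdiv_lin (c : R) q r : inHdiv Om q -> inHdiv Om r ->
  ae_on Om (fun x => wdiv Om (fun x => c *: q x + r x) x =
                     c * wdiv Om q x + wdiv Om r x).
Proof.
move=> Hq Hr; apply: weak_div_unique; first exact/wdivP/inHdiv_lin.
by apply: weak_div_lin; [case: Hq|case: Hr|exact: wdivP|exact: wdivP].
Qed.

Lemma wdiv_null q : inHdiv Om q -> ae_on Om (fun x => q x = 0) ->
  ae_on Om (fun x => wdiv Om q x = 0).
Proof.
move=> Hq q0; apply: weak_div_unique (wdivP Hq) _; split; first exact: inL2_cst.
move=> phi tphi; have [L2p L2dp] := test_function_L2 tphi; have [L2q _] := Hq.
rewrite ipvE// big1; last first.
  move=> i _; apply: ip_null => //.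
  by apply: ae_onS q0 => x _ ->; rewrite mxE.
by rewrite ip_null ?oppr0//; [exact: inL2_cst|exact: ae_onW].
Qed.

End L2.

(** * Weak and classical divergence *)

Section classical_divergence.
Context (R : realType) (d : nat).
Local Notation leb := (lebesgue_cV R d).
Implicit Types (O Om : set 'cV[R]_d).

Lemma ae_on_subset O Om (P : 'cV[R]_d -> Prop) : O `<=` Om -> ae_on Om P -> ae_on O P.
Proof. by move=> OOm; rewrite /ae_on; apply: filterS => x Px /OOm. Qed.

Lemma Rintegral_supp O Om (f : 'cV[R]_d -> R) : O `<=` Om ->
  (forall x, Om x -> ~ O x -> f x = 0) ->
  \int[leb]_(x in O) f x = \int[leb]_(x in Om) f x.
Proof.
move=> OOm f0; rewrite -(setIidr OOm) Rintegral_mkcondr.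
apply: eq_Rintegral => x; rewrite inE => Omx; rewrite patchE.
by case: ifPn => //; rewrite notin_setE => Ox; rewrite f0.
Qed.

(** For each [i], the derivative in direction [i] of the compactly supported product of [Q i] and
    the bump has integral 0 over the whole space. *)
Lemma box_bump_ibp O c a b (Q dQ : 'I_d -> 'cV[R]_d -> R) : open O -> 0 < c ->
  cbox a b `<=` O ->
  (forall i, continuous (Q i)) -> (forall i, continuous (dQ i)) ->
  (forall i x, is_derive x (delta_mx i ord0 : 'cV[R]_d) (Q i) (dQ i x)) ->
  \int[leb]_(x in O) ((\sum_i dQ i x) * box_bump c a b x) =
  - \sum_i \int[leb]_(x in O) (Q i x * pderiv i (box_bump c a b) x).
Proof.
move=> oO c0 abO cQ cdQ QdQ.
have BO : box a b `<=` O by apply: subset_trans abO; exact: sub_box_cbox.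
pose phi := box_bump c a b.
pose r := `|a| + `|b| + 1.
have cube_out x : ~ cube r x -> ~ box a b x.
  apply: contra_not => xab; apply/cubeP => i; have /andP[ax xb] := xab i.
  have := le_mx_norm a i ord0; have := le_mx_norm b i ord0.
  by rewrite /r !ler_norml; lra.
have phi0 x : ~ box a b x -> phi x = 0 by exact: box_bump_supp.
have HD i := box_bump_pderiv a b i c0.
have cphi i : continuous (pderiv i phi) by case: (HD i).
have dphi i x : is_derive x (delta_mx i ord0 : 'cV[R]_d) phi (pderiv i phi x).
  by case: (HD i).
have phid0 i x : ~ box a b x -> pderiv i phi x = 0 by case: (HD i) => _ _ _; exact.
(* [box_bump_pderiv] gives continuity of the bump only through an index, so dimension 0, where both
   sides are 0, is treated apart. *)
have [d0|[i0]] : (forall i : 'I_d, False) \/ exists i : 'I_d, True.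
  by case: (d) => [|n]; [left; case|right; exists ord0].
  have E (f : 'I_d -> R) : \sum_i f i = 0 by apply: big1 => i; case: (d0 i).
  rewrite E oppr0; apply: etrans (_ : \int[leb]_(x in O) 0 = 0).
    by apply: eq_Rintegral => x _; rewrite E mul0r.
  by rewrite Rintegral_cst ?mul0r//; exact: open_measurable_cV.
move=> _; have cphi0 : continuous phi by case: (HD i0).
have cM (f g : 'cV[R]_d -> R) : continuous f -> continuous g -> continuous (fun x => f x * g x).
  by move=> cf cg x; exact: (cvgM (cf x) (cg x)).
have int1 i : rintegrable leb setT (fun x => dQ i x * phi x).
  apply: (@continuous_supp_integrable _ _ _ r); first exact: cM.
  by move=> x /cube_out xab; rewrite phi0// mulr0.
have int2 i : rintegrable leb setT (fun x => Q i x * pderiv i phi x).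
  apply: (@continuous_supp_integrable _ _ _ r); first exact: cM.
  by move=> x /cube_out xab; rewrite phid0// mulr0.
have key i : \int[leb]_x (dQ i x * phi x) = - \int[leb]_x (Q i x * pderiv i phi x).
  apply/eqP; rewrite -subr_eq0 opprK; apply/eqP.
  rewrite -RintegralD//; [|exact: int1|exact: int2].
  suff H : (\int[leb]_x (dQ i x * phi x + Q i x * pderiv i phi x)%:E = 0)%E.
    by rewrite /Rintegral H.
  apply: (@integral_derive_supp _ _ (fun x => Q i x * phi x)
    (fun x => dQ i x * phi x + Q i x * pderiv i phi x) i r) => //.
  - exact: cM.
  - by move=> x; exact: (cvgD (cM _ _ (cdQ i) cphi0 x) (cM _ _ (cQ i) (cphi i) x)).
  - move=> x; refine (is_derive_eq (is_deriveM (QdQ i x) (dphi i x)) _).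
    by rewrite /GRing.scale /= addrC; congr (_ + _); rewrite mulrC.
  - by move=> x /cube_out xab; rewrite phi0// mulr0.
  - by move=> x /cube_out xab; rewrite phi0// phid0// !mulr0 addr0.
have -> : \int[leb]_(x in O) ((\sum_i dQ i x) * box_bump c a b x) =
    \int[leb]_x ((\sum_i dQ i x) * phi x).
  by apply: Rintegral_supp => // x _ Ox; rewrite -/phi phi0 ?mulr0// => /BO.
under eq_Rintegral do rewrite mulr_suml.
rewrite Rintegral_sum// -sumrN; apply: eq_bigr => i _; rewrite key; congr (- _).
apply/esym; apply: Rintegral_supp => // x _ Ox.
by rewrite phid0 ?mulr0// => /BO.
Qed.

(** A bump supported in a box inside [O] is a test function for [Om] too. Testing the weak
    divergence with it and integrating the classical one by parts give the same number, and the
    fundamental lemma on [O] concludes. *)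
Lemma weak_div_classical O Om q w (Q dQ : 'I_d -> 'cV[R]_d -> R) :
  open O -> open Om -> bounded_set Om -> O `<=` Om -> inL2v Om q -> weak_div Om q w ->
  (forall i, continuous (Q i)) -> (forall i, continuous (dQ i)) ->
  (forall i x, is_derive x (delta_mx i ord0 : 'cV[R]_d) (Q i) (dQ i x)) ->
  ae_on O (fun x => forall i, q x i ord0 = Q i x) ->
  ae_on O (fun x => w x = \sum_i dQ i x).
Proof.
move=> oO oOm bOm OOm L2q [L2w qw] cQ cdQ QdQ qQ.
have mO := open_measurable_cV oO; have mOm := open_measurable_cV oOm.
have bO : bounded_set O.
  have /bounded_set_cVP[r r0 Or] := bOm.
  by apply/bounded_set_cVP; exists r => // x /OOm; exact: Or.
have cD : continuous (fun x => \sum_i dQ i x).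
  move=> x; apply: (@cvg_big _ _ _ _ _ (@add_continuous R) _ (nbhs x)) => i _.
  exact: cdQ.
have L2D : inL2 O (fun x => \sum_i dQ i x).
  by apply: ae_bounded_inL2 => //; exact: continuous_Linfty.
have L2wO : inL2 O w.
  have [mw iw] := L2w; split; first exact: measurable_funS mw.
  exact: integrableS iw.
have L2 := inL2_lin oO (-1) L2D L2wO.
suff : {ae leb, forall x, O x -> -1 * (\sum_i dQ i x) + w x = 0}.
  rewrite /ae_on; apply: filterS => x H Ox; have := H Ox => /eqP.
  by rewrite mulN1r addrC subr_eq0 => /eqP.
apply: fundamental_lemma => //; first exact: inL2_rintegrable.
move=> c a b c0 abO.
have abOm : cbox a b `<=` Om by exact: subset_trans OOm.
have tphi := test_function_box_bump c0 abO.
have tphi' := test_function_box_bump c0 abOm.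
have [L2p L2dp] := test_function_L2 oO bO tphi.
have [L2p' L2dp'] := test_function_L2 oOm bOm tphi'.
have Ox0 x : Om x -> ~ O x -> ~ box a b x.
  by move=> _; apply: contra_not => /sub_box_cbox/abO.
have i1 := inL2_mul oO L2 L2p.
rewrite -[LHS]fineK ?(integrable_fin_num mO i1)// -[fine _]/(ip O _ _).
rewrite ip_linl//.
have -> : ip O w (box_bump c a b) = ip Om w (box_bump c a b).
  apply: Rintegral_supp => // x Omx Ox; rewrite box_bump_supp ?mulr0//.
  exact: Ox0.
have -> : ip Om w (box_bump c a b) = - \sum_i \int[leb]_(x in O)
    (Q i x * pderiv i (box_bump c a b) x).
  rewrite -[LHS]opprK -qw// ipvE//; congr (- _); apply: eq_bigr => i _.
  have [_ cpd _ pd0] := box_bump_pderiv a b i c0.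
  have -> : (fun x => (\col_j pderiv j (box_bump c a b) x) i ord0) = pderiv i (box_bump c a b).
    by apply/funext => x; rewrite mxE.
  rewrite /ip.
  have <- : \int[leb]_(x in O) (q x i ord0 * pderiv i (box_bump c a b) x) =
    \int[leb]_(x in Om) (q x i ord0 * pderiv i (box_bump c a b) x).
    by apply: Rintegral_supp => // x Omx Ox; rewrite pd0 ?mulr0//; exact: Ox0.
  apply: ae_eq_Rintegral => //.
  - apply: measurable_funM; first by apply: measurable_funS (L2q i).1.
    exact: continuous_measurable_cV.
  - by apply: measurable_funM; exact: continuous_measurable_cV.
  - by apply: ae_onS qQ => x _ ->.
rewrite /ip (@box_bump_ibp O c a b Q dQ)//.
by rewrite mulN1r opprK subrr.
Qed.

End classical_divergence.

(** * Polynomial spaces and meshes *)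

Section polynomial_functions.
Context (R : realType) (d : nat).
Implicit Types (e : 'I_d -> nat) (f g : 'cV[R]_d -> R).

Definition mono e (x : 'cV[R]_d) : R := \prod_i x i ord0 ^+ e i.

Definition expo N (a : {ffun 'I_d -> 'I_N.+1}) : 'I_d -> nat := fun i => a i.

(** Truncated subtraction leaves an exponent 0 unchanged; this is harmless in the derivative of a
    monomial, whose factor [(e i)%:R] is then 0. *)
Definition decr e (i j : 'I_d) : nat := e j - (j == i).

Lemma mono_continuous e : continuous (mono e).
Proof.
apply: (@prod_coord_continuous _ _ (fun i t => t ^+ e i)) => i.
exact: exprn_continuous.
Qed.

Lemma mono_differentiable e x : differentiable (mono e) x.
Proof.
rewrite /mono; elim: (index_enum _) => [|i s IH].
  rewrite (_ : (fun _ => _) = cst 1); first exact: differentiable_cst.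
  by apply/funext => y; rewrite big_nil.
rewrite (_ : (fun _ => _) = (fun y : 'cV[R]_d => y i ord0 ^+ e i) *
  (fun y => \prod_(j <- s) y j ord0 ^+ e j)); last first.
  by apply/funext => y; rewrite big_cons.
apply: differentiableM => //.
case: (e i) => [|k]; first exact: differentiable_cst.
rewrite (_ : (fun _ => _) = (fun y : 'cV[R]_d => y i ord0 : R) ^+ k.+1).
  by apply: differentiableX; exact: differentiable_coord.
by apply/funext => y; rewrite exprfctE.
Qed.

Lemma is_derive_mono e i (x : 'cV[R]_d) :
  is_derive x (delta_mx i ord0 : 'cV[R]_d) (mono e) ((e i)%:R * mono (decr e i) x).
Proof.
have D : is_derive (x i ord0) 1 (fun t : R => t ^+ e i) ((e i)%:R * x i ord0 ^+ (e i).-1).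
  split; first exact: exprn_derivable.
  by rewrite exp_derive /GRing.scale /= mulr1.
refine (is_derive_eq (prod_line_derive (f := fun i t => t ^+ e i) D) _).
rewrite -mulrA; congr (_ * _); rewrite /mono [RHS](bigD1 i)//= /decr eqxx subn1.
by congr (_ * _); apply: eq_bigr => j /negbTE ->; rewrite subn0.
Qed.

Lemma mono_decrM e i x : (e i)%:R * mono (decr e i) x * x i ord0 = (e i)%:R * mono e x.
Proof.
have [->|ei0] := eqVneq (e i) 0%N; first by rewrite !mul0r.
rewrite -mulrA; congr (_ * _); rewrite /mono (bigD1 i)//= [RHS](bigD1 i)//=.
rewrite mulrAC; congr (_ * _).
  by rewrite /decr eqxx subn1 -exprSr prednK// lt0n.
by apply: eq_bigr => j /negbTE ji; rewrite /decr ji subn0.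
Qed.

Lemma monoM e i x : mono e x * x i ord0 = mono (fun j => e j + (j == i))%N x.
Proof.
rewrite /mono (bigD1 i)//= [RHS](bigD1 i)//= mulrAC; congr (_ * _).
  by rewrite eqxx addn1 exprSr.
by apply: eq_bigr => j /negbTE ->; rewrite addn0.
Qed.

(** Proof principle for properties stable under linear combinations: check them on the admissible
    monomials. *)
Lemma polyfun_ind N (S : pred {ffun 'I_d -> 'I_N.+1}) (P : set ('cV[R]_d -> R^o)) :
  subspace P -> (forall a : {ffun 'I_d -> 'I_N.+1}, S a -> P (mono (expo a))) ->
  forall f, polyfun S f -> P f.
Proof.
move=> sP Pm f [c fc].
have -> : f = \sum_(a | S a) c a *: (mono (expo a) : 'cV[R]_d -> R^o).
  by apply/funext => x; rewrite fc fct_sumE.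
elim/big_ind : _ => [||a Sa].
- by case: sP.
- by move=> *; exact: subspaceD.
- by apply: subspaceZ => //; exact: Pm.
Qed.

Lemma polyfun_subspace N (S : pred {ffun 'I_d -> 'I_N.+1}) :
  subspace (polyfun S : set ('cV[R]_d -> R^o)).
Proof.
split.
  by exists (fun=> 0) => x; rewrite big1// => a _; rewrite mul0r.
move=> t f g [c fc] [c' gc']; exists (fun a => t * c a + c' a) => x.
rewrite -[LHS]/(t * f x + g x) fc gc' mulr_sumr -big_split/=.
by apply: eq_bigr => a _; rewrite mulrDl mulrA.
Qed.

Lemma polyfun_mono N (S : pred {ffun 'I_d -> 'I_N.+1}) e :
  (forall i, e i <= N)%N -> S [ffun i => inord (e i)] -> polyfun S (mono e).
Proof.
move=> eN Se; exists (fun a => (a == [ffun i => inord (e i)])%:R) => x.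
rewrite (bigD1 _ Se)/= eqxx mul1r [X in _ + X]big1 ?addr0; last first.
  by move=> a /andP[_ /negbTE ->]; rewrite mul0r.
by apply: eq_bigr => i _; rewrite ffunE inordK// ltnS.
Qed.

Lemma polyfun_monoT N e : (forall i, e i <= N)%N ->
  polyfun (fun _ : {ffun 'I_d -> 'I_N.+1} => true) (mono e).
Proof. by move=> eN; exact: polyfun_mono. Qed.

Lemma polyfun_C1 N (S : pred {ffun 'I_d -> 'I_N.+1}) f : polyfun S f ->
  [/\ continuous f, forall x, differentiable f x
    & forall i, continuous (pderiv i f)].
Proof.
move=> pf; split.
- apply: (polyfun_ind (S := S) (P := fun f : 'cV[R]_d -> R => continuous f)) pf.
    split; first exact: cst_continuous.
    by move=> c g h cg ch x; apply: cvgD (ch x); apply: cvgZr; exact: cg.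
  by move=> a _; exact: mono_continuous.
- apply: (polyfun_ind (S := S) (P := fun f : 'cV[R]_d -> R => forall x, differentiable f x)) pf.
    split; first by move=> x; exact: differentiable_cst.
    by move=> c g h dg dh x; apply: differentiableD => //; exact: differentiableZ.
  by move=> a _ x; exact: mono_differentiable.
- move=> i.
  have : exists g, continuous g /\ forall x, is_derive x (delta_mx i ord0 : 'cV[R]_d) f (g x).
    apply: (polyfun_ind (S := S) (P := fun f : 'cV[R]_d -> R => exists g,
      continuous g /\ forall x, is_derive x (delta_mx i ord0 : 'cV[R]_d) f (g x))) pf.
      split; first by exists (fun=> 0); split; [exact: cst_continuous|move=> x; exact: is_derive_cst].
      move=> c g h [g' [cg dg]] [h' [ch dh]]; exists (fun x => c *: (g' x : R^o) + h' x); split.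
        by move=> x; apply: cvgD (ch x); apply: cvgZr; exact: cg.
      by move=> x; exact: (is_deriveD (is_deriveZ c (dg x)) (dh x)).
    move=> a _; exists (fun x => (expo a i)%:R * mono (decr (expo a) i) x); split.
      by move=> x; apply: (@cvgM _ _ (nbhs x)); [exact: cvg_cst|exact: mono_continuous].
    by move=> x; exact: is_derive_mono.
  move=> [g [cg fg]]; rewrite (_ : pderiv i f = g)//.
  by apply/funext => x; rewrite /pderiv; case: (fg x).
Qed.

Lemma polyfun_derivable N (S : pred {ffun 'I_d -> 'I_N.+1}) f i x : polyfun S f ->
  is_derive x (delta_mx i ord0 : 'cV[R]_d) f (pderiv i f x).
Proof.
by move=> /polyfun_C1[_ df _]; split => //; exact: diff_derivable.
Qed.

Lemma polyfun_pderiv N N' (S : pred {ffun 'I_d -> 'I_N.+1})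
    (S' : pred {ffun 'I_d -> 'I_N'.+1}) i f : polyfun S f ->
  (forall a : {ffun 'I_d -> 'I_N.+1}, S a -> (0 < a i)%N -> polyfun S' (mono (decr (expo a) i))) ->
  polyfun S' (pderiv i f).
Proof.
move=> pf SS'.
have sS' := polyfun_subspace S'.
have : exists g, polyfun S' g /\ forall x, is_derive x (delta_mx i ord0 : 'cV[R]_d) f (g x).
  apply: (polyfun_ind (S := S) (P := fun f : 'cV[R]_d -> R => exists g,
    polyfun S' g /\ forall x, is_derive x (delta_mx i ord0 : 'cV[R]_d) f (g x))) pf.
    split; first by exists (fun=> 0); split; [case: sS'|move=> x; exact: is_derive_cst].
    move=> c g h [g' [cg dg]] [h' [ch dh]]; exists (fun x => c *: (g' x : R^o) + h' x); split.
      by case: sS' => _; exact.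
    by move=> x; exact: (is_deriveD (is_deriveZ c (dg x)) (dh x)).
  move=> a Sa; exists (fun x => (expo a i)%:R * mono (decr (expo a) i) x); split.
    have [->|ai] := posnP (expo a i).
      rewrite (_ : (fun _ => _) = (fun=> 0)); first by case: sS'.
      by apply/funext => x; rewrite mul0r.
    exact: (subspaceZ _ sS' (SS' a Sa ai)).
  by move=> x; exact: is_derive_mono.
move=> [g [cg fg]]; rewrite (_ : pderiv i f = g)//.
by apply/funext => x; rewrite /pderiv; case: (fg x).
Qed.

(** The operator [x_i d/dx_i] multiplies each monomial by its exponent in [x_i], hence preserves any
    span of monomials, in particular polynomials of bounded total degree. *)
Lemma polyfun_pderivM N (S : pred {ffun 'I_d -> 'I_N.+1}) i f : polyfun S f ->
  polyfun S (fun x => pderiv i f x * x i ord0).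
Proof.
move=> pf; have sS := polyfun_subspace S.
have : exists g, polyfun S (fun x => g x * x i ord0) /\
    forall x, is_derive x (delta_mx i ord0 : 'cV[R]_d) f (g x).
  apply: (polyfun_ind (S := S) (P := fun f : 'cV[R]_d -> R => exists g,
    polyfun S (fun x => g x * x i ord0) /\
    forall x, is_derive x (delta_mx i ord0 : 'cV[R]_d) f (g x))) pf.
    split.
      exists (fun=> 0); split; last by move=> x; exact: is_derive_cst.
      rewrite (_ : (fun _ => _) = (fun=> 0)); first by case: sS.
      by apply/funext => x; rewrite mul0r.
    move=> c g h [g' [cg dg]] [h' [ch dh]]; exists (fun x => c *: (g' x : R^o) + h' x); split.
      rewrite (_ : (fun _ => _) = c *: ((fun x => g' x * x i ord0) : 'cV[R]_d -> R^o) +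
        ((fun x => h' x * x i ord0) : 'cV[R]_d -> R^o)).
        by case: sS => _; exact.
      apply/funext => x; rewrite -[LHS]/((c * g' x + h' x) * x i ord0).
      by rewrite -[RHS]/(c * (g' x * x i ord0) + h' x * x i ord0); ring.
    by move=> x; exact: (is_deriveD (is_deriveZ c (dg x)) (dh x)).
  move=> a Sa; exists (fun x => (expo a i)%:R * mono (decr (expo a) i) x); split.
    rewrite (_ : (fun _ => _) = (expo a i)%:R *: (mono (expo a) : 'cV[R]_d -> R^o)).
      apply: (subspaceZ _ sS); apply: polyfun_mono; first by move=> j; rewrite -ltnS; exact: ltn_ord.
      suff -> : [ffun j => inord (expo a j)] = a by [].
      by apply/ffunP => j; rewrite ffunE; exact: inord_val.
    by apply/funext => x; rewrite mono_decrM.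
  by move=> x; exact: is_derive_mono.
move=> [g [cg fg]]; rewrite (_ : pderiv i f = g)//.
by apply/funext => x; rewrite /pderiv; case: (fg x).
Qed.

Lemma polyfun_widen N N' (S : pred {ffun 'I_d -> 'I_N.+1}) f : (N <= N')%N ->
  polyfun S f -> polyfun (fun _ : {ffun 'I_d -> 'I_N'.+1} => true) f.
Proof.
move=> NN'; apply: polyfun_ind; first exact: polyfun_subspace.
by move=> a _; apply: polyfun_monoT => i; apply: leq_trans NN'; rewrite -ltnS; exact: ltn_ord.
Qed.

Lemma polyfunM_coord N (S : pred {ffun 'I_d -> 'I_N.+1}) i f : polyfun S f ->
  polyfun (fun _ : {ffun 'I_d -> 'I_N.+2} => true) (fun x => f x * x i ord0).
Proof.
have sT := polyfun_subspace (fun _ : {ffun 'I_d -> 'I_N.+2} => true).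
apply: (polyfun_ind (P := fun f : 'cV[R]_d -> R =>
  polyfun (fun _ : {ffun 'I_d -> 'I_N.+2} => true) (fun x => f x * x i ord0))).
  split.
    rewrite (_ : (fun x : 'cV[R]_d => _ * x i ord0) = (fun=> 0)); first by case: sT.
    by apply/funext => x; rewrite mul0r.
  move=> c g h pg ph.
  rewrite (_ : (fun x : 'cV[R]_d => _ * x i ord0) = c *: ((fun x => g x * x i ord0) : 'cV[R]_d -> R^o) +
    ((fun x => h x * x i ord0) : 'cV[R]_d -> R^o)).
    by case: sT => _; exact.
  apply/funext => x; rewrite -[LHS]/((c * g x + h x) * x i ord0).
  by rewrite -[RHS]/(c * (g x * x i ord0) + h x * x i ord0); ring.
move=> a _; rewrite (_ : (fun x : 'cV[R]_d => _ * x i ord0) = mono (fun j => a j + (j == i))%N).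
  apply: polyfun_monoT => j; apply: (@leq_trans (N + 1)); last by rewrite addn1.
  by apply: leq_add; [rewrite -ltnS; exact: ltn_ord|exact: leq_b1].
by apply/funext => x; rewrite monoM.
Qed.

End polynomial_functions.

(** * Spaces on the reference elements *)

Section reference_spaces.
Context (R : realType) (d : nat).
Implicit Types (s : ref_shape) (p : nat).

Lemma Pref_subspace p s : subspace (Pref p s : set ('cV[R]_d -> R^o)).
Proof. by case: s; exact: polyfun_subspace. Qed.

(** Both shapes embed in tensor-product polynomials, which gives coefficient vectors of the same
    type on all elements. *)
Lemma Pref_polyfun p s (f : 'cV[R]_d -> R) : Pref p s f ->
  polyfun (fun _ : {ffun 'I_d -> 'I_p.+1} => true) f.
Proof. by case: s => //; exact: polyfun_widen. Qed.

Lemma RTref_subspace p s : subspace (RTref p s : set ('cV[R]_d -> 'cV[R]_d)).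
Proof.
case: s; split.
- exists (fun _ _ => 0), (fun=> 0); split.
  + by move=> i; case: (Pref_subspace p Simplex).
  + by case: (Pref_subspace p Simplex).
  + by move=> x; rewrite scale0r addr0; apply/colP => i; rewrite !mxE.
- move=> c q r [a [b [pa pb qE]]] [a' [b' [pa' pb' rE]]].
  have [_ lP] := Pref_subspace p Simplex.
  exists (fun i => (c *: (a i : 'cV[R]_d -> R^o) + a' i : 'cV[R]_d -> R)),
    (c *: (b : 'cV[R]_d -> R^o) + b' : 'cV[R]_d -> R); split.
  + by move=> i; exact: lP.
  + exact: lP.
  + move=> x; rewrite -[LHS]/(c *: q x + r x) qE rE.
    apply/colP => i; rewrite !mxE -[(_ *: a i + a' i) x]/(c * a i x + a' i x).
    by rewrite -[(_ *: _ + b') x]/(c * b x + b' x); ring.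
- move=> i; have [P0 _] := polyfun_subspace R
    (fun a : {ffun 'I_d -> 'I_p.+2} => [forall j, a j <= p + (j == i)]%N).
  by rewrite (_ : (fun x : 'cV[R]_d => _ i ord0) = (fun=> 0))//; apply/funext => x; rewrite mxE.
- move=> c q r Hq Hr i; have [_ lP] := polyfun_subspace R
    (fun a : {ffun 'I_d -> 'I_p.+2} => [forall j, a j <= p + (j == i)]%N).
  have := lP c _ _ (Hq i) (Hr i).
  by rewrite (_ : _ + _ = (fun x => (c *: q + r) x i ord0))//; apply/funext => x; rewrite !mxE.
Qed.

Lemma RTref_polyfun p s (r : 'cV[R]_d -> 'cV[R]_d) i : RTref p s r ->
  polyfun (fun _ : {ffun 'I_d -> 'I_p.+2} => true) (fun x => r x i ord0).
Proof.
case: s => /=; last by move=> /(_ i); exact: polyfun_widen.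
move=> [a [b [pa pb rE]]].
have sT := polyfun_subspace R (fun _ : {ffun 'I_d -> 'I_p.+2} => true).
rewrite (_ : (fun x : 'cV[R]_d => r x i ord0) = (a i : 'cV[R]_d -> R^o) + (fun x => b x * x i ord0)).
  apply: subspaceD => //; first exact: polyfun_widen (pa i).
  exact: polyfunM_coord pb.
by apply/funext => x; rewrite rE !mxE.
Qed.

(** On a simplex, component [i] of [a + b x] contributes [d_i a_i + b + x_i d_i b], and [x_i d_i]
    preserves the total degree. On a cube, [d_i] lowers the one exceptional degree [p + 1], that in
    [x_i], to [p]. *)
Lemma RTref_divergence p s (r : 'cV[R]_d -> 'cV[R]_d) : RTref p s r ->
  Pref p s (fun x => \sum_i pderiv i (fun y => r y i ord0) x).
Proof.
move=> RTr; have sP := Pref_subspace p s.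
rewrite (_ : (fun _ => _) = \sum_i (pderiv i (fun y => r y i ord0) : 'cV[R]_d -> R^o)); last first.
  by apply/funext => x; rewrite fct_sumE.
elim/big_ind : _ => [||i _]; [by case: sP|by move=> *; exact: subspaceD|].
case: s RTr sP => /= [[a [b [pa pb rE]]] sP|Hr sP]; last first.
  apply: polyfun_pderiv (Hr i) _ => c /forallP cp ci.
  apply: polyfun_monoT => j; have := cp j; rewrite /decr.
  by case: (j == i); rewrite ?addn1 ?addn0 ?subn0// leq_subLR addnC addn1.
have -> : pderiv i (fun y => r y i ord0) = (pderiv i (a i) : 'cV[R]_d -> R^o) +
    ((b : 'cV[R]_d -> R^o) + (fun x => pderiv i b x * x i ord0)).
  apply/funext => x.
  have d1 := polyfun_derivable i x (pa i).
  have d2 := polyfun_derivable i x pb.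
  have d3 : is_derive x (delta_mx i ord0 : 'cV[R]_d) (fun y : 'cV[R]_d => y i ord0) 1.
    have D : is_derive (x i ord0) (1:R) (fun t : R => t) 1 by exact: is_derive_id.
    apply: is_derive_line D => h; rewrite !mxE !eqxx mulr1.
    by rewrite -[h *: 1]/(h * 1) mulr1.
  have d4 := is_deriveD d1 (is_deriveM d2 d3).
  have -> : (fun y => r y i ord0) = a i + b * (fun y : 'cV[R]_d => y i ord0).
    by apply/funext => y; rewrite rE !mxE.
  rewrite [LHS]/pderiv; case: d4 => _ ->.
  by rewrite -[RHS]/(_ + (_ + _)) /GRing.scale /= mulr1 [x i ord0 * _]mulrC.
apply: subspaceD => //; last first.
  by apply: subspaceD => //; exact: polyfun_pderivM.
apply: polyfun_pderiv (pa i) _ => c cp ci.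
apply: polyfun_mono => [j|]; first by apply: leq_trans (leq_subr _ _) _; rewrite -ltnS; exact: ltn_ord.
apply: leq_trans cp; apply: leq_sum => j _; rewrite ffunE inordK ?leq_subr//.
exact: leq_ltn_trans (leq_subr _ _) (ltn_ord _).
Qed.

End reference_spaces.

(** * Geometry of the elements *)

Section mesh_geometry.
Context (R : realType) (d : nat) (Om : set 'cV[R]_d) (hs : seq ('cV[R]_d * R)).
Context (M : mesh R d).
Hypotheses (hOm : polyhedral_domain Om hs) (hM : conforming Om M).
Local Notation leb := (lebesgue_cV R d).
Implicit Types (T : mesh_elt M) (s : ref_shape) (x y : 'cV[R]_d).

Let oOm : open Om. Proof. by case: hOm => -[]. Qed.
Let bOm : bounded_set Om. Proof. by case: hOm => -[]. Qed.

Lemma mesh_unit T : mesh_lin T \in unitmx.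
Proof. by case: hM. Qed.

Lemma mesh_mapK T : cancel (mesh_map T) (mesh_inv T).
Proof. by move=> x; rewrite /mesh_inv /mesh_map addrK mulKmx// mesh_unit. Qed.

Lemma mesh_invK T : cancel (mesh_inv T) (mesh_map T).
Proof. by move=> x; rewrite /mesh_inv /mesh_map mulKVmx ?mesh_unit// subrK. Qed.

Lemma elemE T x : elem T x <-> ref_elt (mesh_shape T) (mesh_inv T x).
Proof.
split=> [[y Ky <-]|Kx]; first by rewrite mesh_mapK.
by exists (mesh_inv T x) => //; exact: mesh_invK.
Qed.

Lemma affine_continuous (B : 'M[R]_d) (b : 'cV[R]_d) : continuous (fun x => B *m x + b).
Proof.
apply: continuous_mx => i j.
have -> : (fun x => (B *m x + b) i j) = (fun x => \sum_k B i k * x k j + b i j).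
  by apply/funext => x; rewrite mxE mxE; congr (_ + _).
move=> x; apply: (@cvgD _ _ _ (nbhs x)); last exact: cvg_cst.
apply: (@cvg_big _ _ _ _ _ (@add_continuous R) _ (nbhs x)) => k _.
by apply: (@cvgM _ _ (nbhs x)); [exact: cvg_cst|exact: coord_continuous].
Qed.

Lemma mesh_map_continuous T : continuous (mesh_map T).
Proof. exact: affine_continuous. Qed.

Lemma mesh_inv_continuous T : continuous (mesh_inv T).
Proof.
have -> : mesh_inv T = (fun x => invmx (mesh_lin T) *m x + - (invmx (mesh_lin T) *m mesh_vec T)).
  by apply/funext => x; rewrite /mesh_inv mulmxBr.
exact: affine_continuous.
Qed.

(** Strict inequalities make openness direct and reduce the comparison with [ref_elt] to finitely
    many hyperplanes. *)
Definition ref_int s : set 'cV[R]_d :=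
  match s with
  | Simplex => [set x | (forall i, 0 < x i ord0) /\ \sum_i x i ord0 < 1]
  | Cube => [set x | forall i, 0 < x i ord0 < 1]
  end.

Lemma ref_int_sub s : ref_int s `<=` ref_elt s.
Proof.
case: s => x /=; first by move=> [x0 /ltW]; split => // i; exact: ltW.
by move=> x01 i; have /andP[? ?] := x01 i; rewrite !ltW.
Qed.

Lemma coord_sum_continuous : continuous (fun x : 'cV[R]_d => \sum_i x i ord0).
Proof.
move=> x; apply: (@cvg_big _ _ _ _ _ (@add_continuous R) _ (nbhs x)) => k _.
exact: coord_continuous.
Qed.

Lemma open_coords_gt0 : open [set x : 'cV[R]_d | forall i, 0 < x i ord0].
Proof.
rewrite openE => x x0; rewrite /interior.
exists (fun _ _ => [set t | 0 < t]) => [i j|y xy i]; last exact: xy.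
by rewrite ord1; apply: open_nbhs_nbhs; split; [exact: open_gt|exact: x0].
Qed.

Lemma open_ref_int s : open (ref_int s).
Proof.
case: s.
- have -> : ref_int Simplex =
      [set x : 'cV[R]_d | forall i, 0 < x i ord0] `&`
      ((fun x : 'cV[R]_d => \sum_i x i ord0) @^-1` [set t | t < 1]).
    by apply/seteqP; split.
  apply: openI; first exact: open_coords_gt0.
  apply: open_comp => [x _|]; [exact: coord_sum_continuous|exact: open_lt].
- have -> : ref_int Cube = box 0 (const_mx 1).
    by apply/seteqP; split=> x x01 i; have := x01 i; rewrite !mxE.
  exact: open_box.
Qed.

Lemma closed_ref_elt s : closed (@ref_elt R d s).
Proof.
case: s.
- have -> : @ref_elt R d Simplex =
      (\bigcap_(i in [set: 'I_d]) ((fun x : 'cV[R]_d => x i ord0) @^-1` [set t | 0 <= t])) `&`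
      ((fun x : 'cV[R]_d => \sum_i x i ord0) @^-1` [set t | t <= 1]).
    apply/seteqP; split=> x [x0 x1]; first by split => // i _; exact: x0.
    by split => // i; exact: (x0 i Logic.I).
  apply: closedI.
    apply: closed_bigI => i _.
    apply: (iffLR (continuous_closedP _) (@coord_continuous _ _ _ _ _)).
    exact: closed_ge.
  apply: (iffLR (continuous_closedP _) coord_sum_continuous).
  exact: closed_le.
- have -> : @ref_elt R d Cube = cbox 0 (const_mx 1).
    by apply/seteqP; split=> x x01 i; have := x01 i; rewrite !mxE.
  exact: closed_cbox.
Qed.

Definition elem_int T := mesh_inv T @^-1` ref_int (mesh_shape T).

Lemma open_elem_int T : open (elem_int T).
Proof.
apply: open_comp => [x _|]; [exact: mesh_inv_continuous|exact: open_ref_int].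
Qed.

Lemma elem_preimage T : elem T = mesh_inv T @^-1` ref_elt (mesh_shape T).
Proof. by apply/seteqP; split=> x; rewrite /= -elemE. Qed.

Lemma closed_elem T : closed (elem T).
Proof.
rewrite elem_preimage.
apply: (iffLR (continuous_closedP _) (@mesh_inv_continuous T)).
exact: closed_ref_elt.
Qed.

Lemma elem_sub_closure T : elem T `<=` closure Om.
Proof. by case: hM => _ -> _ _ x Tx; exists T. Qed.

Lemma bounded_closure (A : set 'cV[R]_d) : bounded_set A -> bounded_set (closure A).
Proof.
move=> /bounded_set_cVP[r r0 Ar].
have Ac : A `<=` cube r by move=> x Ax; apply/cubeP; exact: Ar.
apply/bounded_set_cVP; exists r => // x /(closure_subset Ac).
by rewrite -(closure_id _).1; [move=> /cubeP|exact: closed_cbox].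
Qed.

Lemma compact_elem T : compact (elem T).
Proof.
apply: bounded_closed_compact_cV; last exact: closed_elem.
have /bounded_set_cVP[r r0 Or] := bounded_closure bOm.
by apply/bounded_set_cVP; exists r => // x /elem_sub_closure; exact: Or.
Qed.

Lemma elem_int_sub T : elem_int T `<=` elem T.
Proof. by move=> x Tx; apply/elemE; exact: ref_int_sub. Qed.

(** An open subset of [closure Om] lies in the interior of that closure, which is [Om] itself
    because cracks are excluded. *)
Lemma elem_int_Om T : elem_int T `<=` Om.
Proof.
case: hOm => -[_ _ _ _ ->] _.
rewrite -open_subsetE; last exact: open_elem_int.
by apply: subset_trans (@elem_sub_closure T); exact: elem_int_sub.
Qed.

Lemma dot_mulmx (B : 'M[R]_d) x y : dot x (B *m y) = dot (B^T *m x) y.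
Proof.
rewrite /dot; under eq_bigr do rewrite mxE mulr_sumr.
rewrite exchange_big/=; apply: eq_bigr => j _.
rewrite mxE mulr_suml; apply: eq_bigr => i _; rewrite mxE; ring.
Qed.

Lemma dotBr x y z : dot x (y - z) = dot x y - dot x z :> R.
Proof.
by rewrite /dot -sumrB; apply: eq_bigr => i _; rewrite !mxE mulrBr.
Qed.

(** The preimage of a hyperplane under the affine map [mesh_inv T] is a hyperplane, whose normal is
    [nu] multiplied by the inverse transpose of [mesh_lin T]. *)
Lemma ae_mesh_inv_hyperplane T (nu : 'cV[R]_d) (c : R) : nu != 0 ->
  {ae leb, forall x, dot nu (mesh_inv T x) != c}.
Proof.
move=> nu0; pose nu' := (invmx (mesh_lin T))^T *m nu.
have nu'0 : nu' != 0.
  apply: contra nu0 => /eqP nu'0.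
  have : (mesh_lin T)^T *m nu' = nu.
    by rewrite mulmxA -trmx_mul mulVmx ?mesh_unit// trmx1 mul1mx.
  by rewrite nu'0 mulmx0 => <-.
exists (hyperplane (nu', c + dot nu' (mesh_vec T))); split.
- exact: measurable_hyperplane.
- exact: lebesgue_cV_hyperplane.
- move=> x /= /negP; rewrite negbK => /eqP <-.
  by rewrite /hyperplane /= /mesh_inv dot_mulmx dotBr subrK.
Qed.

Lemma dot_delta i x : dot (delta_mx i ord0) x = x i ord0 :> R.
Proof.
rewrite /dot (bigD1 i)//= big1 ?addr0; first by rewrite mxE !eqxx mul1r.
by move=> j ji; rewrite mxE (negbTE ji) mul0r.
Qed.

Lemma dot_const1 x : dot (const_mx 1) x = \sum_i x i ord0 :> R.
Proof. by apply: eq_bigr => i _; rewrite mxE mul1r. Qed.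

Lemma ae_elem_int T : ae_on (elem T) (elem_int T).
Proof.
have d0 (i : 'I_d) : delta_mx i ord0 != 0 :> 'cV[R]_d.
  apply/eqP => /colP/(_ i); rewrite !mxE !eqxx => /eqP.
  by rewrite oner_eq0.
have H0 : {ae leb, forall x, forall i, mesh_inv T x i ord0 != 0}.
  apply: filter_forall => i; have := ae_mesh_inv_hyperplane T 0 (d0 i).
  by apply: filterS => x; rewrite dot_delta.
have H1 : {ae leb, forall x, forall i, mesh_inv T x i ord0 != 1}.
  apply: filter_forall => i; have := ae_mesh_inv_hyperplane T 1 (d0 i).
  by apply: filterS => x; rewrite dot_delta.
have H2 : {ae leb, forall x, \sum_i mesh_inv T x i ord0 != 1}.
  (* The vector of ones vanishes only in dimension 0, where the coordinate sum is empty and differs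
     from 1. *)
  have [n0|/eqP n0] := eqVneq (const_mx 1 : 'cV[R]_d) 0.
    have E : 'I_d -> False.
      by move=> i; have /colP/(_ i) := n0; rewrite !mxE => /eqP; rewrite oner_eq0.
    apply: aeW => x; rewrite big1; first by rewrite eq_sym oner_neq0.
    by move=> i; case: (E i).
  have := ae_mesh_inv_hyperplane T 1 (introN eqP n0).
  by apply: filterS => x; rewrite dot_const1.
rewrite /ae_on; apply: filterS3 H0 H1 H2 => x x0 x1 x2 /elemE; rewrite /elem_int.
case: (mesh_shape T) => /=.
  move=> [y0 y1]; split; last by rewrite lt_neqAle x2.
  by move=> i; rewrite lt_neqAle eq_sym x0 y0.
move=> y01 i; have /andP[y0 y1] := y01 i.
by rewrite !lt_neqAle eq_sym x0 y0 x1 y1.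
Qed.

Lemma ae_on_elem_of_int T (P : 'cV[R]_d -> Prop) : ae_on (elem_int T) P -> ae_on (elem T) P.
Proof.
have := ae_elem_int T; rewrite /ae_on.
by apply: filterS2 => x Tx Px Ex; apply: Px; exact: Tx.
Qed.

Lemma ae_on_elem T (P : 'cV[R]_d -> Prop) : ae_on Om P -> ae_on (elem T) P.
Proof. by move=> OP; apply: ae_on_elem_of_int; exact: ae_on_subset (@elem_int_Om T) OP. Qed.

Lemma ae_on_elems (P : 'cV[R]_d -> Prop) : (forall T, ae_on (elem T) P) -> ae_on Om P.
Proof.
move=> aP.
have : {ae leb, forall x, forall T, elem T x -> P x} by exact: filter_forall.
rewrite /ae_on; apply: filterS => x Px Ox.
have : closure Om x by exact: subset_closure.
by case: hM => _ -> _ _ [T _ Tx]; exact: Px Tx.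
Qed.

Lemma convex_gt0 (a b t : R) : 0 <= a -> 0 < b -> 0 < t -> t <= 1 ->
  0 < a + t * (b - a).
Proof. by move=> *; nra. Qed.

Lemma convex_lt1 (a b t : R) : a <= 1 -> b < 1 -> 0 < t -> t <= 1 ->
  a + t * (b - a) < 1.
Proof. by move=> *; nra. Qed.

(** The point with all coordinates [1/(d+1)] is the barycentre of the simplex and also lies in the
    open cube; moving towards it turns all the inequalities strict. *)
Lemma ref_int_convex s y t : ref_elt s y -> 0 < t <= 1 ->
  ref_int s (y + t *: (const_mx (d.+1%:R^-1) - y)).
Proof.
have c0 : 0 < d.+1%:R^-1 :> R by rewrite invr_gt0.
have c1 (i : 'I_d) : d.+1%:R^-1 < 1 :> R.
  by rewrite invf_lt1// ltr1n ltnS; apply: leq_ltn_trans (ltn_ord i).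
case: s => /= Ky /andP[t0 t1].
  have [y0 y1] := Ky; split; first by move=> i; rewrite !mxE; exact: convex_gt0.
  have -> : \sum_i (y + t *: (const_mx d.+1%:R^-1 - y)) i ord0 =
      \sum_i y i ord0 + t * (d%:R / d.+1%:R - \sum_i y i ord0).
    rewrite (eq_bigr (fun i => y i ord0 + t * (d.+1%:R^-1 - y i ord0))); last first.
      by move=> i _; rewrite !mxE.
    rewrite big_split/= -mulr_sumr sumrB sumr_const card_ord.
    by rewrite -[_ *+ d]mulr_natl.
  apply: convex_lt1 => //.
  by rewrite ltr_pdivrMr// mul1r ltr_nat.
move=> i; have /andP[y0 y1] := Ky i; rewrite !mxE.
by rewrite convex_gt0//= convex_lt1// c1.
Qed.

Lemma dense_elem_int T x (U : set 'cV[R]_d) : elem T x -> nbhs x U ->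
  (elem_int T `&` U) !=set0.
Proof.
move=> /elemE Kx Ux; pose y := mesh_inv T x.
pose c : 'cV[R]_d := const_mx (d.+1%:R^-1).
pose z (t : R) := mesh_map T (y + t *: (c - y)).
have cz : z t @[t --> (0 : R)] --> x.
  have -> : x = z 0 by rewrite /z scale0r addr0 mesh_invK.
  apply: (@continuous_comp _ _ _ (fun t : R => y + t *: (c - y)) (mesh_map T) 0).
    apply: (@cvgD _ _ _ (nbhs (0 : R))); first exact: cvg_cst.
    by apply: cvgZr_tmp; exact: cvg_id.
  exact: mesh_map_continuous.
have zint t : 0 < t <= 1 -> elem_int T (z t).
  by move=> t01; rewrite /elem_int /= /z mesh_mapK; exact: ref_int_convex.
have h1 : \forall t \near (0 : R)^'+, U (z t) by apply: (cvg_at_right_filter cz).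
have h2 : \forall t \near (0 : R)^'+, 0 < t by exact: nbhs_right_gt.
have h3 : \forall t \near (0 : R)^'+, t <= 1 by apply: nbhs_right_le.
have h4 : \forall t \near (0 : R)^'+, U (z t) /\ 0 < t <= 1.
  by apply: filterS3 h1 h2 h3 => t Uz -> ->.
have [t [Uz t01]] := @filter_ex _ _ (at_right_proper_filter (0 : R)) _ h4.
by exists (z t); split => //; exact: zint.
Qed.

(** Near a point of the closed element, even on its boundary, the open interior of the element
    contributes a nonempty open set, whose measure is positive. *)
Lemma ae_on_elem_nonempty T x (U : set 'cV[R]_d) (P : 'cV[R]_d -> Prop) :
  ae_on (elem T) P -> elem T x -> nbhs x U -> exists y, [/\ elem T y, U y & P y].
Proof.
move=> [A [mA A0 PA]] Tx; rewrite nbhsE => -[B [oB Bx] BU].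
apply: contrapT => nP.
have oW : open (elem_int T `&` B) by apply: openI => //; exact: open_elem_int.
have W0 : elem_int T `&` B !=set0 by apply: (dense_elem_int Tx); exact: open_nbhs_nbhs.
have := lebesgue_cV_open_gt0 oW W0; rewrite ltNge => /negP; apply.
rewrite -A0; apply: le_measure; rewrite ?inE//; first exact: open_measurable_cV.
move=> y [Ty By]; apply: PA => /= H; apply: nP; exists y; split.
- exact: elem_int_sub.
- exact: BU.
- by apply: H; exact: elem_int_sub.
Qed.

(** This determines [elem_trace] at every point of the closed element, including the part on the
    boundary of [Om]: a nonzero difference would persist near [x], against agreement almost
    everywhere. *)
Lemma elem_continuous_unique T (f g : 'cV[R]_d -> 'cV[R]_d) :
  {within elem T, continuous f} -> {within elem T, continuous g} ->
  ae_on (elem T) (fun x => f x = g x) -> forall x, elem T x -> f x = g x.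
Proof.
move=> cf cg fg x Tx; apply: contrapT => /eqP fgx.
have c1 := (subspace_continuousP _ _).1 cf x Tx.
have c2 := (subspace_continuousP _ _).1 cg x Tx.
have : (f y - g y) @[y --> within (elem T) (nbhs x)] --> f x - g x by exact: cvgB.
have fg0 : f x - g x != 0 by rewrite subr_eq0.
move=> /cvgr_neq0 /(_ fg0) nb.
have [y [Ty /(_ Ty) + fgy]] := ae_on_elem_nonempty fg Tx nb.
by rewrite /= fgy subrr eqxx.
Qed.

End mesh_geometry.

Lemma exists_orthonormal_basis_fin (R : realType) (X : lmodType R) (L : set X)
    (a : X -> X -> R) (I : finType) (Gam : (I -> R) -> X -> Prop) :
  subspace L -> inner_product_on L a ->
  (forall (c : R) r s u v, L u -> L v -> Gam r u -> Gam s v ->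
    Gam (fun i => c * r i + s i) (c *: u + v)) ->
  (forall u, L u -> exists r, Gam r u) ->
  (forall u, L u -> Gam (fun=> 0) u -> a u u = 0) ->
  exists n (e : 'I_n -> X), orthonormal_basis L a e.
Proof.
move=> sL ia lG eG G0.
apply: (exists_orthonormal_basis (N := #|I|)
  (Gam := fun r u => Gam (fun i => r ord0 (enum_rank i)) u)) => //.
- move=> c r s u v Lu Lv Gr Gs; have := lG c _ _ _ _ Lu Lv Gr Gs.
  congr (Gam _ _); apply/funext => i; rewrite !mxE//.
- move=> u Lu; have [r Gr] := eG u Lu; exists (\row_k r (enum_val k)).
  move: Gr; congr (Gam _ _); apply/funext => i; rewrite mxE enum_rankK//.
- move=> u Lu Gu; apply: G0 => //; move: Gu; congr (Gam _ _).
  by apply/funext => i; rewrite mxE.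
Qed.

(** * The discrete spaces and the divergence between them *)

Section discrete_spaces.
Context (R : realType) (d : nat) (Om : set 'cV[R]_d) (hs : seq ('cV[R]_d * R)).
Context (M : mesh R d) (p : nat).
Hypotheses (hOm : polyhedral_domain Om hs) (hM : conforming Om M).
Local Notation leb := (lebesgue_cV R d).
Implicit Types (T : mesh_elt M) (x y : 'cV[R]_d).

Let oOm : open Om. Proof. by case: hOm => -[]. Qed.
Let bOm : bounded_set Om. Proof. by case: hOm => -[]. Qed.

Lemma Vh_subspace : subspace (Vh Om M p : set ('cV[R]_d -> R^o)).
Proof.
split.
  split; first exact: inL2_cst.
  move=> T; exists (fun=> 0); first by case: (Pref_subspace R d p (mesh_shape T)).
  exact: ae_onW.
move=> c u v [L2u Tu] [L2v Tv]; split; first exact: inL2_lin.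
move=> T; have [uh Pu uE] := Tu T; have [vh Pv vE] := Tv T.
exists (c *: (uh : 'cV[R]_d -> R^o) + vh).
  by case: (Pref_subspace R d p (mesh_shape T)) => _; exact.
by apply: ae_onS2 uE vE => x _; rewrite -[(_ + v) x]/(c * u x + v x) => -> ->.
Qed.

(** Polynomials are bounded on the compact elements, and there are finitely many of these. It is
    this bound that puts [V_h] in the domain of the superposition operator. *)
Lemma Vh_Linfty v : Vh Om M p v -> inLinfty Om v.
Proof.
move=> [[mv _] Tv]; split => //.
have H T : exists C, ae_on (elem T) (fun x => `|v x| <= C).
  have [vh Pv vE] := Tv T.
  have [cvh _ _] := polyfun_C1 (Pref_polyfun Pv).
  have cc : continuous (fun x => vh (mesh_inv T x)).
    by move=> x; apply: continuous_comp; [exact: mesh_inv_continuous|exact: cvh].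
  have /compact_bounded[C [_ HC]] : compact ((fun x => vh (mesh_inv T x)) @` elem T).
    apply: continuous_compact; first exact: continuous_subspaceT.
    exact: compact_elem hOm hM T.
  exists (`|C| + 1); apply: ae_onS vE => x Tx ->; apply: HC; last by exists x.
  by rewrite (le_lt_trans (ler_norm C))// ltrDl.
have /choice[C HC] := H; exists (\sum_T `|C T|).
apply: (ae_on_elems hM) => T; apply: ae_onS (HC T) => x _ /le_trans; apply.
rewrite (bigD1 T)//=; apply: le_trans (ler_norm _) _.
by rewrite lerDl sumr_ge0.
Qed.

Definition Vh_coef (c : mesh_elt M * {ffun 'I_d -> 'I_p.+1} -> R) (v : 'cV[R]_d -> R) :=
  forall T, ae_on (elem T) (fun x =>
    v x = \sum_a c (T, a) * mono (expo a) (mesh_inv T x)).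

Lemma Vh_basis : exists n (e : 'I_n -> ('cV[R]_d -> R^o)),
  orthonormal_basis (Vh Om M p : set ('cV[R]_d -> R^o)) (ip Om) e.
Proof.
apply: (exists_orthonormal_basis_fin (Gam := Vh_coef)).
- exact: Vh_subspace.
- split => [w [L2w _] c u v [L2u _] [L2v _]|u v _ _|u _].
  + exact: ip_linl.
  + exact: ipC.
  + exact: ip_ge0.
- move=> c r s u v _ _ ru sv T; apply: ae_onS2 (ru T) (sv T) => x _.
  rewrite -[(_ + v) x]/(c * u x + v x) => -> ->.
  rewrite mulr_sumr -big_split/=; apply: eq_bigr => a _; ring.
- move=> u [_ Tu].
  have /choice[c Hc] T : exists c : {ffun 'I_d -> 'I_p.+1} -> R,
      ae_on (elem T) (fun x => u x = \sum_a c a * mono (expo a) (mesh_inv T x)).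
    have [uh /Pref_polyfun[c uhc] uE] := Tu T; exists c.
    by apply: ae_onS uE => x _ ->.
  by exists (fun Ta => c Ta.1 Ta.2) => T; exact: Hc.
- move=> u [L2u _] u0; apply: ip_null => //.
  apply: (ae_on_elems hM) => T; apply: ae_onS (u0 T) => x _ ->.
  by rewrite big1// => a _; rewrite mul0r.
Qed.

Lemma Sigmah_div_subspace :
  subspace (Sigmah_div Om M p : set ('cV[R]_d -> 'cV[R]_d)).
Proof.
have L20 : inL2v Om (fun=> 0 : 'cV[R]_d).
  move=> i; rewrite (_ : (fun _ => _) = fun=> 0); first exact: inL2_cst.
  by apply/funext => x; rewrite mxE.
split.
  split; last first.
    split => //; exists (fun=> 0); split; first exact: inL2_cst.
    move=> phi /(test_function_L2 oOm bOm)[L2p L2dp].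
    rewrite ip_null ?oppr0//; [|exact: inL2_cst|exact: ae_onW].
    rewrite ipvE// big1// => i _; apply: ip_null => //.
    by apply: ae_onW => x _; rewrite mxE.
  split => // T; exists (fun=> 0).
    by case: (RTref_subspace R d p (mesh_shape T)).
  by apply: ae_onW => x _; rewrite mulmx0 scaler0.
move=> c q r [[L2q Tq] Hq] [[L2r Tr] Hr]; split; last exact: inHdiv_lin.
split; first exact: inL2v_lin.
move=> T; have [qh Pq qE] := Tq T; have [rh Pr rE] := Tr T.
exists (c *: qh + rh).
  by case: (RTref_subspace R d p (mesh_shape T)) => _; exact.
apply: ae_onS2 qE rE => x _; rewrite -[(_ + r) x]/(c *: q x + r x) => -> ->.
rewrite -[(_ + rh) _]/(c *: qh _ + rh _) mulmxDr scalerDr -scalemxAr.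
by rewrite scalerA [c * _]mulrC -scalerA.
Qed.

Definition piola T (r : 'cV[R]_d -> 'cV[R]_d) x : 'cV[R]_d :=
  (\det (mesh_lin T))^-1 *: (mesh_lin T *m r (mesh_inv T x)).

Definition Sigmah_coef (c : mesh_elt M * ('I_d * {ffun 'I_d -> 'I_p.+2}) -> R)
    (q : 'cV[R]_d -> 'cV[R]_d) :=
  forall T, ae_on (elem T) (fun x =>
    q x = piola T (fun y => \col_i \sum_a c (T, (i, a)) * mono (expo a) y) x).

Lemma Sigmah_div_basis (a : ('cV[R]_d -> 'cV[R]_d) -> ('cV[R]_d -> 'cV[R]_d) -> R) :
  inner_product_on (Sigmah_div Om M p : set ('cV[R]_d -> 'cV[R]_d)) a ->
  (forall q, Sigmah_div Om M p q -> ae_on Om (fun x => q x = 0) -> a q q = 0) ->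
  exists n (e : 'I_n -> ('cV[R]_d -> 'cV[R]_d)),
    orthonormal_basis (Sigmah_div Om M p : set ('cV[R]_d -> 'cV[R]_d)) a e.
Proof.
move=> ia a0; apply: (exists_orthonormal_basis_fin (Gam := Sigmah_coef)) => //.
- exact: Sigmah_div_subspace.
- move=> c r s u v _ _ ru sv T; apply: ae_onS2 (ru T) (sv T) => x _.
  rewrite -[(_ + v) x]/(c *: u x + v x) => -> ->; rewrite /piola.
  rewrite scalerA mulrC -scalerA scalemxAr -scalerDr -mulmxDr; congr (_ *: (_ *m _)).
  apply/colP => i; rewrite !mxE mulr_sumr -big_split/=.
  by apply: eq_bigr => b _; ring.
- move=> q [[_ Tq] _].
  have /choice[c Hc] T : exists c : 'I_d * {ffun 'I_d -> 'I_p.+2} -> R,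
      ae_on (elem T) (fun x => q x = piola T (fun y => \col_i \sum_b c (i, b) * mono (expo b) y) x).
    have [qh Pq qE] := Tq T.
    have /choice[c Hc] := fun i => RTref_polyfun i Pq.
    exists (fun ib => c ib.1 ib.2); apply: ae_onS qE => x _ ->; rewrite /piola.
    congr (_ *: (_ *m _)); apply/colP => i; rewrite mxE /=; exact: Hc.
  by exists (fun Tib => c Tib.1 Tib.2) => T; exact: Hc.
- move=> q Sq q0; apply: a0 => //.
  apply: (ae_on_elems hM) => T; apply: ae_onS (q0 T) => x _ ->; rewrite /piola.
  rewrite (_ : (\col_i _) = 0) ?mulmx0 ?scaler0//.
  by apply/colP => i; rewrite !mxE big1// => b _; rewrite mul0r.
Qed.

Lemma is_derive_mesh_inv T (f : 'cV[R]_d -> R) i x : (forall y, differentiable f y) ->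
  is_derive x (delta_mx i ord0 : 'cV[R]_d) (fun y => f (mesh_inv T y))
    (\sum_l invmx (mesh_lin T) l i * pderiv l f (mesh_inv T x)).
Proof.
move=> df; set a := mesh_inv T x; set B := invmx _.
have D : is_derive a (B *m delta_mx i ord0) f (\sum_l B l i * pderiv l f a).
  split; first exact: diff_derivable.
  rewrite deriveE//.
  have -> : B *m delta_mx i ord0 = \sum_l B l i *: (delta_mx l ord0 : 'cV[R]_d).
    apply/colP => j; rewrite summxE (bigD1 j)//= big1 ?addr0; last first.
      by move=> l lj; rewrite !mxE eq_sym (negbTE lj) mulr0.
    rewrite !mxE (bigD1 i)//= big1 ?addr0; first by rewrite !mxE !eqxx.
    by move=> k ki; rewrite mxE (negbTE ki) mulr0.
  rewrite linear_sum; apply: eq_bigr => l _; rewrite linearZ/=.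
  by rewrite /pderiv deriveE.
apply: is_derive_line D => h; congr f.
by rewrite /a /mesh_inv -/B scalemxAr -mulmxDr addrA.
Qed.

(** The Piola transform commutes with the divergence up to the factor [1 / det B]: the matrix [B] in
    front of the field cancels the [B^-1] of the chain rule. Inside an element the weak divergence
    is the classical one of this smooth field. *)
Lemma wdiv_Vh q : Sigmah_div Om M p q -> Vh Om M p (wdiv Om q).
Proof.
move=> [[L2q Tq] Hq]; have qw := wdivP Hq; split; first by case: qw.
move=> T; have [rh RTr qE] := Tq T.
set B := mesh_lin T; set t := (\det B)^-1.
pose f k y := rh y k ord0 : R.
have C1 k := polyfun_C1 (RTref_polyfun k RTr).
pose Q i x := t * \sum_k B i k * f k (mesh_inv T x).
pose dQ i x := t * \sum_k B i k * \sum_l invmx B l i * pderiv l (f k) (mesh_inv T x).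
have cinv (g : 'cV[R]_d -> R) : continuous g -> continuous (fun x => g (mesh_inv T x)).
  by move=> cg x; apply: continuous_comp; [exact: mesh_inv_continuous|exact: cg].
have csum (g : 'I_d -> 'cV[R]_d -> R) : (forall k, continuous (g k)) ->
    continuous (fun x => \sum_k g k x).
  move=> cg x; apply: (@cvg_big _ _ _ _ _ (@add_continuous R) _ (nbhs x)) => k _.
  exact: cg.
have cZ (c : R) (g : 'cV[R]_d -> R) : continuous g -> continuous (fun x => c * g x).
  by move=> cg x; apply: (@cvgM _ _ (nbhs x)); [exact: cvg_cst|exact: cg].
exists (t *: ((fun x => \sum_k pderiv k (f k) x) : 'cV[R]_d -> R^o)).
  by apply: subspaceZ; [exact: Pref_subspace|exact: RTref_divergence].
apply: (ae_on_elem_of_int hM).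
have : ae_on (elem_int T) (fun x => wdiv Om q x = \sum_i dQ i x).
  apply: (@weak_div_classical _ _ (elem_int T) Om q _ Q dQ) => //.
  - exact: open_elem_int.
  - exact: elem_int_Om hOm hM T.
  - by move=> i; apply: (cZ _ _ _); apply: csum => k; apply/cZ/cinv; case: (C1 k).
  - move=> i; apply: (cZ _ _ _); apply: (csum _ _) => k; apply: (cZ _ _ _); apply: csum => l.
    by apply/cZ/cinv; case: (C1 k).
  - move=> i x.
    have D k : is_derive x (delta_mx i ord0 : 'cV[R]_d)
        (B i k \*: (fun y => f k (mesh_inv T y) : R^o))
        (B i k *: (\sum_l invmx B l i * pderiv l (f k) (mesh_inv T x) : R^o)).
      by apply: is_deriveZ; apply: is_derive_mesh_inv; case: (C1 k).
    have := is_deriveZ t (is_derive_sum D).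
    rewrite /Q /dQ; congr (is_derive _ _ _ _).
    by apply/funext => y; rewrite /= fct_sumE.
  - apply: ae_on_subset (@elem_int_sub _ _ Om M hM T) _.
    apply: ae_onS qE => x _ -> i; rewrite !mxE; congr (_ * _).
apply: ae_onS => x _ ->.
rewrite -[RHS]/(t * \sum_k pderiv k (f k) (mesh_inv T x)) -mulr_sumr; congr (_ * _).
rewrite exchange_big/=; apply: eq_bigr => k _.
under eq_bigr do rewrite mulr_sumr.
(* Summing over [i] leaves the entries [(l, k)] of [invmx B *m B], so only [l = k] survives. *)
rewrite exchange_big/= (bigD1 k)//= [X in _ + X]big1 ?addr0.
  under eq_bigr do rewrite mulrA.
  rewrite -mulr_suml.
  have := congr1 (fun N : 'M[R]_d => N k k) (mulVmx (mesh_unit hM T)).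
  rewrite !mxE eqxx; under eq_bigr do rewrite mulrC.
  by move=> ->; rewrite mul1r.
move=> l lk.
under eq_bigr do rewrite mulrA.
rewrite -mulr_suml.
have := congr1 (fun N : 'M[R]_d => N l k) (mulVmx (mesh_unit hM T)).
rewrite !mxE (negbTE lk); under eq_bigr do rewrite mulrC.
by move=> ->; rewrite mul0r.
Qed.

End discrete_spaces.

(** * The boundary pairing *)

Section outward_normals.
Context (R : realType) (d : nat) (Om : set 'cV[R]_d).
Hypothesis oOm : open Om.
Implicit Types (nu x y : 'cV[R]_d).

Definition is_normal x nu :=
  enorm nu = 1 /\ \forall y \near x, Om y <-> dot nu (y - x) < 0.

Lemma dotC nu x : dot nu x = dot x nu.
Proof. by apply: eq_bigr => i _; rewrite mulrC. Qed.

Lemma dotZr nu x (c : R) : dot nu (c *: x) = c * dot nu x.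
Proof. by rewrite /dot mulr_sumr; apply: eq_bigr => i _; rewrite mxE; ring. Qed.

Lemma dotDr nu x y : dot nu (x + y) = dot nu x + dot nu y.
Proof. by rewrite /dot -big_split; apply: eq_bigr => i _; rewrite mxE mulrDr. Qed.

Lemma dot_ge0 x : 0 <= dot x x.
Proof. by apply: sumr_ge0 => i _; rewrite -expr2 sqr_ge0. Qed.

Lemma dot_eq0 x : dot x x = 0 -> x = 0.
Proof.
move=> /eqP; rewrite psumr_eq0; last by move=> i _; rewrite -expr2 sqr_ge0.
move=> /allP x0; apply/colP => i; rewrite mxE.
by have := x0 i; rewrite mem_index_enum => /(_ isT) /=; rewrite mulf_eq0 orbb => /eqP.
Qed.

Lemma enorm1_dot x : enorm x = 1 -> dot x x = 1.
Proof. by rewrite /enorm => x1; rewrite -[LHS](sqr_sqrtr (dot_ge0 x)) x1 expr1n. Qed.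

Lemma dot_continuous nu : continuous (dot nu).
Proof.
move=> x; apply: (@cvg_big _ _ _ _ _ (@add_continuous R) _ (nbhs x)) => k _.
by apply: (@cvgM _ _ (nbhs x)); [exact: cvg_cst|exact: coord_continuous].
Qed.

(** With [v = nu - nu'], the products [dot nu v] and [dot nu' v] are [|v|^2 / 2] and its opposite; a
    small step from [x] along a nonzero [v] would be outside [Om] by the first normal and inside by
    the second. *)
Lemma is_normal_unique x nu nu' : is_normal x nu -> is_normal x nu' -> nu = nu'.
Proof.
move=> [n1 H] [n1' H']; apply: contrapT => nn.
have E1 := enorm1_dot n1; have E2 := enorm1_dot n1'.
pose v := nu - nu'.
have v0 : 0 < dot v v.
  rewrite lt_def dot_ge0 andbT; apply: contra_notN nn => /eqP/dot_eq0 /eqP.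
  by rewrite subr_eq0 => /eqP.
have Dv : dot v v = 2 - 2 * dot nu nu'.
  by rewrite /v dotBr [dot _ nu]dotC [dot _ nu']dotC !dotBr E1 E2 [dot nu' nu]dotC; ring.
have D1 : dot nu v = 1 - dot nu nu' by rewrite dotBr E1.
have D2 : dot nu' v = dot nu nu' - 1 by rewrite dotBr E2 dotC.
have c0 : (x + t *: v) @[t --> (0 : R)] --> x.
  suff : (x + t *: v) @[t --> (0 : R)] --> x + 0 *: v by rewrite scale0r addr0.
  apply: (@cvgD _ _ _ (nbhs (0 : R))); first exact: cvg_cst.
  by apply: cvgZr_tmp; exact: cvg_id.
have h1 : \forall t \near (0 : R)^'+, Om (x + t *: v) <-> dot nu (x + t *: v - x) < 0.
  by have := cvg_at_right_filter c0; move=> /(_ _ H).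
have h2 : \forall t \near (0 : R)^'+, Om (x + t *: v) <-> dot nu' (x + t *: v - x) < 0.
  by have := cvg_at_right_filter c0; move=> /(_ _ H').
have h3 : \forall t \near (0 : R)^'+, 0 < t by exact: nbhs_right_gt.
have h4 : \forall t \near (0 : R)^'+, False.
  apply: filterS3 h1 h2 h3 => t a1 a2 t0.
  rewrite [x + _]addrC addrK !dotZr in a1 a2.
  have : t * dot nu' v < 0 by rewrite pmulr_rlt0// D2; lra.
  move=> /a2.2/a1.1; rewrite pmulr_rlt0// D1; lra.
by have [] := @filter_ex _ _ (at_right_proper_filter (0 : R)) _ h4.
Qed.

(** Near [x] the domain is a half-space, so nearby boundary points satisfy [dot nu (y - x) = 0], and
    recentering the half-space at [y] does not change it. *)
Lemma is_normal_near x nu : is_normal x nu ->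
  \forall y \near x, bdry Om y -> is_normal y nu.
Proof.
move=> [n1 H].
have H2 := nbhs_interior H.
apply: filterS2 H H2 => y Py Iy [cy niy]; split => //.
have y0 : dot nu (y - x) = 0.
  apply/eqP; rewrite eq_le; apply/andP; split; rewrite leNgt; apply/negP => yx.
  - have U : \forall z \near y, ~ Om z.
      have cc : {for y, continuous (fun z : 'cV[R]_d => dot nu (z - x))}.
        apply: (@continuous_comp _ _ _ (fun z : 'cV[R]_d => z - x) (dot nu) y).
          by apply: (@cvgB _ _ _ (nbhs y)); [exact: cvg_id|exact: cvg_cst].
        exact: dot_continuous.
      have g0 : \forall z \near y, 0 < dot nu (z - x).
        exact: (cvgr_gt _ cc _ yx).
      apply: filterS2 g0 Iy => z z0 Pz Oz.
      by have := Pz.1 Oz; rewrite ltNge (ltW z0).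
    by have [z [Oz nOz]] := cy _ U.
  - by apply: niy; apply: open_nbhs_nbhs; split => //; exact: Py.2.
apply: filterS Iy => z; rewrite (_ : z - x = (z - y) + (y - x)); last first.
  by rewrite addrA subrK.
have -> : dot nu (z - y + (y - x)) = dot nu (z - y).
  by rewrite dotDr y0 addr0.
by [].
Qed.

Lemma outward_normalE x nu : is_normal x nu -> outward_normal Om x = nu.
Proof.
move=> N; apply: (@is_normal_unique x) => //.
by apply: (@xgetPex _ 0 (is_normal x)); exists nu.
Qed.

Lemma outward_normal_default x : ~ (exists nu, is_normal x nu) -> outward_normal Om x = 0.
Proof.
move=> nN; apply: xgetPN => nu N.
by apply: nN; exists nu.
Qed.

Lemma measurable_bdry : measurable (bdry Om).
Proof.
apply: measurableD; first by apply: closed_measurable_cV; exact: closed_closure.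
by apply: open_measurable_cV; exact: open_interior.
Qed.

(* Where it is not a default value, the outward normal is locally constant. *)
Lemma outward_normal_preimage (B : set 'cV[R]_d) :
  measurable (bdry Om `&` outward_normal Om @^-1` B).
Proof.
(* Within the boundary, the open set [W C] cuts out the points with a genuine normal lying in [C].
   Thus [W setT] separates them from the points that carry the default value 0. *)
pose W C := [set y | bdry Om y -> (exists nu, is_normal y nu) /\ C (outward_normal Om y)]°.
have WE C : bdry Om `&` W C =
    [set y | bdry Om y /\ ((exists nu, is_normal y nu) /\ C (outward_normal Om y))].
  apply/seteqP; split=> [y [By /interior_subset Wy]|y [By [[nu N] Cy]]].
    by split => //; exact: Wy.
  split => //; have := is_normal_near N; apply: filterS => z zN Bz.
  have Nz := zN Bz; split; first by exists nu.
  by rewrite (outward_normalE Nz) -(outward_normalE N).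
have mW C : measurable (bdry Om `&` W C).
  apply: measurableI; first exact: measurable_bdry.
  by apply: open_measurable_cV; exact: open_interior.
have -> : bdry Om `&` outward_normal Om @^-1` B = (bdry Om `&` W B) `|`
    ((bdry Om `\` (bdry Om `&` W setT)) `&` [set _ | B 0]).
  rewrite !WE; apply/seteqP; split=> [y [By Cy]|y].
    have [N|N] := pselect (exists nu, is_normal y nu); first by left.
    right; split; first by split => // -[_ []].
    by move: Cy; rewrite /= outward_normal_default.
  move=> [[By [_ Cy]]//|[[By nN] B0]]; split => //=.
  rewrite outward_normal_default// => N; apply: nN.
  by split.
apply: measurableU => //; apply: measurableI.
  by apply: measurableD => //; exact: measurable_bdry.
have [B0|B0] := pselect (B 0).
  by rewrite (_ : [set _ | _] = setT)//; apply/seteqP; split.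
by rewrite (_ : [set _ | _] = set0)//; apply/seteqP; split.
Qed.

Lemma measurable_outward_normal i :
  measurable_fun (bdry Om) (fun x => outward_normal Om x i ord0).
Proof.
move=> _ A mA.
exact: (outward_normal_preimage [set v : 'cV[R]_d | A (v i ord0)]).
Qed.

Lemma outward_normal_le1 x i : `|outward_normal Om x i ord0| <= 1.
Proof.
have [[nu N]|N] := pselect (exists nu, is_normal x nu); last first.
  by rewrite outward_normal_default// mxE normr0.
rewrite (outward_normalE N); have := enorm1_dot N.1.
rewrite /dot (bigD1 i)//= => E.
have : 0 <= \sum_(j | j != i) nu j ord0 * nu j ord0.
  by apply: sumr_ge0 => j _; rewrite -expr2 sqr_ge0.
by move=> S; rewrite ler_norml; apply/andP; split; nra.
Qed.

End outward_normals.

(** * Finiteness of the surface measure *)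

Section surface.
Context (R : realType) (d : nat).
Local Notation leb := (lebesgue_cV R d).

(** The prism of height 1 over a bounded set is bounded. *)
Lemma hyperplane_measure_lty (h : 'cV[R]_d * R) (B : set 'cV[R]_d) :
  measurable B -> bounded_set B -> (hyperplane_measure h B < +oo)%E.
Proof.
move=> mB /bounded_set_cVP[r r0 Br].
apply: lebesgue_cV_bounded_lty.
  apply: measurableI; first exact: measurable_slab.
  by rewrite -[X in measurable X]setTI; exact: measurable_hproj.
apply/bounded_set_cVP; exists (r + `|h.1|) => [|x [xs /Br xB] i].
  by rewrite ltr_pwDl.
have -> : x i ord0 = hproj h x i ord0 + (dot h.1 x - h.2) * h.1 i ord0.
  by rewrite /hproj !mxE subrK.
apply: le_trans (ler_normD _ _) _; apply: lerD; first exact: xB.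
rewrite normrM; apply: le_trans (_ : 1 * `|h.1 i ord0| <= _).
  apply: ler_wpM2r => //; have /andP[s0 s1] := xs.
  by rewrite ger0_norm.
by rewrite mul1r; exact: le_mx_norm.
Qed.

Lemma surface_measure_lty hs (B : set 'cV[R]_d) :
  measurable B -> bounded_set B -> (surface_measure hs B < +oo)%E.
Proof.
move=> mB bB; rewrite /surface_measure /= /msum.
apply: lte_sum_pinfty => i _; exact: hyperplane_measure_lty.
Qed.

End surface.

(** * Linearity of the pairing and its vanishing on null fields *)

Section boundary_pairing.
Context (R : realType) (d : nat) (Om : set 'cV[R]_d) (hs : seq ('cV[R]_d * R)).
Context (M : mesh R d) (p : nat) (g : 'cV[R]_d -> R).
Hypotheses (hOm : polyhedral_domain Om hs) (hM : conforming Om M).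
Hypothesis hg : inH12_bdry Om hs g.
Local Notation sigma := (surface_measure hs).
Implicit Types (T : mesh_elt M) (q r : 'cV[R]_d -> 'cV[R]_d).

Let oOm : open Om. Proof. by case: hOm => -[]. Qed.
Let bOm : bounded_set Om. Proof. by case: hOm => -[]. Qed.

Let D T := bdry Om `&` elem T.

Let mD T : measurable (D T).
Proof.
apply: measurableI; first exact: measurable_bdry.
by apply: closed_measurable_cV; exact: closed_elem hM T.
Qed.

(** The Piola image of the reference field is a continuous representative, so the choice in
    [elem_trace] is not the default; uniqueness identifies the two on the whole closed element. *)
Lemma elem_traceP q T : Sigmah Om M p q -> exists w : 'cV[R]_d -> 'cV[R]_d,
  [/\ continuous w, ae_on (elem T) (fun x => w x = q x)
    & forall x, elem T x -> elem_trace q T x = w x].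
Proof.
move=> [L2q Tq]; have [rh RTr qE] := Tq T.
have cw : continuous (piola T rh).
  apply: continuous_mx => i j.
  have -> : (fun x => piola T rh x i j) = (fun x => (\det (mesh_lin T))^-1 *
      \sum_k mesh_lin T i k * rh (mesh_inv T x) k ord0).
    by apply/funext => x; rewrite !mxE ord1.
  move=> x; apply: (@cvgM _ _ (nbhs x)); first exact: cvg_cst.
  apply: (@cvg_big _ _ _ _ _ (@add_continuous R) _ (nbhs x)) => k _.
  apply: (@cvgM _ _ (nbhs x)); first exact: cvg_cst.
  have [ck _ _] := polyfun_C1 (RTref_polyfun k RTr).
  apply: (@continuous_comp _ _ _ (mesh_inv T) (fun y => rh y k ord0) x).
    exact: mesh_inv_continuous.
  exact: ck.
have wq : ae_on (elem T) (fun x => piola T rh x = q x).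
  by apply: ae_onS qE => x _ ->.
exists (piola T rh); split => //.
pose P := [set w | {within elem T, continuous w} /\ ae_on (elem T) (fun x => w x = q x)].
have [ct tq] : P (elem_trace q T).
  apply: (@xgetPex _ (cst 0) P); exists (piola T rh); split => //.
  exact: continuous_subspaceT.
have cw' : {within elem T, continuous (piola T rh)} by exact: continuous_subspaceT.
have tw : ae_on (elem T) (fun x => elem_trace q T x = piola T rh x).
  by apply: ae_onS2 tq wq => x _ -> ->.
by move=> x Tx; have := elem_continuous_unique hM ct cw' tw Tx.
Qed.

Lemma elem_trace_lin (c : R) q r T x : Sigmah Om M p q -> Sigmah Om M p r ->
  Sigmah Om M p (fun x => c *: q x + r x) -> elem T x ->
  elem_trace (fun x => c *: q x + r x) T x = c *: elem_trace q T x + elem_trace r T x.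
Proof.
move=> Sq Sr Sqr Tx.
have [w [cw wq ->//]] := elem_traceP T Sq.
have [v [cv vr ->//]] := elem_traceP T Sr.
have [u [cu uqr ->//]] := elem_traceP T Sqr.
apply: (elem_continuous_unique hM (f := u) (g := fun x => c *: w x + v x)) Tx.
- exact: continuous_subspaceT.
- apply: continuous_subspaceT => y.
  apply: (@cvgD _ _ _ (nbhs y)); last exact: cv.
  by apply: cvgZl_tmp; exact: cw.
- have wv : ae_on (elem T) (fun x => c *: w x + v x = c *: q x + r x).
    by apply: ae_onS2 wq vr => y _ -> ->.
  by apply: ae_onS2 uqr wv => y _ -> ->.
Qed.

Lemma elem_trace_null q T x : Sigmah Om M p q -> ae_on Om (fun x => q x = 0) ->
  elem T x -> elem_trace q T x = 0.
Proof.
move=> Sq q0 Tx; have [w [cw wq ->//]] := elem_traceP T Sq.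
apply: (elem_continuous_unique hM (f := w) (g := fun=> 0)) Tx.
- exact: continuous_subspaceT.
- by apply: continuous_subspaceT; exact: cst_continuous.
- have q0T := ae_on_elem hOm hM T q0.
  by apply: ae_onS2 wq q0T => y _ -> ->.
Qed.

(** On the boundary, which has finite surface measure, [|g| <= 1 + g^2]. *)
Lemma g_rintegrable T : rintegrable sigma (D T) g.
Proof.
have [mg ig _] := hg.
have mb := measurable_bdry Om.
have /bounded_set_cVP[r r0 Or] := bounded_closure bOm.
have fin : (sigma (bdry Om) < +oo)%E.
  apply: surface_measure_lty => //; apply/bounded_set_cVP.
  by exists r => // x [/Or].
have : rintegrable sigma (bdry Om) g.
  apply: (@le_integrable _ _ _ sigma _ mb _ (EFin \o (fun x => 1 + g x ^+ 2))).
  - exact/measurable_EFinP.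
  - move=> x _ /=; rewrite lee_fin [leRHS]ger0_norm ?addr_ge0 ?sqr_ge0//.
    rewrite -[g x ^+ 2]real_normK ?num_real//.
    have := sqr_ge0 (`|g x| - 1); have := normr_ge0 (g x); nra.
  - apply: rintegrableD => //.
    apply: measurable_bounded_integrable => //.
    by exists 1; split => // C C1 x _ /=; rewrite normr1 ltW.
by apply: integrableS => //; exact: subIsetl.
Qed.

Lemma pairing_rintegrable q T : Sigmah Om M p q -> rintegrable sigma (D T)
  (fun x => g x * dot (elem_trace q T x) (outward_normal Om x)).
Proof.
move=> Sq; have [w [cw wq E]] := elem_traceP T Sq.
have cwi i : continuous (fun x => w x i ord0).
  move=> x; apply: (@continuous_comp _ _ _ w (fun v : 'cV[R]_d => v i ord0) x).
    exact: cw.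
  exact: coord_continuous.
suff : rintegrable sigma (D T) (fun x => g x * dot (w x) (outward_normal Om x)).
  apply: eq_integrable => // x; rewrite inE => -[_ Tx] /=.
  by rewrite E.
have [mg _ _] := hg.
have /choice[C HC] i : exists C, forall x, elem T x -> `|w x i ord0| <= C.
  have /compact_bounded[C [_ HC]] : compact ((fun x => w x i ord0) @` elem T).
    apply: continuous_compact; first exact: continuous_subspaceT.
    exact: compact_elem hOm hM T.
  exists (`|C| + 1) => x Tx; apply: HC; last by exists x.
  by rewrite (le_lt_trans (ler_norm C))// ltrDl.
have C0 i : 0 <= `|C i| by [].
apply: (@le_integrable _ _ _ sigma _ (mD T) _ (EFin \o (fun x => (\sum_i `|C i|) * g x))).
- apply/measurable_EFinP; apply: measurable_funM.
    by apply: measurable_funS mg => //; [exact: measurable_bdry|exact: subIsetl].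
  apply: measurable_sum => i; apply: measurable_funM; first exact: continuous_measurable_cV.
  apply: measurable_funS (measurable_outward_normal oOm i); last exact: subIsetl.
  exact: measurable_bdry.
- move=> x [_ Tx] /=; rewrite lee_fin !normrM mulrC; apply: ler_wpM2r => //.
  rewrite [leRHS]ger0_norm ?sumr_ge0//.
  apply: le_trans (ler_norm_sum _ _ _) _; apply: ler_sum => i _.
  rewrite normrM -[leRHS]mulr1; apply: ler_pM => //.
    by apply: le_trans (HC i x Tx) (ler_norm _).
  exact: outward_normal_le1.
- by apply: rintegrableZ => //; exact: g_rintegrable.
Qed.

Lemma bdry_pairing_lin (c : R) q r : Sigmah Om M p q -> Sigmah Om M p r ->
  Sigmah Om M p (fun x => c *: q x + r x) ->
  bdry_pairing Om M hs g (fun x => c *: q x + r x) =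
  c * bdry_pairing Om M hs g q + bdry_pairing Om M hs g r.
Proof.
move=> Sq Sr Sqr; rewrite /bdry_pairing mulr_sumr -big_split/=.
apply: eq_bigr => T _.
rewrite -(@Rintegral_lin _ _ _ sigma (D T))//; [|exact: pairing_rintegrable..].
apply: eq_Rintegral => x; rewrite inE => -[_ Tx].
rewrite elem_trace_lin// /dot mulrCA -mulrDr; congr (_ * _).
rewrite mulr_sumr -big_split/=; apply: eq_bigr => i _.
by rewrite !mxE; ring.
Qed.

Lemma bdry_pairing_null q : Sigmah Om M p q -> ae_on Om (fun x => q x = 0) ->
  bdry_pairing Om M hs g q = 0.
Proof.
move=> Sq q0; rewrite /bdry_pairing big1// => T _.
apply: etrans (_ : \int[sigma]_(x in D T) 0 = 0); last by rewrite Rintegral_cst// mul0r.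
apply: eq_Rintegral => x; rewrite inE => -[_ Tx].
rewrite elem_trace_null// /dot big1 ?mulr0// => i _.
by rewrite mxE mul0r.
Qed.

End boundary_pairing.

(** * The elliptic form *)

Section elliptic.
Context (R : realType) (d : nat).
Implicit Types (A : 'M[R]_d) (x y q : 'cV[R]_d).

Lemma dotDl x y q : dot (x + y) q = dot x q + dot y q.
Proof. by rewrite dotC dotDr !(dotC q). Qed.

Lemma dotZl x y (c : R) : dot (c *: x) y = c * dot x y.
Proof. by rewrite dotC dotZr dotC. Qed.

Lemma compact_unit_sphere : compact [set x : 'cV[R]_d | dot x x = 1].
Proof.
apply: bounded_closed_compact_cV.
  apply/bounded_set_cVP; exists 1 => // x x1 i.
  have : 0 <= \sum_(j | j != i) x j ord0 * x j ord0.
    by apply: sumr_ge0 => j _; rewrite -expr2 sqr_ge0.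
  have := x1; rewrite /= /dot (bigD1 i)//= => E S.
  by rewrite ler_norml; apply/andP; split; nra.
have cd : continuous (fun x : 'cV[R]_d => dot x x).
  move=> x; apply: (@cvg_big _ _ _ _ _ (@add_continuous R) _ (nbhs x)) => k _.
  by apply: (@cvgM _ _ (nbhs x)); exact: coord_continuous.
apply: (iffLR (continuous_closedP _) cd [set 1]).
exact: closed_eq.
Qed.

Lemma nonneg_quadratic_zero (a b : R) : (forall t, 0 <= 2 * t * a + t ^+ 2 * b) -> a = 0.
Proof.
move=> H; apply/eqP/negPn/negP => a0.
have b0 : 0 <= b by have := H 1; have := H (-1); rewrite sqrrN expr1n; lra.
have b1 : 0 < b + 1 by lra.
(* Up to the shift by 1, which avoids division by zero, this is the minimizer of the quadratic; the
   value there is negative unless [a = 0]. *)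
have := H (- a / (b + 1)).
have -> : 2 * (- a / (b + 1)) * a + (- a / (b + 1)) ^+ 2 * b = - (a ^+ 2 * (b + 2)) / (b + 1) ^+ 2.
  by field; rewrite gt_eqF.
rewrite mulNr oppr_ge0 leNgt => /negP; apply.
rewrite divr_gt0 ?exprn_gt0// mulr_gt0//; last lra.
by rewrite lt_def sqr_ge0 sqrf_eq0 a0.
Qed.

(* By compactness the quadratic form has a minimizer on the unit sphere, and a
   minimizer is an eigenvector. *)
Lemma symmetric_eigenvalue_bound A (a0 : R) : A^T = A ->
  (forall l, eigenvalue A l -> a0 <= l) ->
  forall x, a0 * dot x x <= dot x (A *m x).
Proof.
move=> sA lA x; pose S := [set y : 'cV[R]_d | dot y y = 1].
have [->|x0] := eqVneq x 0; first by rewrite -(scale0r 0) !dotZl !mul0r mulr0.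
have nx y : y != 0 -> 0 < dot y y.
  by move=> y0; rewrite lt_def dot_ge0 andbT; apply: contra y0 => /eqP/dot_eq0 ->.
have unit y : y != 0 -> S ((Num.sqrt (dot y y))^-1 *: y).
  move=> /nx y0; rewrite /S /= dotZl dotZr mulrA -invfM -expr2 sqr_sqrtr; last exact: ltW.
  by rewrite mulVf// gt_eqF.
pose f y := dot y (A *m y).
have cf : continuous f.
  move=> y; apply: (@cvg_big _ _ _ _ _ (@add_continuous R) _ (nbhs y)) => k _.
  apply: (@cvgM _ _ (nbhs y)); first exact: coord_continuous.
  have cA : continuous (fun z : 'cV[R]_d => A *m z + 0) by exact: affine_continuous.
  have -> : (fun z : 'cV[R]_d => (A *m z) k ord0) = (fun z : 'cV[R]_d => (A *m z + 0) k ord0).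
    by apply/funext => z; rewrite addr0.
  rewrite -[A *m y]addr0.
  apply: (@continuous_comp _ _ _ (fun z : 'cV[R]_d => A *m z + 0) (fun v : 'cV[R]_d => v k ord0) y).
    exact: cA.
  exact: coord_continuous.
have [|z + zmin] := compact_EVT_min _ compact_unit_sphere (continuous_subspaceT cf).
  by exists ((Num.sqrt (dot x x))^-1 *: x); exact: unit.
rewrite inE => z1; set lam := f z in zmin.
have fge y : lam * dot y y <= f y.
  have [->|y0] := eqVneq y 0; first by rewrite /f -(scale0r 0) !dotZl !mul0r mulr0.
  have := zmin _ (mem_set (unit y y0)).
  rewrite /f -scalemxAr dotZl dotZr mulrA -invfM -expr2 sqr_sqrtr; last exact/ltW/nx.
  move=> H; by rewrite mulrC -ler_pdivlMl ?nx.
have zN0 : z != 0.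
  by apply: contra_eq_neq z1 => ->; rewrite -(scale0r 0) dotZl mul0r eq_sym oner_eq0.
have sf y w : dot y (A *m w) = dot w (A *m y).
  by rewrite dot_mulmx sA dotC.
have Az : A *m z = lam *: z.
  apply/eqP; rewrite -subr_eq0; apply/eqP/dot_eq0.
  have [y Ey] : exists y, y = A *m z - lam *: z by eexists.
  have yE : dot y y = dot y (A *m z) - lam * dot y z by rewrite {2}Ey dotBr dotZr.
  rewrite -Ey.
  (* For the residual [y = A z - lam z], expanding [f (z + t y) - lam |z + t y|^2 >= 0] gives
     [2 t |y|^2 + t^2 (f y - lam |y|^2) >= 0] for all [t], since [f z = lam] and [|z| = 1]. *)
  apply: (@nonneg_quadratic_zero _ (f y - lam * dot y y)) => t.
  have := fge (z + t *: y).
  rewrite /f mulmxDr -scalemxAr !dotDl !dotDr !dotZl !dotZr -/(f z) -/lam z1.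
  rewrite (sf z y) (dotC z y) yE -/(f y).
lra.
have : eigenvalue A lam.
  apply/eigenvalueP; exists z^T.
    by rewrite -[in LHS]sA -trmx_mul Az linearZ.
  by rewrite -(inj_eq trmx_inj) trmxK linear0.
move=> /lA alam; apply: le_trans (fge x); apply: ler_wpM2r => //.
exact: dot_ge0.
Qed.

Section positive_definite.
Context (A : 'M[R]_d) (a0 : R).
Hypotheses (a00 : 0 < a0) (sA : A^T = A) (pA : forall x, a0 * dot x x <= dot x (A *m x)).

Lemma posdef_unitmx : A \in unitmx.
Proof.
rewrite -row_free_unit; apply: inj_row_free => v vA.
apply: (can_inj (@trmxK _ _ _)); rewrite trmx0; apply: dot_eq0; apply/eqP.
rewrite eq_le dot_ge0 andbT; have := pA v^T.
rewrite -[X in X *m v^T]sA -trmx_mul vA trmx0.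
have -> : dot v^T 0 = 0 :> R by rewrite -(scale0r 0) dotZr mul0r.
by rewrite pmulr_rle0.
Qed.

Let AK q : A *m (invmx A *m q) = q.
Proof. by rewrite mulKVmx// posdef_unitmx. Qed.

Lemma posdef_invmx_ge q : a0 * dot (invmx A *m q) (invmx A *m q) <= dot (invmx A *m q) q.
Proof. by have := pA (invmx A *m q); rewrite AK. Qed.

Lemma posdef_invmx_ge0 q : 0 <= dot (invmx A *m q) q.
Proof.
apply: le_trans (posdef_invmx_ge q); apply: mulr_ge0; [exact: ltW|exact: dot_ge0].
Qed.

Lemma posdef_invmx_eq0 q : dot (invmx A *m q) q = 0 -> q = 0.
Proof.
move=> q0; have := posdef_invmx_ge q; rewrite q0 pmulr_rle0// => H.
have /dot_eq0 E : dot (invmx A *m q) (invmx A *m q) = 0.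
  by apply/eqP; rewrite eq_le H dot_ge0.
by rewrite -[LHS]AK E mulmx0.
Qed.

Lemma posdef_invmx_sym q r : dot (invmx A *m q) r = dot (invmx A *m r) q.
Proof. by rewrite [RHS]dotC dot_mulmx trmx_inv sA. Qed.

(** For [y = A^-1 q], expand [|a0 y - q|^2 >= 0] and insert [a0 |y|^2 <= dot y q]. *)
Lemma posdef_invmx_bound q :
  dot (invmx A *m q) (invmx A *m q) <= (a0 ^+ 2)^-1 * dot q q.
Proof.
set y := invmx A *m q.
have := dot_ge0 (a0 *: y - q); rewrite dotBr ![dot (a0 *: y - q) _]dotC !dotBr.
rewrite !dotZl !dotZr [dot q y]dotC => H.
have := posdef_invmx_ge q; rewrite -/y => H2.
have a02 : 0 < a0 ^+ 2 by exact: exprn_gt0.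
rewrite ler_pdivlMl//.
have : a0 * (a0 * dot y y) <= a0 * dot y q by rewrite ler_pM2l.
rewrite expr2; lra.
Qed.

End positive_definite.

Section measurable_matrices.
Context dd (T : measurableType dd) (D : set T).

Lemma measurable_invr : measurable_fun [set: R] (@GRing.inv R).
Proof.
rewrite (_ : @GRing.inv R = fun t => if t == 0 then 0 else t^-1); last first.
  by apply/funext => t; case: eqP => // ->; rewrite invr0.
apply: measurable_fun_if => //.
- by apply: measurable_fun_eqr => //; exact: measurable_cst.
- rewrite setTI; apply: open_continuous_measurable_fun.
    rewrite (_ : _ @^-1` _ = [set t : R | t != 0]); first exact: open_neq.
    by apply/seteqP; split=> t /=; case: eqP.
  by move=> t; rewrite inE /= => /negbT t0; exact: inv_continuous.
Qed.

Lemma measurable_det n (B : T -> 'M[R]_n) :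
  (forall i j, measurable_fun D (fun t => B t i j)) ->
  measurable_fun D (fun t => \det (B t)).
Proof.
move=> mB; apply: measurable_sum => s; apply: measurable_funM => //.
by apply: measurable_prod => i _; exact: mB.
Qed.

Lemma measurable_invmx n (B : T -> 'M[R]_n) : measurable D ->
  (forall i j, measurable_fun D (fun t => B t i j)) ->
  forall i j, measurable_fun D (fun t => invmx (B t) i j).
Proof.
move=> mD mB i j; have mdet := measurable_det mB.
(* [invmx] returns a singular matrix unchanged; the cofactor formula covers the other case. *)
rewrite (_ : (fun t => _) = fun t => if \det (B t) == 0 then B t i j else
    (\det (B t))^-1 * cofactor (B t) j i); last first.
  by apply/funext => t; rewrite /invmx unitmxE unitfE; case: eqP => //; rewrite !mxE.
apply: measurable_fun_if => //.
- by apply: measurable_fun_eqr => //; exact: measurable_cst.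
- exact: measurable_funS (mB i j).
- apply: measurable_funS mD _ _ => //; apply: measurable_funM.
    by apply: measurableT_comp mdet; exact: measurable_invr.
  apply: measurable_funM => //; apply: measurable_det => k l.
  rewrite (_ : (fun t => _) = fun t => B t (lift j k) (lift i l)); first exact: mB.
  by apply/funext => t; rewrite !mxE.
Qed.

End measurable_matrices.

End elliptic.

Section elliptic_form.
Context (R : realType) (d : nat) (Om : set 'cV[R]_d) (A : 'cV[R]_d -> 'M[R]_d).
Hypotheses (oOm : open Om) (bOm : bounded_set Om) (hA : elliptic_coeff Om A).
Implicit Types q r : 'cV[R]_d -> 'cV[R]_d.

Definition inv_form q r := ipv Om (fun x => invmx (A x) *m q x) r.

Let pos : exists2 a0 : R, 0 < a0 &
  ae_on Om (fun x => (A x)^T = A x /\ forall y, a0 * dot y y <= dot y (A x *m y)).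
Proof.
have [_ sA [a0 [a1 [a00 eA]]]] := hA; exists a0 => //.
apply: ae_onS2 sA eA => x _ sAx eAx; split => //.
by apply: symmetric_eigenvalue_bound => // l /eAx /andP[].
Qed.

(** Ellipticity dominates the square of each component by the integrable function [a0^-2 |q|^2]. *)
Lemma invmx_inL2v q : inL2v Om q -> inL2v Om (fun x => invmx (A x) *m q x).
Proof.
move=> L2q; have [mA _ _] := hA; have [a0 a00 pA] := pos.
have mOm := open_measurable_cV oOm.
have mi i j := measurable_invmx mOm (fun i j => (mA i j).1) i j.
have mq i : measurable_fun Om (fun x => (invmx (A x) *m q x) i ord0).
  rewrite (_ : (fun x => _) = fun x => \sum_j invmx (A x) i j * q x j ord0).
    by apply: measurable_sum => j; apply: measurable_funM; [exact: mi|case: (L2q j)].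
  by apply/funext => x; rewrite mxE.
move=> i; split => //.
have int : rintegrable (lebesgue_cV R d) Om (fun x => (a0 ^+ 2)^-1 * dot (q x) (q x)).
  by apply: rintegrableZ => //; exact: inL2v_dot.
apply/integrableP; split; first by apply/measurable_EFinP; exact: measurable_funX.
have /integrableP[mint] := int; apply: le_lt_trans.
apply: ae_ge0_le_integral => //.
- by apply: measurableT_comp => //; apply/measurable_EFinP; exact: measurable_funX.
- exact: measurableT_comp.
apply: ae_onS pA => x _ [sA pA]; rewrite /= lee_fin.
rewrite ger0_norm ?sqr_ge0// [leRHS]ger0_norm; last first.
  by rewrite mulr_ge0 ?dot_ge0// invr_ge0 sqr_ge0.
apply: le_trans (posdef_invmx_bound a00 sA pA (q x)).
rewrite /dot (bigD1 i)//= -expr2 lerDl.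
by apply: sumr_ge0 => j _; rewrite -expr2 sqr_ge0.
Qed.

Lemma inv_form_linl (c : R) q r s : inL2v Om q -> inL2v Om r -> inL2v Om s ->
  inv_form (fun x => c *: q x + r x) s = c * inv_form q s + inv_form r s.
Proof.
move=> L2q L2r L2s; rewrite /inv_form -ipv_linl//; try exact: invmx_inL2v.
by apply: eq_Rintegral => x _; rewrite mulmxDr -scalemxAr.
Qed.

Lemma inv_form_sym q r : inL2v Om q -> inL2v Om r -> inv_form q r = inv_form r q.
Proof.
move=> L2q L2r; have [a0 a00 pA] := pos.
have i1 := inL2v_dot oOm (invmx_inL2v L2q) L2r.
have i2 := inL2v_dot oOm (invmx_inL2v L2r) L2q.
apply: ae_eq_Rintegral; first exact: open_measurable_cV.
- by apply/measurable_EFinP; exact: measurable_int i1.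
- by apply/measurable_EFinP; exact: measurable_int i2.
- by apply: ae_onS pA => x _ [sA pA]; exact: (posdef_invmx_sym sA).
Qed.

Lemma inv_form_pos q : inL2v Om q ->
  0 <= inv_form q q /\ (inv_form q q = 0 -> ae_on Om (fun x => q x = 0)).
Proof.
move=> L2q; have [a0 a00 pA] := pos.
have i1 := inL2v_dot oOm (invmx_inL2v L2q) L2q.
have mOm := open_measurable_cV oOm.
have p0 : ae_on Om (fun x => 0 <= dot (invmx (A x) *m q x) (q x)).
  by apply: ae_onS pA => x _ [sA pA]; exact: (posdef_invmx_ge0 a00 sA pA).
split.
  apply: le_trans (_ : \int[lebesgue_cV R d]_(x in Om) `|dot (invmx (A x) *m q x) (q x)| <= _).
    by apply: Rintegral_ge0.
  rewrite le_eqVlt; apply/orP; left; apply/eqP; apply: ae_eq_Rintegral => //.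
  - apply: measurableT_comp => //.
    by apply/measurable_EFinP; exact: measurable_int i1.
  - by apply/measurable_EFinP; exact: measurable_int i1.
  - by apply: ae_onS p0 => x _ q0; rewrite ger0_norm.
move=> q0; have := Rintegral_eq0_ge0 oOm i1 p0 q0.
apply: ae_onS2 pA => x _ [sA pA]; exact: (posdef_invmx_eq0 a00 sA pA).
Qed.

Lemma inv_form_null q r : inL2v Om q -> inL2v Om r -> ae_on Om (fun x => q x = 0) ->
  inv_form q r = 0.
Proof.
move=> L2q L2r q0; rewrite /inv_form ipvE//; last exact: invmx_inL2v.
rewrite big1// => i _; apply: ip_null => //; first exact: invmx_inL2v.
by apply: ae_onS q0 => x _ ->; rewrite mulmx0 mxE.
Qed.

End elliptic_form.

(** * The superposition operator *)

Section latent.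
Context (R : realType) (d : nat) (Om : set 'cV[R]_d).
Context (lb : 'cV[R]_d -> R) (ub : option ('cV[R]_d -> R)) (Ups : 'cV[R]_d -> R -> R).
Hypotheses (oOm : open Om) (bOm : bounded_set Om) (hUps : latent_map Om lb ub Ups).
Local Notation leb := (lebesgue_cV R d).
Implicit Types (u v w psi phi : 'cV[R]_d -> R).

Let mOm : measurable Om. Proof. exact: open_measurable_cV. Qed.

Lemma superposition_L2 psi : inLinfty Om psi -> inL2 Om (superposition Ups psi).
Proof. by case: hUps => _ _ _ H /H; exact: ae_bounded_inL2. Qed.

Lemma Rintegral_ae_ge0 (f : 'cV[R]_d -> R) : measurable_fun Om f ->
  ae_on Om (fun x => 0 <= f x) -> 0 <= \int[leb]_(x in Om) f x.
Proof.
move=> mf f0; apply: le_trans (_ : \int[leb]_(x in Om) `|f x| <= _).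
  by apply: Rintegral_ge0.
rewrite le_eqVlt; apply/orP; left; apply/eqP; apply: ae_eq_Rintegral => //.
  exact: measurableT_comp.
by apply: ae_onS f0 => x _ fx0; rewrite ger0_norm.
Qed.

Lemma latent_mono_ae : ae_on Om (fun x => forall s t, s <= t -> Ups x s <= Ups x t).
Proof.
case: hUps => _ _ + _; apply: ae_onS => x _ [_ H _] s t.
by rewrite le_eqVlt => /predU1P[->//|/H/ltW].
Qed.

(** The inequality already holds pointwise: [Ups x s - Ups x t] and [s - t] have a nonnegative
    product. *)
Lemma superposition_monotone psi phi : inLinfty Om psi -> inLinfty Om phi ->
  ip Om (superposition Ups phi) (fun x => psi x - phi x) <=
  ip Om (superposition Ups psi) (fun x => psi x - phi x).
Proof.
move=> Lpsi Lphi.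
have L2d : inL2 Om (fun x => psi x - phi x).
  have := inL2_lin oOm (-1) (ae_bounded_inL2 oOm bOm Lphi) (ae_bounded_inL2 oOm bOm Lpsi).
  rewrite (_ : (fun x => _) = (fun x => psi x - phi x))//.
  by apply/funext => x; rewrite mulN1r addrC.
have L1 := superposition_L2 Lpsi; have L2 := superposition_L2 Lphi.
rewrite -subr_ge0 addrC -mulN1r -ip_linl//.
have L3 := inL2_lin oOm (-1) L2 L1.
apply: Rintegral_ae_ge0.
  by apply: measurable_funM; [case: L3|case: L2d].
apply: ae_onS latent_mono_ae => x _ mU; rewrite mulN1r addrC /superposition.
have [le|/ltW le] := leP (phi x) (psi x).
  by apply: mulr_ge0; rewrite subr_ge0//; exact: mU.
by apply: mulr_le0; rewrite subr_le0//; exact: mU.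
Qed.

Lemma superposition_ae_eq psi phi w : inLinfty Om psi -> inLinfty Om phi -> inL2 Om w ->
  ae_on Om (fun x => psi x = phi x) ->
  ip Om (superposition Ups psi) w = ip Om (superposition Ups phi) w.
Proof.
move=> Lpsi Lphi L2w pp; apply: ip_ae_eq => //; try exact: superposition_L2.
  by apply: ae_onS pp => x _; rewrite /superposition => ->.
exact: ae_onW.
Qed.

(** Dominated convergence: continuity of [Ups x] gives pointwise convergence, and the bound comes
    from monotonicity. *)
Lemma superposition_continuous n (y : 'I_n -> 'cV[R]_d -> R) (c : nat -> 'I_n -> R) l w :
  (forall j, inLinfty Om (y j)) -> inL2 Om w -> coord_cvg c l ->
  ip Om (superposition Ups (fun x => \sum_j c k j * y j x)) w @[k --> \oo] -->
  ip Om (superposition Ups (fun x => \sum_j l j * y j x)) w.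
Proof.
move=> Ly L2w cl.
have [_ Uc _ ULoo] := hUps.
have Lsum (e : 'I_n -> R) : inLinfty Om (fun x => \sum_j e j * y j x).
  split.
    by apply: measurable_sum => j; apply: measurable_funM => //; case: (Ly j).
  have /choice[B HB] := fun j => (Ly j).2.
  exists (\sum_j `|e j| * B j).
  apply: ae_onS (ae_on_forall HB) => x _ Bx.
  apply: le_trans (ler_norm_sum _ _ _) _; apply: ler_sum => j _.
  by rewrite normrM ler_wpM2l.
have /choice[B HB] := fun j => (Ly j).2.
have /choice[C HC] j : exists C, forall k, `|c k j| <= C.
  have [C [_ HC]] : bounded_fun (c ^~ j) by apply: cvg_seq_bounded; apply/cvg_ex; exists (l j); exact: cl.
  exists (`|C| + 1) => k; apply: HC => //.
  by rewrite (le_lt_trans (ler_norm C))// ltrDl.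
pose K := \sum_j C j * `|B j|.
have psiK : ae_on Om (fun x => forall k, `|\sum_j c k j * y j x| <= K).
  apply: ae_onS (ae_on_forall HB) => x _ Bx k.
  apply: le_trans (ler_norm_sum _ _ _) _; apply: ler_sum => j _.
  by rewrite normrM; apply: ler_pM => //; apply: le_trans (Bx j) (ler_norm _).
(* The constants [K] and [- K] are bounded functions, hence so are their superpositions; by
   monotonicity these enclose [Ups x] at all arguments of size at most [K]. *)
have [_ [N1 HN1]] := ULoo _ (continuous_Linfty bOm (@cst_continuous _ _ K)).
have [_ [N2 HN2]] := ULoo _ (continuous_Linfty bOm (@cst_continuous _ _ (- K))).
pose N := `|N1| + `|N2|.
have UN : ae_on Om (fun x => forall k, `|Ups x (\sum_j c k j * y j x)| <= N).
  have H1 := ae_onS2 (fun x _ (a : forall k, _) b => conj a b) psiK latent_mono_ae.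
  have H2 := ae_onS2 (fun x _ a b => conj a b) HN1 HN2.
  apply: ae_onS2 H1 H2 => x _ [xK mU] [xN1 xN2] k.
  have := xK k; rewrite ler_norml => /andP[/mU h1 /mU h2].
  move: xN1 xN2; rewrite /superposition /cst /= !ler_norml => /andP[a1 a2] /andP[b1 b2].
  have := ler_norm N1; have := ler_norm N2; have := normr_ge0 N1; have := normr_ge0 N2.
  by rewrite /N; lra.
have L2k k := superposition_L2 (Lsum (c k)).
have L2l := superposition_L2 (Lsum l).
have i2 := inL2_mul oOm L2l L2w.
have [|||||_ _ H] := @dominated_convergence _ _ _ leb Om mOm
  (fun k x => (superposition Ups (fun x => \sum_j c k j * y j x) x * w x)%:E)
  (fun x => (superposition Ups (fun x => \sum_j l j * y j x) x * w x)%:E)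
  (fun x => (N * `|w x|)%:E).
- by move=> k; exact: (measurable_int _ (inL2_mul oOm (L2k k) L2w)).
- exact: (measurable_int _ i2).
- apply: ae_onS Uc => x _ cUx; apply: cvg_EFin; first exact: nearW.
  apply: cvgM; last exact: cvg_cst.
  have h : (\sum_j c k j * y j x) @[k --> \oo] --> \sum_j l j * y j x.
    by apply: cvg_sum_ord => j; apply: cvgM; [exact: cl|exact: cvg_cst].
  by rewrite /superposition; apply: continuous_cvg h; exact: cUx.
- have iw := inL2_rintegrable oOm bOm L2w.
  have : rintegrable leb Om (fun x => N * `|w x|).
    by apply: rintegrableZ => //; exact: (integrable_abse iw).
  by [].
- rewrite /ae_on in UN; apply: filterS UN => x UN k Ox /=.
  by rewrite lee_fin normrM ler_wpM2r// UN.
rewrite /ip /Rintegral; apply: fine_cvg.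
by rewrite fineK ?(integrable_fin_num mOm i2).
Qed.

End latent.

(** * The proximal step *)

Section proximal_step.
Context (R : realType) (d : nat) (Om : set 'cV[R]_d) (hs : seq ('cV[R]_d * R)).
Context (A : 'cV[R]_d -> 'M[R]_d) (lb : 'cV[R]_d -> R) (ub : option ('cV[R]_d -> R)).
Context (Ups : 'cV[R]_d -> R -> R) (M : mesh R d) (p : nat) (f g psi0 : 'cV[R]_d -> R).
Context (alpha : R).
Hypotheses (hOm : polyhedral_domain Om hs) (hA : elliptic_coeff Om A).
Hypotheses (hUps : latent_map Om lb ub Ups) (hM : conforming Om M).
Hypotheses (hf : inL2 Om f) (hg : inH12_bdry Om hs g) (hpsi : Vh Om M p psi0).
Hypothesis alpha0 : 0 < alpha.

Let oOm : open Om. Proof. by case: hOm => -[]. Qed.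
Let bOm : bounded_set Om. Proof. by case: hOm => -[]. Qed.

Local Notation S := (Sigmah_div Om M p : set ('cV[R]_d -> 'cV[R]_d)).
Local Notation V := (Vh Om M p : set ('cV[R]_d -> R^o)).
Local Notation a := (inv_form Om A).
Local Notation m := (ip Om).
Local Notation b := (fun q v => ip Om (wdiv Om q) v).
Local Notation G := (bdry_pairing Om M hs g).
Local Notation F := (fun v => alpha * ip Om f v + ip Om psi0 v).
Local Notation U := (fun psi w => ip Om (superposition Ups psi) w).

Let SL2 q : S q -> inL2v Om q. Proof. by case=> -[]. Qed.
Let SH q : S q -> inHdiv Om q. Proof. by case. Qed.
Let VL2 v : V v -> inL2 Om v. Proof. by case. Qed.
Let VLoo v : V v -> inLinfty Om v. Proof. exact: Vh_Linfty hOm hM v. Qed.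
Let divL2 q : S q -> inL2 Om (wdiv Om q). Proof. by move/SH/wdivP => -[]. Qed.

Lemma inv_form_inner_product : inner_product_on S a.
Proof.
split.
- by move=> w Sw c u v Su Sv; apply: inv_form_linl => //; exact: SL2.
- by move=> u v Su Sv; apply: inv_form_sym => //; exact: SL2.
- by move=> u Su; case: (inv_form_pos oOm hA (SL2 Su)).
Qed.

Lemma ip_inner_product : inner_product_on V m.
Proof.
split=> [w Vw c u v Vu Vv|u v _ _|u _].
- by apply: ip_linl => //; exact: VL2.
- exact: ipC.
- exact: ip_ge0.
Qed.

Let anull q : S q -> a q q = 0 -> ae_on Om (fun x => q x = 0).
Proof. by move=> Sq; case: (inv_form_pos oOm hA (SL2 Sq)). Qed.

Let mnull v : V v -> m v v = 0 -> ae_on Om (fun x => v x = 0).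
Proof. by move=> Vv; apply: ip_eq0 => //; exact: VL2. Qed.

Lemma mixed_solutionE q u psi : mixed_solution Om hs A Ups M p f g alpha psi0 q u psi <->
  abstract_solution S V a m b G F U alpha q u psi.
Proof.
split=> -[H1 [H2 H3 H4]]; split => //; split=> // w Vw; have := H4 w Vw.
- by move=> /eqP; rewrite subr_eq0 => /eqP.
- by move=> ->; rewrite subrr.
Qed.

Let bl v : V v -> linear_on S (fun q => b q v).
Proof.
move=> Vv c q r Sq Sr; rewrite -ip_linl//; [|exact: divL2|exact: divL2|exact: VL2].
apply: ip_ae_eq => //.
- by apply: divL2; have [_] := Sigmah_div_subspace M p hOm; exact.
- by apply: inL2_lin => //; exact: divL2.
- exact: VL2.
- exact: VL2.
- by apply: wdiv_lin => //; exact: SH.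
- exact: ae_onW.
Qed.

Let br q : S q -> linear_on V (b q).
Proof.
by move=> Sq c u v Vu Vv; apply: ip_linr => //; [exact: VL2|exact: VL2|exact: divL2].
Qed.

Let bl0 v : V v -> null_compat S a (fun q => b q v).
Proof.
move=> Vv z Sz /(anull Sz) z0; apply: ip_null => //; [exact: divL2|exact: VL2|].
by apply: wdiv_null => //; exact: SH.
Qed.

Let ipr_null u v : inL2 Om u -> V v -> m v v = 0 -> m u v = 0.
Proof.
by move=> L2u Vv /(mnull Vv) v0; rewrite ipC ip_null//; exact: VL2.
Qed.

Let br0 q : S q -> null_compat V m (b q).
Proof. by move=> Sq z Vz; apply: ipr_null => //; exact: divL2. Qed.

Let lG : linear_on S G.
Proof.
move=> c q r Sq Sr; apply: (bdry_pairing_lin hOm hM hg (p := p)).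
- by case: Sq.
- by case: Sr.
- by have [_ /(_ c _ _ Sq Sr)[]] := Sigmah_div_subspace M p hOm.
Qed.

Let G0 : null_compat S a G.
Proof.
move=> z Sz /(anull Sz) z0; apply: (bdry_pairing_null g hOm hM (p := p)) => //.
by case: Sz.
Qed.

Let lF : linear_on V F.
Proof.
move=> c u v Vu Vv; rewrite !ip_linr//; try exact: VL2.
ring.
Qed.

Let F0 : null_compat V m F.
Proof.
move=> z Vz z0.
by rewrite (ipr_null hf Vz z0) (ipr_null (VL2 hpsi) Vz z0) mulr0 addr0.
Qed.

Let UL2 psi : V psi -> inL2 Om (superposition Ups psi).
Proof. by move=> Vpsi; exact: (superposition_L2 oOm bOm hUps (VLoo Vpsi)). Qed.

Let lU psi : V psi -> linear_on V (U psi).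
Proof.
by move=> Vpsi c u v Vu Vv; apply: ip_linr => //; [exact: VL2|exact: VL2|exact: UL2].
Qed.

Let U0 psi : V psi -> null_compat V m (U psi).
Proof. by move=> Vpsi z Vz; apply: ipr_null => //; exact: UL2. Qed.

Let Umono psi phi : V psi -> V phi -> U phi (psi - phi) <= U psi (psi - phi).
Proof.
by move=> Vpsi Vphi; exact: (superposition_monotone oOm bOm hUps (VLoo Vpsi) (VLoo Vphi)).
Qed.

Let Uext psi phi : V psi -> V phi -> m (psi - phi) (psi - phi) = 0 ->
  forall w, V w -> U psi w = U phi w.
Proof.
move=> Vpsi Vphi d0 w Vw.
apply: (superposition_ae_eq oOm bOm hUps (VLoo Vpsi) (VLoo Vphi) (VL2 Vw)).
have := mnull (subspaceB (Vh_subspace M p hOm) Vpsi Vphi) d0.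
by apply: ae_onS => x _ /eqP; rewrite subr_eq0 => /eqP.
Qed.

Let Ucont n (y : 'I_n -> ('cV[R]_d -> R^o)) (c : nat -> 'I_n -> R) l w :
  (forall j, V (y j)) -> V w -> coord_cvg c l ->
  U (\sum_j c k j *: y j) w @[k --> \oo] --> U (\sum_j l j *: y j) w.
Proof.
move=> Vy Vw cl.
have E (e : 'I_n -> R) : \sum_j e j *: y j = (fun x => \sum_j e j * y j x) :> ('cV[R]_d -> R^o).
  by apply/funext => x; rewrite fct_sumE.
rewrite E; under eq_fun do rewrite E.
apply: (superposition_continuous oOm bOm hUps) => // [j|]; [exact: VLoo|exact: VL2].
Qed.

Let sS : subspace S. Proof. exact: (Sigmah_div_subspace M p hOm). Qed.
Let sV : subspace V. Proof. exact: (Vh_subspace M p hOm). Qed.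

Lemma mixed_solution_exists :
  exists q u psi, mixed_solution Om hs A Ups M p f g alpha psi0 q u psi.
Proof.
have [nV [y basy]] := Vh_basis p hOm hM.
have [nS [x basx]] : exists n (e : 'I_n -> ('cV[R]_d -> 'cV[R]_d)), orthonormal_basis S a e.
  apply: (Sigmah_div_basis hOm hM); first exact: inv_form_inner_product.
  by move=> q Sq q0; apply: inv_form_null => //; exact: SL2.
have Vy j : V (y j) by case: basy.
have [q [u [psi H]]] := abstract_solution_exists sS sV inv_form_inner_product
  ip_inner_product basx basy bl br bl0 br0 lG G0 lF F0 lU U0 Umono
  (fun c l w => Ucont (c := c) (l := l) (w := w) Vy) alpha0.
by exists q, u, psi; apply/mixed_solutionE.
Qed.

Lemma mixed_solution_unique q u psi q' u' psi' :
  mixed_solution Om hs A Ups M p f g alpha psi0 q u psi ->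
  mixed_solution Om hs A Ups M p f g alpha psi0 q' u' psi' ->
  [/\ ae_on Om (fun x => q' x = q x), ae_on Om (fun x => u' x = u x)
    & ae_on Om (fun x => psi' x = psi x)].
Proof.
move=> /mixed_solutionE H /mixed_solutionE H'.
have [a0 u0 p0] := abstract_solution_unique sS sV inv_form_inner_product
  ip_inner_product bl br bl0 Umono Uext alpha0 H H'.
have [[Sq Vu Vp] _] := H; have [[Sq' Vu' Vp'] _] := H'.
split.
- have := anull (subspaceB sS Sq' Sq) a0.
  by apply: ae_onS => x _ /eqP; rewrite subr_eq0 => /eqP.
- have := mnull (subspaceB sV Vu' Vu) u0.
  by apply: ae_onS => x _ /eqP; rewrite subr_eq0 => /eqP.
- have := mnull (subspaceB sV Vp' Vp) p0.
  by apply: ae_onS => x _ /eqP; rewrite subr_eq0 => /eqP.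
Qed.

(* Since [div Sigma_h] lies in [V_h], testing [U psi] against a divergence is
   testing its projection [u]. *)
Lemma mixed_reduced q u psi : mixed_solution Om hs A Ups M p f g alpha psi0 q u psi ->
  reduced_solution Om hs A Ups M p f g alpha psi0 q psi.
Proof.
move=> [[Sq Vu Vp] [E1 E2 E3]]; split => // v Sv; rewrite -E2//; congr (_ - _).
rewrite [LHS]ipC [RHS]ipC; apply/esym/eqP; rewrite -subr_eq0; apply/eqP.
by apply: E3; exact: wdiv_Vh hOm hM _ Sv.
Qed.

(** Completing a reduced solution in this way lets the uniqueness result for the mixed problem apply
    to it. *)
Lemma reduced_mixed q psi : reduced_solution Om hs A Ups M p f g alpha psi0 q psi ->
  exists u, mixed_solution Om hs A Ups M p f g alpha psi0 q u psi.
Proof.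
move=> [Sq Vp E2 E1].
have [nV [y basy]] := Vh_basis p hOm hM; have [Vy oy _] := basy.
(* The [L^2] projection of [U psi] onto [V_h], written in an orthonormal basis. *)
pose u : 'cV[R]_d -> R^o := \sum_j U psi (y j) *: y j.
have Vu : V u by exact: subspace_sum.
have E3 w : V w -> m u w = U psi w.
  move=> Vw; apply/eqP; rewrite -subr_eq0; apply/eqP; move: w Vw.
  apply: (orthonormal_basis_ext sV ip_inner_product basy) => [c v w Vv Vw|z Vz z0|j].
  - rewrite (inner_product_linear_on sV ip_inner_product Vu)// (lU Vp)//; ring.
  - by rewrite (ipr_null (VL2 Vu) Vz z0) (ipr_null (UL2 Vp) Vz z0) subrr.
  - rewrite /u; have [lm _ _] := ip_inner_product.
    rewrite (linear_on_sum _ sV (lm _ (Vy j)) Vy) (bigD1 j)//= big1 ?addr0.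
      by rewrite oy eqxx mulr1 subrr.
    by move=> k kj; rewrite oy (negbTE kj) mulr0.
exists u; split => //; split => // [v Sv|w Vw]; last by rewrite E3// subrr.
rewrite -E2//; congr (_ - _); rewrite [LHS]ipC [RHS]ipC.
by apply: E3; exact: wdiv_Vh hOm hM _ Sv.
Qed.

End proximal_step.

Theorem theorem4p2 (R : realType) (d : nat) (hd : d = 2%N \/ d = 3%N)
  (Om : set 'cV[R]_d) (hs : seq ('cV[R]_d * R))
  (hOm : polyhedral_domain Om hs)
  (A : 'cV[R]_d -> 'M[R]_d) (hA : elliptic_coeff Om A)
  (lb : 'cV[R]_d -> R) (ub : option ('cV[R]_d -> R))
  (hobs : obstacles Om lb ub)
  (Ups : 'cV[R]_d -> R -> R) (hUps : latent_map Om lb ub Ups)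
  (M : mesh R d) (kappa : R)
  (hM : conforming Om M) (hreg : shape_regular M kappa)
  (p : nat)
  (f : 'cV[R]_d -> R) (hf : inL2 Om f)
  (g : 'cV[R]_d -> R) (hg : inH12_bdry Om hs g)
  (psi : nat -> 'cV[R]_d -> R) (hpsi0 : Vh Om M p (psi 0%N))
  (alpha : nat -> R) (halpha : forall k, (1 <= k)%N -> 0 < alpha k)
  (k : nat) (hk : (1 <= k)%N) (hpsi : Vh Om M p (psi k.-1)) :
  (exists q u ps,
     mixed_solution Om hs A Ups M p f g (alpha k) (psi k.-1) q u ps /\
     forall q' u' ps',
       mixed_solution Om hs A Ups M p f g (alpha k) (psi k.-1) q' u' ps' ->
       [/\ ae_on Om (fun x => q' x = q x), ae_on Om (fun x => u' x = u x)
         & ae_on Om (fun x => ps' x = ps x)]) /\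
  (exists q ps,
     reduced_solution Om hs A Ups M p f g (alpha k) (psi k.-1) q ps /\
     forall q' ps',
       reduced_solution Om hs A Ups M p f g (alpha k) (psi k.-1) q' ps' ->
       ae_on Om (fun x => q' x = q x) /\ ae_on Om (fun x => ps' x = ps x)).
Proof.
have alpha0 := halpha k hk.
have [q [u [ps H]]] := mixed_solution_exists hOm hA hUps hM hf hg hpsi alpha0.
have uniq := mixed_solution_unique hOm hA hUps hM alpha0 H.
split; first by exists q, u, ps; split.
exists q, ps; split=> [|q' ps' H']; first exact: (mixed_reduced hOm hM H).
(* A competing reduced solution is completed to a mixed one, whose components agree with those
   already found. *)
by have [u' /uniq[]] := reduced_mixed hOm hUps hM H'; split.
Qed.
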